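(* Let $1\le N<\infty$, $\mathbb S=\{1,\dots,N\}$, $b:\mathbb R^n\times\mathbb S\to\mathbb R^n$ and $\sigma:\mathbb R^n\times\mathbb S\to\mathbb R^{n\times m}$. Assume the following. (1) There is $L>0$ such that $|b(x,i)-b(y,i)|+\|\sigma(x,i)-\sigma(y,i)\|\le L|x-y|$ for all $i\in\mathbb S$, $x,y\in\mathbb R^n$. (2) There exist $c_0>0$ and $\beta_1,\dots,\beta_N\in\mathbb R$ such that for all $i\in\mathbb S$ and $x,y\in\mathbb R^n$: $2\langle x,b(x,i)\rangle+\|\sigma(x,i)\|^2\le c_0+\beta_i|x|^2$ and $2\langle x-y,b(x,i)-b(y,i)\rangle+\|\sigma(x,i)-\sigma(y,i)\|^2\le\beta_i|x-y|^2$. (3) $\sum_{i=1}^N\mu_i\beta_i<0$, where $\mu$ is the stationary distribution of $\{\Lambda_t\}_{t\ge0}$. (4) $\min_{i\in\mathbb S,\ \beta_i>0}\{-q_{ii}/\beta_i\}>1$. With $\eta_2$ and $\beta>0$ as defined in the context, for every stepsize $\delta\in(0,1)$ with $$\delta<\frac1{32L^2}\wedge\Big(\frac{\eta_2}{\beta}\Big)^2,$$ the Euler-Maruyama chain $(\bar Y_{k\delta}^{x,i},\Lambda_{k\delta}^i)_{k\ge0}$ admits a unique invariant measure $\pi^\delta\in\mathcal P(\mathbb R^n\times\mathbb S)$.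
   Context: $\{W_t\}_{t\ge0}$ is an $m$-dimensional Brownian motion and $\{\Lambda_t\}_{t\ge0}$ is an independent continuous-time Markov chain on $\mathbb S$ with irreducible conservative $Q$-matrix $Q=(q_{ij})_{N\times N}$. Its unique stationary distribution is $\mu=(\mu_1,\dots,\mu_N)$, with all $\mu_i>0$. $\Lambda^i$ denotes the chain started at $i$. $\|\cdot\|$ is the Hilbert-Schmidt norm, $a\wedge b=\min\{a,b\}$, a minimum over the empty set is $+\infty$, and $\mathcal P(\mathbb R^n\times\mathbb S)$ is the set of probability measures on $\mathbb R^n\times\mathbb S$. The Euler-Maruyama scheme for $dX_t=b(X_t,\Lambda_t)\,dt+\sigma(X_t,\Lambda_t)\,dW_t$ with stepsize $\delta\in(0,1)$ is $$\bar Y_{(k+1)\delta}^{x,i}=\bar Y_{k\delta}^{x,i}+b(\bar Y_{k\delta}^{x,i},\Lambda_{k\delta}^i)\delta+\sigma(\bar Y_{k\delta}^{x,i},\Lambda_{k\delta}^i)\,(W_{(k+1)\delta}-W_{k\delta}),\quad k\ge0,\quad \bar Y_0^{x,i}=x,\ \Lambda_0^i=i.$$ The pair $(\bar Y_{k\delta}^{x,i},\Lambda_{k\delta}^i)$ is a time-homogeneous Markov chain on $\mathbb R^n\times\mathbb S$ with transition kernel $P^\delta_{k\delta}(x,i;dy\times\{j\})$. A measure $\pi^\delta\in\mathcal P(\mathbb R^n\times\mathbb S)$ is invariant for it if $\pi^\delta(\Gamma\times\{i\})=\sum_{j=1}^N\int_{\mathbb R^n}P^\delta_{k\delta}(x,j;\Gamma\times\{i\})\,\pi^\delta(dx\times\{j\})$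 for all $k\ge0$, Borel $\Gamma\subseteq\mathbb R^n$, $i\in\mathbb S$. Set $Q_2:=Q+\mathrm{diag}(\beta_1,\dots,\beta_N)$ and $\eta_2:=-\max_{\gamma\in\mathrm{spec}(Q_2)}\mathrm{Re}\,\gamma$. Under (3) and (4) one has $\eta_2>0$, and there is an eigenvector $\xi^{(2)}=(\xi^{(2)}_1,\dots,\xi^{(2)}_N)$ with all entries strictly positive and $Q_2\xi^{(2)}=-\eta_2\xi^{(2)}$. Put $\hat\xi_2:=\max_i\xi_i^{(2)}$, $\bar\xi_2:=(\min_i\xi_i^{(2)})^{-1}$, $\beta_0:=\max_i|\beta_i|$, $q_0:=\max_i(-q_{ii})$ and $$\beta:=\{(1+12q_0)\beta_0+8L^2(5+6\beta_0)\}\,\hat\xi_2\,\bar\xi_2.$$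
   Formalization: η₂>0 is assumed explicitly: (3) and (4) do not imply it. For Q=[[-3/2,3/2],[1,-1]], β=(1,-1), both hold but det Q₂=-1/2<0, so η₂<0; and if η₂<0 is allowed, the claim itself can fail. *)

(* Defs.v *)
From HB Require Import structures.
From mathcomp Require Export all_boot all_order all_algebra.
From mathcomp Require Export all_classical all_reals all_analysis.
From mathcomp Require Import complex.
Export Order.TTheory GRing.Theory Num.Theory.
Export numFieldNormedType.Exports.

Set Implicit Arguments.
Unset Strict Implicit.
Unset Printing Implicit Defensive.

Local Open Scope classical_set_scope.
Local Open Scope ring_scope.

Section euclidean.
Context {R : realType}.

Definition inner n (x y : 'cV[R]_n) : R := \sum_i x i 0 * y i 0.

(* On column vectors this is the Euclidean norm.  The library norm `|A| on
   matrices is the maximum of the entries and is not the one used here. *)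
Definition hsnorm p q (A : 'M[R]_(p, q)) : R :=
  Num.sqrt (\sum_i \sum_j A i j ^+ 2).

End euclidean.

(* Matrix spaces, in particular R^n = 'cV[R]_n, carry their Borel
   sigma-algebra. *)
HB.instance Definition _ (R : realType) (p q : nat) :=
  @isMeasurable.Build default_measure_display 'M[R]_(p, q)
    <<s @open 'M[R]_(p, q) >>
    (@sigma_algebra0 _ _ _) (@sigma_algebraC _ _) (@sigma_algebra_bigcup _ _ _).

(* The library requires measurable types to be inhabited, whence the indexing
   of a nonempty finite state space by 'I_N.+1. *)
HB.instance Definition _ (N : nat) := isPointed.Build 'I_N.+1 ord0.
HB.instance Definition _ (N : nat) :=
  @isMeasurable.Build default_measure_display 'I_N.+1
    (discrete_measurable : set (set 'I_N.+1)) discrete_measurable0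
    discrete_measurableC discrete_measurableU.

Section chain_generator.
Context {R : realType} {N : nat}.
Implicit Types (Q : 'M[R]_N.+1) (Pt : R -> 'M[R]_N.+1).

Definition conservative Q : Prop :=
  (forall i j, i != j -> 0 <= Q i j) /\ (forall i, \sum_j Q i j = 0).

Definition irreducible Q : Prop :=
  forall i j, connect [rel k l | 0 < Q k l] i j.

(* Pt is the transition function (P_t)_{t >= 0} with Q-matrix Q = P'(0+). *)
Definition transition_function Q Pt : Prop :=
  [/\ forall t i j, 0 <= t -> 0 <= Pt t i j,
      forall t i, 0 <= t -> \sum_j Pt t i j = 1,
      Pt 0 = 1%:M,
      forall s t, 0 <= s -> 0 <= t -> Pt (s + t) = Pt s *m Pt t
    & forall i j, (Pt h i j - (i == j)%:R) / h @[h --> 0^'+] --> Q i j].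

Definition stationary Pt (mu : 'rV[R]_N.+1) : Prop :=
  [/\ forall i, 0 <= mu 0 i,
      \sum_i mu 0 i = 1
    & forall t, 0 <= t -> mu *m Pt t = mu].

End chain_generator.

Section processes.
Context {R : realType} {d : measure_display} {Omega : measurableType d}.
Variable P : probability Omega R.

(* Allowing B i = setT makes the product rule for the whole finite family
   imply it for every subfamily. *)
Definition mutually_independent (I : finType) (X : I -> Omega -> R) : Prop :=
  forall B : I -> set R, (forall i, measurable (B i)) ->
    P (\bigcap_i (X i @^-1` B i)) = (\prod_i P (X i @^-1` B i))%E.

(* The processes are indexed by all of R; only their values at times t >= 0
   are constrained or used. *)
Definition process_sigma d' (T : measurableType d') (X : R -> Omega -> T) :
    set (set Omega) :=
  <<s [set A | exists t B, [/\ 0 <= t, measurable B & A = X t @^-1` B]] >>.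

Definition independent_processes d1 (T1 : measurableType d1)
    d2 (T2 : measurableType d2)
    (X : R -> Omega -> T1) (Y : R -> Omega -> T2) : Prop :=
  forall A B, process_sigma X A -> process_sigma Y B ->
    P (A `&` B) = (P A * P B)%E.

(* The second parameter of normal_prob is the standard deviation. *)
Definition brownian_motion m (W : R -> Omega -> 'cV[R]_m) : Prop :=
  [/\ forall t, 0 <= t -> measurable_fun setT (W t),
      {ae P, forall w, W 0 w = 0},
      {ae P, forall w, {within `[0, +oo[, continuous (fun t => W t w)}},
      forall k (t : nat -> R), 0 <= t 0%N ->
        {homo t : a b / (a < b)%N >-> a < b} ->
        mutually_independent (fun (p : 'I_k * 'I_m) w =>
          (W (t p.1.+1) w - W (t p.1) w) p.2 0)
    & forall s t c (B : set R), 0 <= s -> s < t -> measurable B ->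
        P [set w | B ((W t w - W s w) c 0)] =
        normal_prob 0 (Num.sqrt (t - s)) B].

(* Continuous-time Markov chain with transition function Pt started at i,
   through its finite-dimensional distributions. *)
Definition markov_chain N (Pt : R -> 'M[R]_N.+1) (i : 'I_N.+1)
    (Lam : R -> Omega -> 'I_N.+1) : Prop :=
  (forall t, 0 <= t -> measurable_fun setT (Lam t)) /\
  forall k (t : nat -> R) (s : nat -> 'I_N.+1), t 0%N = 0 ->
    {homo t : a b / (a <= b)%N >-> a <= b} ->
    P [set w | forall a, (a <= k)%N -> Lam (t a) w = s a] =
    ((s 0%N == i)%:R *
     \prod_(0 <= a < k) Pt (t a.+1 - t a) (s a) (s a.+1))%:E.

End processes.

Section euler_maruyama.
Context {R : realType} {d : measure_display} {Omega : measurableType d}.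
Variable P : probability Omega R.
Context {n m N : nat}.
Variables (b : 'cV[R]_n -> 'I_N.+1 -> 'cV[R]_n)
  (sigma : 'cV[R]_n -> 'I_N.+1 -> 'M[R]_(n, m))
  (W : R -> Omega -> 'cV[R]_m)
  (* Lam i is the chain started at i *)
  (Lam : 'I_N.+1 -> R -> Omega -> 'I_N.+1)
  (delta : R).

Fixpoint EM (x : 'cV[R]_n) (i : 'I_N.+1) (k : nat) (w : Omega) : 'cV[R]_n :=
  if k is k'.+1 then
    let y := EM x i k' w in
    let j := Lam i (k'%:R * delta) w in
    y + delta *: b y j
      + sigma y j *m (W (k'.+1%:R * delta) w - W (k'%:R * delta) w)
  else x.

Definition EM_kernel (k : nat) (z : 'cV[R]_n * 'I_N.+1)
    (A : set ('cV[R]_n * 'I_N.+1)) : \bar R :=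
  P [set w | A (EM z.1 z.2 k w, Lam z.2 (k%:R * delta) w)].

Definition EM_invariant
    (pi : probability ('cV[R]_n * 'I_N.+1)%type R) : Prop :=
  forall (k : nat) (G : set 'cV[R]_n) (i : 'I_N.+1), measurable G ->
    pi (G `*` [set i]) =
    (\sum_(j < N.+1) \int[pi]_(z in setT `*` [set j])
       EM_kernel k z (G `*` [set i]))%E.

End euler_maruyama.

Section constants.
Context {R : realType} {N : nat}.
Implicit Types (Q : 'M[R]_N.+1) (bet : 'I_N.+1 -> R) (xi : 'cV[R]_N.+1).

Definition Q2 Q bet : 'M[R]_N.+1 := Q + diag_mx (\row_i bet i).

Definition spec_Re (A : 'M[R]_N.+1) : set R :=
  [set complex.Re z | z in
    [set z | eigenvalue (map_mx (complex.real_complex R) A) z]].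

(* spec is finite and nonempty, so sup is a maximum *)
Definition eta2 Q bet : R := - sup (spec_Re (Q2 Q bet)).

(* Below, 0 is a neutral starting value because the entries are positive or
   nonnegative; in min_xi the neutral starting value is the maximum. *)
Definition max_xi xi : R := \big[Num.max/0]_i xi i 0.
Definition min_xi xi : R := \big[Num.min/max_xi xi]_i xi i 0.
Definition beta0 bet : R := \big[Num.max/0]_i `|bet i|.
Definition q0 Q : R := \big[Num.max/0]_i (- Q i i).

Definition beta_const (L : R) Q bet xi : R :=
  ((1 + 12 * q0 Q) * beta0 bet + 8 * L ^+ 2 * (5 + 6 * beta0 bet))
  * max_xi xi * (min_xi xi)^-1.

End constants.

(* Main.v *)
From HB Require Import structures.
Require Import Defs.
From mathcomp Require Import measurable_realfun normal_distribution lra ring.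

Set Implicit Arguments.
Unset Strict Implicit.
Unset Printing Implicit Defensive.

Local Open Scope classical_set_scope.
Local Open Scope ring_scope.

(** The chain is a random iteration of the maps
      F_i(y, z) = y + delta b(y, i) + sigma(y, i) z,
    where z is a Brownian increment over one step and the regime i moves
    independently with the stochastic matrix A = P_delta.  Its one-step operator
    is  T f (x, i) = sum_j A_ij E f(F_i(x, Z), j).  Conditionally on the regimes
    visited the increments are still independent Gaussian vectors, so k steps of
    the chain act as T^k (em_expectation), and a law is invariant for the chain
    exactly when it is invariant for T (op_invariant_EM, EM_op_invariant).

    Contraction.  Two copies driven by the same noise and the same regimes
    satisfy  E |F_i(x, Z) - F_i(y, Z)|^2 <= lam_i |x - y|^2  with
    lam_i = 1 + delta beta_i + delta^2 L^2, by the one-sided and the Lipschitz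
    conditions (em_step_contraction, increment_quadratic).  Some lam_i may
    exceed 1; switching compensates, because the eigenvector xi of Q_2 satisfies
      lam_i (A xi)_i < xi_i   for every i                  (drift_contraction).
    To first order A xi = xi + delta Q xi with (Q xi)_i = -(eta + beta_i) xi_i,
    so the left side is xi_i - delta eta xi_i up to a remainder of order
    delta^2, and the bound on the step size says that the remainder is smaller
    than delta eta xi_i.  Consequently xi_i |x - y|^2 is multiplied by a factor
    rho < 1 in the mean at each step.

    Uniqueness.  If f(x, j) <= f(y, j) + e + c xi_j |x - y|^2 for all x, y, j,
    then T f satisfies the same inequality with rho c in place of c
    (quadratic_modulus_step).  A bounded Lipschitz function satisfies it for
    every e > 0, with c depending on e, so T^k f depends in the limit on the
    regime alone.  Hence two invariant laws with the same regime marginal agree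
    (op_invariant_unique).  The marginals do agree: they are stationary for A,
    whose entries are positive by irreducibility (transition_positive,
    positive_stationary_unique).

    Existence.  Fix the present and start the recursion at the origin k steps in
    the past, along a stationary path of regimes.  Moving the start one step
    further back changes the present value by an amount with mean square at most
    M rho^k (gap_sum_bound), so the present values converge almost surely
    (ae_cvg_geometric_gaps).  Passing from k to k + 1 amounts to applying T, so
    the law of the limit is invariant (limit_law_step).  No compactness or
    tightness is involved.  The stationary regimes, extended indefinitely into
    the past, are read off a single uniform variable through nested
    subdivisions of the unit interval (word_prob). *)

(** * Short-time expansion of the transition semigroup *)

Section semigroup_expansion.
Context {R : realType} {N : nat} (Q : 'M[R]_N.+1) (Pt : R -> 'M[R]_N.+1).
Hypothesis hPt : transition_function Q Pt.
Implicit Types v : 'cV[R]_N.+1.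

Lemma stochastic_contraction t v (K : R) : 0 <= t ->
  (forall i, `|v i 0| <= K) -> forall i, `|(Pt t *m v) i 0| <= K.
Proof.
case: hPt => P0 P1 _ _ _ t0 vK i; rewrite mxE.
apply: le_trans (ler_norm_sum _ _ _) _.
rewrite -[leRHS]mul1r -(P1 t i t0) mulr_suml; apply: ler_sum => j _.
by rewrite normrM (ger0_norm (P0 _ _ _ t0)) ler_wpM2l// P0.
Qed.

(** The entrywise derivative at 0 becomes a bound uniform in the state because
    there are finitely many states. *)
Lemma generator_at0 v (e : R) : 0 < e -> exists2 h0, 0 < h0 &
  forall h, 0 < h -> h < h0 -> forall i,
    `|(Pt h *m v - v - h *: (Q *m v)) i 0| <= h * e.
Proof.
case: hPt => _ _ _ _ Qlim e0.
have S0 : 0 < 1 + \sum_j `|v j 0| by rewrite ltr_pwDl// sumr_ge0.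
have [h0 h00 H] : exists2 h0, 0 < h0 & forall h, 0 < h -> h < h0 -> forall i j,
    `|Q i j - (Pt h i j - (i == j)%:R) / h| < e / (1 + \sum_j `|v j 0|).
  have : \forall h \near (0:R)^'+, forall i j : 'I_N.+1,
    `|Q i j - (Pt h i j - (i == j)%:R) / h| < e / (1 + \sum_j `|v j 0|).
    apply: filter_forall => i; apply: filter_forall => j.
    by move/cvgrPdist_lt: (Qlim i j); apply; rewrite divr_gt0.
  move=> [r /= r0 Hr]; exists r => // h h0 hr; apply: Hr => //=.
  by rewrite sub0r normrN gtr0_norm.
exists h0 => // h hp hh i; rewrite !mxE.
have -> : v i 0 = \sum_j (i == j)%:R * v j 0.
  rewrite (bigD1 i)//= eqxx mul1r big1 ?addr0// => j ji.
  by rewrite eq_sym (negbTE ji) mul0r.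
rewrite -sumrB mulr_sumr -sumrB.
apply: le_trans (ler_norm_sum _ _ _) _.
apply: (@le_trans _ _ (\sum_j h * (e / (1 + \sum_j `|v j 0|)) * `|v j 0|)).
  apply: ler_sum => j _; rewrite -mulrBl mulrA -mulrBl normrM ler_wpM2r//.
  have -> : Pt h i j - (i == j)%:R - h * Q i j =
      - (h * (Q i j - (Pt h i j - (i == j)%:R) / h)).
    by field; rewrite gt_eqF.
  by rewrite normrN normrM gtr0_norm// ler_wpM2l ?(ltW hp)// ltW// H.
rewrite -mulr_sumr -!mulrA ler_wpM2l ?(ltW hp)// ler_piMr ?(ltW e0)//.
by rewrite mulrC ler_pdivrMr// mul1r lerDr.
Qed.

(** Telescoping over a fine subdivision of [0, t]: each small increment costs
    h (K + o(1)), and multiplication by the stochastic matrices in front does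
    not increase it.  This replaces differentiability at positive times. *)
Lemma semigroup_increment t v (K : R) : 0 <= t ->
  (forall i, `|(Q *m v) i 0| <= K) ->
  forall i, `|(Pt t *m v - v) i 0| <= t * K.
Proof.
case: (hPt) => _ _ P0 PD _; rewrite le_eqVlt => /predU1P[<- _ i|t0 QvK i].
  by rewrite P0 mul1mx subrr mxE normr0 mul0r.
apply/ler_addgt0Pr => e e0.
have [h0 h00 Hh] := generator_at0 v (divr_gt0 e0 t0).
have [M] := ltr_add_invr (mulr_gt0 (ltr01 : 0 < (1 : R)) (divr_gt0 h00 t0)).
rewrite add0r mul1r ltr_pdivlMr// => tM.
set h := M.+1%:R^-1 * t in tM.
have hp : 0 < h by rewrite mulr_gt0// invr_gt0.
have tE : t = M.+1%:R * h by rewrite mulrA mulfV ?mul1r// pnatr_eq0.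
suff main k j : `|(Pt (k%:R * h) *m v - v) j 0| <= k%:R * h * (K + e / t).
  rewrite {1}tE (le_trans (main _ _))// -tE mulrDr mulrCA divff ?mulr1//.
  by rewrite gt_eqF.
elim: k j => [|k IH] j.
  by rewrite !mul0r P0 mul1mx subrr mxE normr0.
have kh : 0 <= k%:R * h by rewrite mulr_ge0// ltW.
have hS : k.+1%:R * h = k%:R * h + h by rewrite -natr1 mulrDl mul1r.
have -> : Pt (k.+1%:R * h) *m v - v =
    Pt (k%:R * h) *m (Pt h *m v - v) + (Pt (k%:R * h) *m v - v).
  rewrite hS PD ?(ltW hp)// mulmxBr mulmxA.
  by rewrite addrA subrK.
rewrite mxE (le_trans (ler_normD _ _))// hS mulrDl addrC.
rewrite lerD//; apply: stochastic_contraction => // l.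
rewrite -[_ - v](subrK (h *: (Q *m v))) mxE (le_trans (ler_normD _ _))//.
rewrite mulrDr addrC lerD ?Hh// mxE normrM gtr0_norm// ler_wpM2l//; exact: ltW.
Qed.

(** Second-order version of the same telescoping: over the k-th small step the
    linear term h Q v is transported by P_(kh), which displaces it by at most
    h t K according to semigroup_increment applied to Q v. *)
Lemma semigroup_expansion t v (K : R) : 0 <= t ->
  (forall i, `|(Q *m (Q *m v)) i 0| <= K) ->
  forall i, `|(Pt t *m v - v - t *: (Q *m v)) i 0| <= t ^+ 2 * K.
Proof.
case: (hPt) => _ _ P0 PD _; rewrite le_eqVlt => /predU1P[<- _ i|t0 QvK i].
  by rewrite P0 mul1mx subrr scale0r subrr mxE normr0 expr0n/= mul0r.
have K0 : 0 <= K by apply: le_trans (QvK i).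
apply/ler_addgt0Pr => e e0.
have [h0 h00 Hh] := generator_at0 v (divr_gt0 e0 t0).
have [M] := ltr_add_invr (mulr_gt0 (ltr01 : 0 < (1 : R)) (divr_gt0 h00 t0)).
rewrite add0r mul1r ltr_pdivlMr// => tM.
set h := M.+1%:R^-1 * t in tM.
have hp : 0 < h by rewrite mulr_gt0// invr_gt0.
have tE : t = M.+1%:R * h by rewrite mulrA mulfV ?mul1r// pnatr_eq0.
suff main k j : (k <= M.+1)%N ->
    `|(Pt (k%:R * h) *m v - v - (k%:R * h) *: (Q *m v)) j 0| <=
    k%:R * h * (t * K + e / t).
  rewrite {1 2}tE (le_trans (main _ _ _))// -tE le_eqVlt; apply/orP; left; apply/eqP.
  by field; rewrite gt_eqF.
elim: k j => [|k IH] j kM.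
  by rewrite !mul0r P0 mul1mx subrr scale0r subrr mxE normr0.
have kh : 0 <= k%:R * h by rewrite mulr_ge0// ltW.
have hS : k.+1%:R * h = k%:R * h + h by rewrite -natr1 mulrDl mul1r.
have -> : Pt (k.+1%:R * h) *m v - v - (k.+1%:R * h) *: (Q *m v) =
    Pt (k%:R * h) *m (Pt h *m v - v - h *: (Q *m v)) +
    h *: (Pt (k%:R * h) *m (Q *m v) - Q *m v) +
    (Pt (k%:R * h) *m v - v - (k%:R * h) *: (Q *m v)).
  rewrite hS PD ?(ltW hp)// !mulmxBr -scalemxAr -!mulmxA scalerDl scalerBr.
  move: (Q *m v) (Pt _ *m v) (Pt _ *m (Q *m v)) (Pt _ *m (Pt h *m v)) => x y z u.
  by apply/matrixP => l c; rewrite !mxE; ring.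
rewrite mxE (le_trans (ler_normD _ _))// hS mulrDl addrC.
rewrite lerD//; first exact/IH/ltnW.
rewrite mxE (le_trans (ler_normD _ _))// addrC mulrDr lerD//.
  rewrite mxE normrM gtr0_norm// ler_wpM2l ?(ltW hp)//.
  apply: le_trans (semigroup_increment kh QvK j) _.
  rewrite ler_wpM2r// tE ler_wpM2r ?(ltW hp)// ler_nat; exact: ltnW.
by apply: stochastic_contraction => // l; exact: Hh.
Qed.

End semigroup_expansion.

(** * Positivity of the transition matrix and the weighted drift condition *)

Section irreducible_semigroup.
Context {R : realType} {N : nat} (Q : 'M[R]_N.+1) (Pt : R -> 'M[R]_N.+1).
Hypothesis hPt : transition_function Q Pt.

(** For small h the entry Pt h i j is close to (i == j) + h Q i j, which is
    positive on the diagonal and along the edges of Q. *)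
Lemma small_time_positive : exists2 h0, 0 < h0 & forall h, 0 < h -> h < h0 ->
  forall i j, (i == j) || (0 < Q i j) -> 0 < Pt h i j.
Proof.
case: hPt => _ _ _ _ Qlim.
have : \forall h \near (0:R)^'+, forall i j : 'I_N.+1,
    (i == j) || (0 < Q i j) -> 0 < Pt h i j.
  apply: filter_forall => i; apply: filter_forall => j.
  have [ij|ij] := eqVneq i j.
    rewrite -ij; have /cvgrPdist_lt/(_ 1 ltr01) Hi := Qlim i i.
    near=> h => _.
    have h0 : 0 < h by near: h; exact: nbhs_right_gt.
    have hQ : h < (1 + `|Q i i|)^-1.
      by near: h; apply: nbhs_right_lt; rewrite invr_gt0 ltr_pwDl.
    have : `|Q i i - (Pt h i i - (i == i)%:R) / h| < 1 by near: h.
    rewrite eqxx/= ltr_distlC => /andP[+ _].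
    rewrite ltr_pdivlMr// ltrBrDr => Hh.
    rewrite (le_lt_trans _ Hh)//.
    have {}hQ : (1 + `|Q i i|) * h < 1.
      by rewrite mulrC -ltr_pdivlMr ?ltr_pwDl// div1r.
    have := ler_norm (- Q i i); rewrite normrN => nQ.
    have := ler_wpM2r (ltW h0) nQ; lra.
  have [Qp|Qn] := ltP 0 (Q i j); last by near=> h.
  have /cvgrPdist_lt/(_ _ Qp) Hij := Qlim i j.
  near=> h => _.
  have h0 : 0 < h by near: h; exact: nbhs_right_gt.
  have : `|Q i j - (Pt h i j - (i == j)%:R) / h| < Q i j by near: h.
  rewrite (negbTE ij) subr0 ltr_distlC subrr => /andP[+ _].
  by rewrite pmulr_lgt0// invr_gt0.
move=> [r /= r0 Hr]; exists r => // h hp hr; apply: Hr => //=.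
by rewrite sub0r normrN gtr0_norm.
Unshelve. all: by end_near. Qed.

(** Connect i to j by a path of Q and spend a time t / (K + 1) on each edge,
    waiting at the end point for the remaining steps. *)
Lemma transition_positive (hQ : irreducible Q) t : 0 < t ->
  forall i j, 0 < Pt t i j.
Proof.
case: (hPt) => Pge0 _ P0 PD _ t0 i j.
have [h0 h00 Hh] := small_time_positive.
have main k h : 0 < h -> h < h0 -> forall i p,
    path [rel k l | 0 < Q k l] i p -> (size p <= k)%N ->
    0 < Pt (k%:R * h) i (last i p).
  move=> hp hh0; elim: k => [|k IH] {}i p pP.
    rewrite leqn0 size_eq0 => /eqP ->/=.
    by rewrite mul0r P0 mxE eqxx ltr01.
  have hk : 0 <= k%:R * h by rewrite mulr_ge0// ltW.
  have -> : k.+1%:R * h = h + k%:R * h by rewrite -natr1 mulrDl mul1r addrC.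
  have step x y : 0 < Pt h i x -> 0 < Pt (k%:R * h) x y ->
      0 < Pt (h + k%:R * h) i y.
    move=> ix xy; rewrite PD ?(ltW hp)// mxE (bigD1 x)//= ltr_pwDl ?mulr_gt0//.
    by apply: sumr_ge0 => z _; rewrite mulr_ge0 ?Pge0 ?(ltW hp).
  case: p pP => [_ _|x p /= /andP[ix xp] sp] /=.
    by apply: (step i); [apply: Hh; rewrite ?eqxx|exact: (IH i [::])].
  by apply: (step x); [apply: Hh => //; rewrite ix orbT|exact: IH].
have /connectP[p pP ->] := hQ i j.
have [M] := ltr_add_invr (mulr_gt0 (ltr01 : 0 < (1 : R)) (divr_gt0 h00 t0)).
rewrite add0r mul1r ltr_pdivlMr// => tM.
pose K := maxn M (size p).
have tK : t / K.+1%:R < h0.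
  apply: le_lt_trans tM; rewrite mulrC ler_wpM2r ?(ltW t0)//.
  by rewrite lef_pV2 ?posrE// ler_nat ltnS leq_maxl.
have -> : t = K.+1%:R * (t / K.+1%:R) by rewrite mulrC divfK// pnatr_eq0.
by apply: main => //; [rewrite divr_gt0|rewrite leqW// leq_maxr].
Qed.

(** A stochastic matrix with positive entries strictly shrinks the l1-norm of
    vectors of total mass zero, because a common positive multiple of the
    counting measure can be subtracted from every row. *)
Lemma positive_stationary_unique (A : 'M[R]_N.+1) (x y : 'I_N.+1 -> R) :
  (forall i j, 0 < A i j) -> (forall i, \sum_j A i j = 1) ->
  (forall j, x j = \sum_i x i * A i j) -> (forall j, y j = \sum_i y i * A i j) ->
  \sum_j x j = \sum_j y j -> x =1 y.
Proof.
move=> A0 A1 xA yA xy.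
pose e := \big[Num.min/1]_(p : 'I_N.+1 * 'I_N.+1) A p.1 p.2.
have e0 : 0 < e by apply/bigmin_gtP; split => // p _.
have eA i j : e <= A i j by exact: (bigmin_le _ (i, j) (fun p => A p.1 p.2)).
(* Since z has total mass 0, subtracting the constant e from A leaves z A
   unchanged; the row sums of what remains are 1 - e (N + 1) < 1. *)
pose z j := x j - y j.
have z0 : \sum_j z j = 0 by rewrite sumrB xy subrr.
have zA j : z j = \sum_i z i * (A i j - e).
  under eq_bigr do rewrite mulrBr.
  rewrite sumrB -mulr_suml z0 mul0r subr0 {1}/z xA yA -sumrB.
  by apply: eq_bigr => i _; rewrite mulrBl.
have S1 : \sum_j `|z j| <= \sum_j \sum_i `|z i| * (A i j - e).
  apply: ler_sum => j _; rewrite {1}zA (le_trans (ler_norm_sum _ _ _))//.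
  apply: ler_sum => i _; rewrite normrM (@ger0_norm _ (A i j - e))//.
  by rewrite subr_ge0.
have S2 : \sum_j \sum_i `|z i| * (A i j - e) =
    (1 - e * N.+1%:R) * \sum_i `|z i|.
  rewrite exchange_big mulr_sumr; apply: eq_bigr => i _.
  rewrite -mulr_sumr sumrB A1 sumr_const card_ord mulr_natr.
  by rewrite mulrC.
have S0 : 0 <= \sum_i `|z i| by exact: sumr_ge0.
have zz : \sum_i `|z i| = 0.
  apply/eqP; rewrite eq_le S0 andbT leNgt; apply/negP => Sp.
  move: S1; rewrite S2 leNgt => /negP; apply.
  by rewrite gtr_pMl// ltrBlDr ltrDl mulr_gt0.
move=> i; apply/eqP; rewrite -subr_eq0 -normr_le0 -zz.
by rewrite (bigD1 i)//= lerDl sumr_ge0.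
Qed.

End irreducible_semigroup.

Section drift_contraction.
Context {R : realType} {N : nat} (Q : 'M[R]_N.+1) (Pt : R -> 'M[R]_N.+1).
Hypothesis hPt : transition_function Q Pt.
Hypothesis hQ : conservative Q.

Lemma beta0_ge (bet : 'I_N.+1 -> R) i : `|bet i| <= beta0 bet.
Proof. exact: (le_bigmax _ (fun i => `|bet i|) i). Qed.

Lemma q0_ge i : - Q i i <= q0 Q.
Proof. exact: (le_bigmax _ (fun i => - Q i i) i). Qed.

Lemma q0_ge0 : 0 <= q0 Q.
Proof. exact: bigmax_ge_id. Qed.

Lemma max_xi_ge (xi : 'cV[R]_N.+1) i : xi i 0 <= max_xi xi.
Proof. exact: (le_bigmax _ (fun i => xi i 0) i). Qed.

Lemma min_xi_le (xi : 'cV[R]_N.+1) i : min_xi xi <= xi i 0.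
Proof. exact: (bigmin_le _ i (fun i => xi i 0)). Qed.

Lemma min_xi_gt0 (xi : 'cV[R]_N.+1) : (forall i, 0 < xi i 0) -> 0 < min_xi xi.
Proof.
move=> xi0; apply/bigmin_gtP; split=> //.
exact: lt_le_trans (xi0 ord0) (max_xi_ge _ _).
Qed.

Lemma generator_bound (v : 'cV[R]_N.+1) K : (forall i, `|v i 0| <= K) ->
  forall i, `|(Q *m v) i 0| <= 2 * q0 Q * K.
Proof.
move=> vK i; case: hQ => Q0 Q1.
have K0 : 0 <= K by apply: le_trans (vK i).
rewrite mxE (le_trans (ler_norm_sum _ _ _))//.
apply: (@le_trans _ _ (\sum_j `|Q i j| * K)).
  by apply: ler_sum => j _; rewrite normrM ler_wpM2l.
rewrite -mulr_suml ler_wpM2r//.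
have E : Q i i + \sum_(j | j != i) Q i j = 0.
  by have := Q1 i; rewrite (bigD1 i).
rewrite (bigD1 i)//=.
have -> : \sum_(j | j != i) `|Q i j| = \sum_(j | j != i) Q i j.
  by apply: eq_bigr => j ji; rewrite ger0_norm// Q0// eq_sym.
have S0 : 0 <= \sum_(j | j != i) Q i j.
  by apply: sumr_ge0 => j ji; rewrite Q0// eq_sym.
have /ler0_norm -> : Q i i <= 0 by lra.
have := q0_ge i; lra.
Qed.

Variables (bet : 'I_N.+1 -> R) (xi : 'cV[R]_N.+1) (eta L delta : R).
Hypothesis xi_gt0 : forall i, 0 < xi i 0.
Hypothesis xi_eigen : Q2 Q bet *m xi = - eta *: xi.
Hypothesis eta_gt0 : 0 < eta.

Lemma generator_xi i : (Q *m xi) i 0 = - (eta + bet i) * xi i 0.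
Proof.
have /matrixP/(_ i 0) := xi_eigen; rewrite mulmxDl mul_diag_mx !mxE => h.
by lra.
Qed.

(** At a state where xi is minimal, Q xi is nonnegative. *)
Lemma eta_le_beta0 : eta <= beta0 bet.
Proof.
case: (@arg_minP _ _ _ ord0 xpredT (fun i => xi i 0) isT) => i _ imin.
have : 0 <= (Q *m xi) i 0.
  case: hQ => Q0 Q1.
  have -> : (Q *m xi) i 0 = \sum_j Q i j * (xi j 0 - xi i 0).
    under [RHS]eq_bigr do rewrite mulrBr.
    by rewrite sumrB -mulr_suml Q1 mul0r subr0 mxE.
  apply: sumr_ge0 => j _.
  have [->|ij] := eqVneq i j; first by rewrite subrr mulr0.
  by rewrite mulr_ge0 ?Q0// subr_ge0 imin.
rewrite generator_xi mulNr oppr_ge0 pmulr_lle0// => h.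
have := beta0_ge bet i; have := ler_norm (- bet i); rewrite normrN; lra.
Qed.

Hypothesis bet_lt_rate : forall i, 0 < bet i -> bet i < q0 Q.
Hypothesis bet_ge : forall i, - (2 * L) <= bet i.
Hypothesis L_gt0 : 0 < L.
Hypothesis delta_gt0 : 0 < delta.
Hypothesis delta_lt1 : delta < 1.
Hypothesis delta_L : delta < 1 / (32 * L ^+ 2).
Hypothesis delta_beta : delta < (eta / beta_const L Q bet xi) ^+ 2.

(** Insert the second-order expansion of the semigroup at xi, with
    Q xi = - (eta + bet) xi, into the product with lam.  The first-order terms
    add up to - delta eta xi_i; all other terms carry a factor delta^2 and are
    bounded separately (X1 to X4 in the proof) so that their sum is at most
    delta^(3/2) B max_xi, where B is the brace in the definition of beta_const.
    The hypothesis on delta says exactly that sqrt delta B max_xi < eta min_xi. *)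
Lemma drift_contraction i :
  Num.max 0 (1 + delta * bet i + delta ^+ 2 * L ^+ 2) * (Pt delta *m xi) i 0
  < xi i 0.
Proof.
have [_|lam0] := leP (1 + delta * bet i + delta ^+ 2 * L ^+ 2) 0.
  by rewrite mul0r.
set lam := 1 + _ + _ in lam0 *; set p := (_ *m _) i 0.
set A := xi i 0; set H := max_xi xi; set be := bet i.
set b0 := beta0 bet; set q := q0 Q; set c := eta + be.
have A0 : 0 < A by exact: xi_gt0.
have AH : A <= H by exact: max_xi_ge.
have q_ge0 : 0 <= q by exact: q0_ge0.
have beb0 : `|be| <= b0 by exact: beta0_ge.
have eb0 : eta <= b0 by exact: eta_le_beta0.
have b0_gt0 : 0 < b0 by exact: lt_le_trans eb0.
have H0 : 0 < H by exact: lt_le_trans AH.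
have cb0 j : `|eta + bet j| <= 2 * b0.
  rewrite (le_trans (ler_normD _ _))// gtr0_norm//.
  have := beta0_ge bet j; rewrite -/b0; lra.
have hp : p <= A - delta * c * A + delta ^+ 2 * (4 * q * b0 * H).
  have QQ : forall j, `|(Q *m (Q *m xi)) j 0| <= 2 * q * (2 * b0 * H).
    apply: generator_bound => j; rewrite generator_xi normrM normrN.
    by apply: ler_pM => //; rewrite gtr0_norm// max_xi_ge.
  have := semigroup_expansion hPt (ltW delta_gt0) QQ i.
  have -> : (Pt delta *m xi - xi - delta *: (Q *m xi)) i 0 =
    p - A - delta * (Q *m xi) i 0 by rewrite /p /A !mxE.
  rewrite ler_norml generator_xi -/A -/be -/c => /andP[_].
  move: (delta ^+ 2) => d2; lra.
set e := Num.sqrt delta.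
have e0 : 0 < e by rewrite sqrtr_gt0.
have e2 : delta = e ^+ 2 by rewrite sqr_sqrtr// ltW.
have e1 : e < 1 by rewrite -(ltr_pXn2r (_ : 0 < 2)%N)// ?nnegrE ?ltW// expr1n -e2.
set B := (1 + 12 * q) * b0 + 8 * L ^+ 2 * (5 + 6 * b0).
have B0 : 0 < B.
  rewrite addr_gt0 ?mulr_gt0 ?exprn_gt0//; first by rewrite ltr_pwDl ?mulr_ge0.
  by rewrite ltr_pwDl ?mulr_ge0 ?(ltW b0_gt0).
have eBH : e * (B * H) < eta * A.
  have m0 := min_xi_gt0 xi_gt0.
  have mA : min_xi xi <= A by exact: min_xi_le.
  have bc0 : 0 < beta_const L Q bet xi.
    by rewrite /beta_const -/q -/b0 -/B -/H !mulr_gt0// invr_gt0.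
  have : e < eta / beta_const L Q bet xi.
    rewrite -(ltr_pXn2r (_ : 0 < 2)%N) ?nnegrE ?(ltW e0)// -?e2//.
    by rewrite ltW// divr_gt0.
  rewrite ltr_pdivlMr// /beta_const -/q -/b0 -/B -/H mulrA ltr_pdivrMr//.
  by move/lt_le_trans; apply; rewrite ler_wpM2l// ltW.
(* The two smallness facts below, e L < 1/2 and 12 e q < 1, make the crude
   bound lam <= 3 available. *)
have eL : e * L < 2^-1.
  move: delta_L; rewrite ltr_pdivlMr ?mulr_gt0 ?exprn_gt0// e2 => h.
  rewrite -(ltr_pXn2r (_ : 0 < 2)%N) ?nnegrE ?mulr_ge0 ?ltW ?invr_gt0//.
  by rewrite exprMn; nra.
have eq : e * (12 * q) < 1.
  have BH : e * B < eta.
    rewrite -(ltr_pM2r A0) (le_lt_trans _ eBH)// -mulrA ler_wpM2l ?(ltW e0)//.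
    by rewrite ler_wpM2l ?(ltW B0).
  have Bq : 12 * q * b0 <= B.
    rewrite /B; have : 0 <= 8 * L ^+ 2 * (5 + 6 * b0).
      by apply: mulr_ge0; [rewrite mulr_ge0// sqr_ge0|lra].
    lra.
  rewrite -(ltr_pM2r b0_gt0) mul1r -mulrA (le_lt_trans _ (lt_le_trans BH eb0))//.
  by rewrite ler_wpM2l// ltW.
have L2 : 0 < L ^+ 2 by exact: exprn_gt0.
have lam3 : lam <= 3.
  have : delta * be <= 1.
    have [be0|be0] := leP be 0.
      by rewrite (le_trans _ ler01)// mulr_ge0_le0// ltW.
    have beq : be <= q by rewrite ltW// bet_lt_rate.
    apply: (@le_trans _ _ (e * (12 * q))); last exact: ltW.
    rewrite e2 expr2 -mulrA ler_wpM2l ?(ltW e0)//.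
    apply: (@le_trans _ _ (1 * be)); first by rewrite ler_wpM2r ?ltW.
    by rewrite mul1r; lra.
  have : delta ^+ 2 * L ^+ 2 <= 1.
    have dL0 : 0 <= delta * L by rewrite mulr_ge0// ltW.
    rewrite -exprMn expr_le1//.
    rewrite e2 expr2 -mulrA (le_trans (_ : _ <= 1 * (e * L)))//; last by lra.
    by rewrite ler_wpM2r ?mulr_ge0 ?ltW.
  by rewrite /lam -/be; lra.
have X1 : L ^+ 2 * A <= L ^+ 2 * H by rewrite ler_wpM2l// ltW.
have X2 : - be * c * A <= 2 * L * b0 * H.
  have lb0 : 0 <= 2 * L * b0 by rewrite !mulr_ge0 ?ltW.
  have : - be * c <= 2 * L * b0.
    have [be0|be0] := leP 0 be.
      have : 0 <= be * c by rewrite mulr_ge0// addr_ge0// ltW.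
      by lra.
    have : - be <= 2 * L by have := bet_ge i; rewrite -/be; lra.
    have : c <= b0 by rewrite /c; lra.
    have [c0|c0] := leP c 0.
      have : 0 <= be * c by rewrite mulr_le0// ltW.
      by lra.
    by move=> cb mb; apply: ler_pM; lra.
  move=> h; apply: (@le_trans _ _ (2 * L * b0 * A)).
    by rewrite ler_wpM2r// ltW.
  by rewrite ler_wpM2l.
have X3 : - delta * (L ^+ 2 * c * A) <= 2 * L ^+ 2 * b0 * H.
  have cA : - c * A <= 2 * b0 * H.
    apply: (@le_trans _ _ (`|c| * A)).
      by rewrite ler_wpM2r ?(ltW A0)// -normrN ler_norm.
    by apply: ler_pM => //; [exact: ltW|exact: cb0].
  have w0 : 0 <= 2 * b0 * H by rewrite !mulr_ge0// ltW.
  have : L ^+ 2 * (- c * A) <= L ^+ 2 * (2 * b0 * H) by rewrite ler_wpM2l// ltW.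
  move=> LcA.
  have -> : - delta * (L ^+ 2 * c * A) = delta * (L ^+ 2 * (- c * A)) by ring.
  have -> : 2 * L ^+ 2 * b0 * H = L ^+ 2 * (2 * b0 * H) by ring.
  apply: (@le_trans _ _ (delta * (L ^+ 2 * (2 * b0 * H)))).
    by rewrite ler_wpM2l// ltW.
  by apply: ler_piMl; [apply: mulr_ge0 => //; exact: ltW|exact: ltW].
have X4 : lam * (4 * q * b0 * H) <= 12 * q * b0 * H.
  have : 0 <= q * b0 * H by rewrite !mulr_ge0// ltW.
  move=> w0; rewrite (_ : lam * _ = lam * 4 * (q * b0 * H)); last by ring.
  rewrite (_ : 12 * q * b0 * H = 12 * (q * b0 * H)); last by ring.
  by rewrite ler_wpM2r//; lra.
have lamp : lam * p <= lam * (A - delta * c * A + delta ^+ 2 * (4 * q * b0 * H)).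
  by rewrite ler_wpM2l// ltW.
have lamE : lam * (A - delta * c * A + delta ^+ 2 * (4 * q * b0 * H)) =
    A - delta * (eta * A) + delta ^+ 2 * (L ^+ 2 * A + (- be * c * A) +
    (- delta * (L ^+ 2 * c * A)) + lam * (4 * q * b0 * H)).
  by rewrite /lam -/be /c; ring.
have sumX : delta ^+ 2 * (L ^+ 2 * A + (- be * c * A) +
    (- delta * (L ^+ 2 * c * A)) + lam * (4 * q * b0 * H)) <=
    delta * (e * (B * H)).
  apply: (@le_trans _ _ (delta ^+ 2 * (L ^+ 2 * H + 2 * L * b0 * H +
      2 * L ^+ 2 * b0 * H + 12 * q * b0 * H))).
    by rewrite ler_wpM2l ?sqr_ge0// !lerD.
  rewrite expr2 -mulrA ler_wpM2l ?(ltW delta_gt0)//.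
  have dE x : delta * x = e * (e * x) by rewrite e2; ring.
  rewrite dE ler_wpM2l ?(ltW e0)// /B.
  have h1 : 0 <= L ^+ 2 * H by rewrite mulr_ge0// ltW.
  have h2 : 0 <= b0 * H by rewrite mulr_ge0// ltW.
  have h3 : 0 <= L ^+ 2 * b0 * H by rewrite !mulr_ge0// ltW.
  have h4 : 0 <= q * b0 * H by rewrite !mulr_ge0// ltW.
  have h5 : e * (2 * L * b0 * H) <= b0 * H.
    have -> : e * (2 * L * b0 * H) = (2 * (e * L)) * (b0 * H) by ring.
    by rewrite ler_piMl//; lra.
  have h1' : e * (L ^+ 2 * H) <= L ^+ 2 * H by rewrite ler_piMl// ltW.
  have h3' : e * (L ^+ 2 * b0 * H) <= L ^+ 2 * b0 * H by rewrite ler_piMl// ltW.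
  have h4' : e * (q * b0 * H) <= q * b0 * H by rewrite ler_piMl// ltW.
  lra.
have fin : delta * (e * (B * H)) < delta * (eta * A) by rewrite ltr_pM2l.
lra.
Qed.

End drift_contraction.

(** * Borel structure of matrices and of the state space *)

Section hilbert_schmidt.
Context {R : realType}.

Lemma hsnorm_ge0 p q (A : 'M[R]_(p, q)) : 0 <= hsnorm A.
Proof. exact: sqrtr_ge0. Qed.

Lemma hsnorm_sqr p q (A : 'M[R]_(p, q)) :
  hsnorm A ^+ 2 = \sum_i \sum_j A i j ^+ 2.
Proof. by rewrite sqr_sqrtr//; do 2!apply: sumr_ge0 => ? _; exact: sqr_ge0. Qed.

Lemma coord_le_hsnorm p q (A : 'M[R]_(p, q)) i j : `|A i j| <= hsnorm A.
Proof.
rewrite -(ler_pXn2r (_ : 0 < 2)%N) ?nnegrE ?hsnorm_ge0// hsnorm_sqr.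
rewrite (bigD1 i)//= (bigD1 j)//= real_normK ?num_real// -addrA lerDl.
by rewrite addr_ge0// ?sumr_ge0// => k _; rewrite ?sumr_ge0// ?sqr_ge0// => l _; exact: sqr_ge0.
Qed.

Lemma hsnorm_le_sum p q (A : 'M[R]_(p, q)) : hsnorm A <= \sum_i \sum_j `|A i j|.
Proof.
have S0 : 0 <= \sum_i \sum_j `|A i j| by do 2!apply: sumr_ge0 => ? _.
rewrite -(ler_pXn2r (_ : 0 < 2)%N) ?nnegrE ?hsnorm_ge0// hsnorm_sqr expr2.
rewrite mulr_suml; apply: ler_sum => i _; rewrite mulr_suml; apply: ler_sum => j _.
rewrite -real_normK ?num_real// expr2 ler_wpM2l//.
rewrite (bigD1 i)//= (bigD1 j)//= -addrA lerDl.
by rewrite addr_ge0// sumr_ge0// => k _; rewrite sumr_ge0.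
Qed.

Lemma hsnormN p q (A : 'M[R]_(p, q)) : hsnorm (- A) = hsnorm A.
Proof. by congr Num.sqrt; do 2 (apply: eq_bigr => ? _); rewrite mxE sqrrN. Qed.

Lemma hsnorm_sqrD p (u v : 'cV[R]_p) t :
  hsnorm (u + t *: v) ^+ 2 = hsnorm u ^+ 2 + 2 * t * inner u v + t ^+ 2 * hsnorm v ^+ 2.
Proof.
rewrite !hsnorm_sqr /inner !mulr_sumr -!big_split/=; apply: eq_bigr => i _.
by rewrite !big_ord1 !mxE; ring.
Qed.

End hilbert_schmidt.

Section borel_matrices.
Context {R : realType}.

(** An open set of matrices is a countable union of rational boxes, so
    measurability for the Borel sigma-algebra is decided entrywise. *)
Lemma measurable_fun_mx d (T : measurableType d) p q (f : T -> 'M[R]_(p, q)) :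
  (forall i j, measurable_fun setT (fun t => f t i j)) -> measurable_fun setT f.
Proof.
move=> mf; apply: (@measurability _ _ _ _ _ _ (@open 'M[R]_(p, q))) => //.
move=> _ [U oU <-]; rewrite setTI.
pose B (c : 'M[rat]_(p, q) * nat) : set 'M[R]_(p, q) :=
  [set A | forall i j, ball (ratr (c.1 i j) : R) c.2.+1%:R^-1 (A i j)].
have -> : f @^-1` U = \bigcup_(c in [set c | B c `<=` U]) (f @^-1` B c).
  apply/seteqP; split=> [t /= Ut|t [c cU] /= Bc]; last exact: cU.
  have : nbhs (f t) U by rewrite nbhsE; exists U.
  move=> /nbhs_ballP[e /= e0 eU].
  have [k] := ltr_add_invr (divr_gt0 e0 (ltr0n R 2)); rewrite add0r => ke.
  have /choice[c cP] : forall ij : 'I_p * 'I_q, exists r : rat,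
      ball (f t ij.1 ij.2) k.+1%:R^-1 (ratr r : R).
    move=> ij; have [|y [ /= By [r _ ry]]] :=
      @dense_rat R (ball (f t ij.1 ij.2) k.+1%:R^-1) _ (ball_open _ _).
      by exists (f t ij.1 ij.2); exact: ballxx.
    by exists r; rewrite /= ry.
  exists (\matrix_(i, j) c (i, j), k) => /=.
    move=> A BA; apply: eU; split=> // i j; have := BA i j; rewrite mxE /=.
    move=> /ball_sym h; have h' := cP (i, j).
    apply: (@le_ball _ _ _ (k.+1%:R^-1 + k.+1%:R^-1)).
      by rewrite [e in _ <= e]splitr ltW// ltrD.
    by apply: ball_triangle h' _; exact: ball_sym.
  by move=> i j /=; rewrite mxE; apply: ball_sym; exact: (cP (i, j)).
rewrite bigcup_mkcond; apply: countable_bigcupT_measurable => [//|c].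
case: ifPn => // _.
have -> : f @^-1` B c = \bigcap_(ij : 'I_p * 'I_q) ((fun t => f t ij.1 ij.2) @^-1`
    ball (ratr (c.1 ij.1 ij.2) : R) c.2.+1%:R^-1).
  by apply/seteqP; split=> [t h [i j] _|t h i j]; [exact: h|exact: (h (i, j))].
apply: fin_bigcap_measurable => // ij _.
by rewrite -[X in measurable X]setTI; apply: mf => //; apply: open_measurable; exact: ball_open.
Qed.

Lemma open_mx_measurable p q (U : set 'M[R]_(p, q)) : open U -> measurable U.
Proof. by move=> oU; rewrite /measurable/=; exact: sub_sigma_algebra. Qed.

Lemma continuous_mx_measurable p q (f : 'M[R]_(p, q) -> R) :
  continuous f -> measurable_fun setT f.
Proof.
move=> cf; apply: (measurability _ (RGenOInfty.measurableE R)).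
move=> _ [U [a ->] <-]; rewrite setTI; apply: open_mx_measurable.
by move/continuousP : cf; apply; exact: interval_open.
Qed.

Lemma measurable_coord p q i j :
  measurable_fun setT (fun A : 'M[R]_(p, q) => A i j).
Proof. by apply: continuous_mx_measurable; exact: coord_continuous. Qed.

Lemma measurable_hsnorm_sqr p q :
  measurable_fun setT (fun A : 'M[R]_(p, q) => hsnorm A ^+ 2).
Proof.
under eq_fun do rewrite hsnorm_sqr.
by do 2 (apply: measurable_sum => ?); apply: measurable_funX; exact: measurable_coord.
Qed.

Lemma measurable_hsnorm_sqrB d (T : measurableType d) p q (f g : T -> 'M[R]_(p, q)) :
  measurable_fun setT f -> measurable_fun setT g ->
  measurable_fun setT (fun t => (hsnorm (f t - g t) ^+ 2)%:E).
Proof.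
move=> mf mg; apply/measurable_EFinP; apply: (measurableT_comp (@measurable_hsnorm_sqr p q)).
apply: measurable_fun_mx => i j; under eq_fun do rewrite !mxE.
by apply: measurable_funB; apply: measurableT_comp (measurable_coord _ _) _.
Qed.

Lemma lipschitz_continuous_mx p q (f : 'M[R]_(p, q) -> R) K :
  (forall A B, `|f A - f B| <= K * hsnorm (A - B)) -> continuous f.
Proof.
move=> fK A; apply/(@cvgrPdist_lt _ _ _ (nbhs A)) => e e0.
pose M : R := (1 + `|K|) * (1 + (p * q)%:R).
have M0 : 0 < M by rewrite mulr_gt0 ?ltr_pwDl.
apply/nbhs_ballP; exists (e / M); first exact: divr_gt0.
move=> B AB; apply: le_lt_trans (fK _ _) _.
have : hsnorm (A - B) <= (p * q)%:R * (e / M).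
  apply: le_trans (hsnorm_le_sum _) _.
  apply: (@le_trans _ _ (\sum_(i < p) \sum_(j < q) (e / M))).
    apply: ler_sum => i _; apply: ler_sum => j _.
    by rewrite !mxE ltW//; exact: (AB.2 i j).
  by rewrite !sumr_const !card_ord -mulrnA mulr_natl mulnC.
move=> h; apply: (@le_lt_trans _ _ (`|K| * ((p * q)%:R * (e / M)))).
  apply: (@le_trans _ _ (`|K| * hsnorm (A - B))); last by rewrite ler_wpM2l.
  by rewrite ler_wpM2r ?hsnorm_ge0 ?ler_norm.
have KM : `|K| * (p * q)%:R < M.
  rewrite /M mulrDr mulr1 mulrDl mul1r.
  by have := normr_ge0 K; have := ler0n R (p * q); lra.
apply: (@lt_le_trans _ _ (M * (e / M))).
  by rewrite [ltLHS]mulrA ltr_pM2r// divr_gt0.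
by rewrite mulrC divfK// lt0r_neq0.
Qed.

End borel_matrices.

Section state_space.
Context {R : realType} {n N : nat}.
Local Notation E := ('cV[R]_n * 'I_N.+1)%type.

Lemma measurable_discrete (A : set 'I_N.+1) : measurable A.
Proof. by []. Qed.

(** The regime is discrete and finite, so only sections at a fixed regime have
    to be examined. *)
Lemma measurable_fun_state d (T : measurableType d) (f : E -> T) :
  (forall j, measurable_fun setT (fun x => f (x, j))) -> measurable_fun setT f.
Proof.
move=> mf _ B mB; rewrite setTI.
have -> : f @^-1` B =
    \bigcup_(j in [set: 'I_N.+1]) (((fun x => f (x, j)) @^-1` B) `*` [set j]).
  by apply/seteqP; split=> [[x j] /= h|[x j] [j' _ [/= h ->]]//]; exists j.
apply: fin_bigcup_measurable => // j _; apply: measurableX => //.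
by rewrite -[X in measurable X]setTI; exact: mf.
Qed.

Definition orthant (a : 'cV[R]_n) (j : 'I_N.+1) : set E :=
  [set z : E | (forall c, z.1 c 0 <= a c 0) /\ z.2 = j].

(** Lipschitz functions decreasing, as k grows, to the indicator of an orthant;
    they turn statements about Lipschitz test functions into statements about
    measures. *)
Definition cutoff (a : 'cV[R]_n) (j : 'I_N.+1) (k : nat) (z : E) : R :=
  (z.2 == j)%:R * Num.max 0 (1 - k%:R * \sum_c Num.max 0 (z.1 c 0 - a c 0)).

Lemma cutoff_ge0 a j k z : 0 <= cutoff a j k z.
Proof. by rewrite mulr_ge0// le_max lexx. Qed.

Lemma cutoff_le1 a j k z : cutoff a j k z <= 1.
Proof.
rewrite -[leRHS]mulr1; apply: ler_pM => //; first by rewrite le_max lexx.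
  by case: (_ == _).
rewrite ge_max ler01/= lerBlDr lerDl mulr_ge0// sumr_ge0// => c _.
by rewrite le_max lexx.
Qed.

Lemma cutoff_lipschitz a j k x y i :
  `|cutoff a j k (x, i) - cutoff a j k (y, i)| <= (k * n)%:R * hsnorm (x - y).
Proof.
rewrite /cutoff/= -mulrBr normrM.
have max_lip (u v : R) : `|Num.max 0 u - Num.max 0 v| <= `|u - v|.
  case: (leP 0 u) => u0; case: (leP 0 v) => v0; rewrite ?subrr ?normr0//.
    by rewrite subr0 !ger0_norm//; lra.
  by rewrite sub0r normrN ger0_norm// ltr0_norm; lra.
apply: (@le_trans _ _ (1 * `|k%:R * \sum_c (Num.max 0 (y c 0 - a c 0)
   - Num.max 0 (x c 0 - a c 0))|)).
  apply: ler_pM => //; first by case: (_ == _); rewrite ?normr1 ?normr0.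
  apply: le_trans (max_lip _ _) _.
  rewrite (_ : _ - _ = k%:R * \sum_c (Num.max 0 (y c 0 - a c 0)
    - Num.max 0 (x c 0 - a c 0)))// sumrB; ring.
rewrite mul1r natrM -mulrA normrM normr_nat ler_wpM2l//.
rewrite (le_trans (ler_norm_sum _ _ _))//.
apply: (@le_trans _ _ (\sum_(c < n) hsnorm (x - y))).
  apply: ler_sum => c _; apply: le_trans (max_lip _ _) _.
  rewrite (_ : _ - _ = - (x - y) c 0); last by rewrite !mxE; ring.
  by rewrite normrN coord_le_hsnorm.
by rewrite sumr_const card_ord mulr_natl.
Qed.

Lemma measurable_cutoff a j k : measurable_fun setT (cutoff a j k).
Proof.
apply: measurable_fun_state => i; apply: continuous_mx_measurable.
exact: lipschitz_continuous_mx (fun x y => cutoff_lipschitz a j k x y i).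
Qed.

Lemma cvg_cutoff a j z : cutoff a j k z @[k --> \oo] --> (\1_(orthant a j) z : R).
Proof.
rewrite indicE /cutoff; have [zj|zj] := eqVneq z.2 j; last first.
  rewrite memNset; last by case=> _ /eqP; apply/negP.
  under eq_fun do rewrite mul0r; exact: cvg_cst.
set S := \sum_c _; under eq_fun do rewrite mul1r.
have Sge c : 0 <= Num.max 0 (z.1 c 0 - a c 0) by rewrite le_max lexx.
have S0 : 0 <= S by apply: sumr_ge0.
have [S_eq0|S_neq0] := eqVneq S 0.
  rewrite mem_set; last first.
    split=> // c; move/eqP : S_eq0; rewrite psumr_eq0// => /allP/(_ c).
    rewrite mem_index_enum => /(_ isT)/implyP/(_ isT)/eqP h.
    by rewrite -subr_le0 -h le_max lexx orbT.
  by under eq_fun do rewrite S_eq0 mulr0 subr0 max_r//; exact: cvg_cst.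
rewrite memNset; last first.
  move=> [za _]; move/eqP: S_neq0; apply; apply: big1 => c _.
  by rewrite max_l// subr_le0.
have Sp : 0 < S by rewrite lt_neqAle eq_sym S_neq0.
apply: cvg_near_cst; near=> k.
rewrite max_l// subr_le0 -ler_pdivrMr// ltW//.
by near: k; exact: nbhs_infty_gtr.
Unshelve. all: by end_near. Qed.

Lemma measurable_orthant a j : measurable (orthant a j).
Proof.
have -> : orthant a j = (\bigcap_(c in [set: 'I_n])
    [set x : 'cV[R]_n | x c 0 <= a c 0]) `*` [set j].
  by apply/seteqP; split=> [[x i] [/= h ->]|[x i] [/= h ->]]; split=> // c;
    [move=> _; exact: h|exact: (h c I)].
apply: measurableX => //; apply: fin_bigcap_measurable => // c _.
rewrite -[X in measurable X]setTI.
by apply: measurable_fun_le => //; exact: measurable_coord.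
Qed.

Lemma cvg_integral_cutoff (m : probability E R) a j :
  (\int[m]_z (cutoff a j k z)%:E)%E @[k --> \oo] --> m (orthant a j).
Proof.
have mo := measurable_orthant a j.
have -> : m (orthant a j) = (\int[m]_z (\1_(orthant a j) z)%:E)%E.
  by rewrite integral_indic// setIT.
have [] //  := @dominated_convergence _ _ _ m setT measurableT
  (fun k z => (cutoff a j k z)%:E) (fun z => (\1_(orthant a j) z)%:E) (cst 1%E).
- by move=> k; apply/measurable_EFinP; exact: measurable_cutoff.
- by apply/measurable_EFinP/measurable_indic; exact: measurable_orthant.
- apply: aeW => z _; apply: cvg_EFin; first by near=> k.
  exact: cvg_cutoff.
- exact: finite_measure_integrable_cst.
- apply: aeW => z k _; rewrite lee_fin ger0_norm ?cutoff_ge0//.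
  exact: cutoff_le1.
Unshelve. all: by end_near. Qed.

(** Orthants form a pi-system generating the Borel sets of the state space. *)
Lemma measure_ext_orthant (m1 m2 : probability E R) :
  (forall a j, m1 (orthant a j) = m2 (orthant a j)) ->
  forall A, measurable A -> m1 A = m2 A.
Proof.
move=> m12.
pose G (A : set E) := [\/ A = set0, A = setT | exists a j, A = orthant a j].
have GT : G setT by constructor 2.
apply: (measure_unique G (fun=> setT)) => //.
- apply/seteqP; split; last first.
    apply: smallest_sub; first exact: sigma_algebra_measurable.
    move=> _ [->|->|[a [j ->]]] //; exact: measurable_orthant.
  have mG a j : measurable (orthant a j : set (g_sigma_algebraType G)).
    by apply: sub_sigma_algebra; constructor 3; exists a, j.
  have bound (x : 'cV[R]_n) : exists k : nat, forall c, x c 0 <= k%:R.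
    exists (Num.bound (\sum_c `|x c 0|)) => c.
    rewrite ltW// (le_lt_trans _ (archi_boundP _))//; last exact: sumr_ge0.
    by rewrite (le_trans (ler_norm _))// (bigD1 c)//= lerDl sumr_ge0.
  have mlev c r : measurable [set z : g_sigma_algebraType G | z.1 c 0 <= r].
    have -> : [set z : g_sigma_algebraType G | z.1 c 0 <= r] =
        \bigcup_(kj in [set: nat * 'I_N.+1])
        orthant (\col_c' (if c' == c then r else kj.1%:R)) kj.2.
      apply/seteqP; split=> [[x j] /= xr|[x j] [[k i] _ [/= + _]]]; last first.
        by move/(_ c); rewrite mxE eqxx.
      have [k xk] := bound x; exists (k, j) => //; split=> //= c'.
      by rewrite mxE; case: eqVneq => [->|].
    exact: countable_bigcupT_measurable.
  have mid : measurable_fun setT (fun z : g_sigma_algebraType G => (z : E)).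
    apply/measurable_fun_pairP; split.
      apply: measurable_fun_mx => c c'; rewrite ord1.
      apply: (measurability _ (RGenOInfty.measurableE R)).
      move=> _ [_ [r ->] <-]; rewrite setTI.
      rewrite [X in measurable X](_ : _ =
        ~` [set z : g_sigma_algebraType G | z.1 c 0 <= r]).
        exact: measurableC.
      apply/seteqP; split=> z /=; rewrite in_itv/= andbT ltNge; first by move/negP.
      by move=> h; apply/negP.
    move=> _ B _; rewrite setTI.
    have -> : (snd \o (fun z : g_sigma_algebraType G => (z : E))) @^-1` B =
        \bigcup_(kj in [set: nat * 'I_N.+1])
        if kj.2 \in B then orthant (const_mx kj.1%:R) kj.2 else set0.
      apply/seteqP; split=> [[x j] /= Bj|[x j] [[k i] _ /=]]; last first.
        by case: ifPn => //; rewrite inE => Bi [_ /= ->].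
      have [k xk] := bound x; exists (k, j) => //=; rewrite mem_set//.
      by split=> //= c; rewrite mxE.
    by apply: countable_bigcupT_measurable => // kj; case: ifPn.
  move=> A mA; have := mid measurableT A mA; rewrite setTI; exact.
- move=> A B [->|->|[a [i ->]]] [->|->|[a' [i' ->]]]; rewrite ?setI0 ?set0I ?setTI ?setIT;
    try by [constructor 1|constructor 2].
  + by constructor 3; exists a', i'.
  + by constructor 3; exists a, i.
  have [->|ii'] := eqVneq i i'; last first.
    constructor 1; apply/seteqP; split=> // z [[_ zi] [_ zi']].
    by case/eqP: ii'; rewrite -zi.
  constructor 3; exists (\col_c Num.min (a c 0) (a' c 0)), i'.
  apply/seteqP; split=> [z [[h hz] [h' _]]|z [h hz]].
    by split=> // c; rewrite mxE le_min h h'.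
  by split; split=> // c; have := h c; rewrite mxE le_min => /andP[].
- by apply/seteqP; split=> // z _; exists 0%N.
- move=> _ [->|->|[a [j ->]]]; first by rewrite !measure0.
    by rewrite [LHS]probability_setT [RHS]probability_setT.
  exact: m12.
- by move=> k; apply: fin_num_fun_lty; exact: fin_num_measure.
Qed.

Lemma measure_ext_cutoff (m1 m2 : probability E R) :
  (forall a j k, \int[m1]_z (cutoff a j k z)%:E = \int[m2]_z (cutoff a j k z)%:E)%E ->
  forall A, measurable A -> m1 A = m2 A.
Proof.
move=> m12; apply: measure_ext_orthant => a j.
have h1 := @cvg_integral_cutoff m1 a j; have h2 := @cvg_integral_cutoff m2 a j.
have E : ((fun k => \int[m1]_z (cutoff a j k z)%:E) =
          (fun k => \int[m2]_z (cutoff a j k z)%:E))%E.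
  by apply/funext => k; exact: m12.
by rewrite E in h1; exact: (cvg_unique (@ereal_hausdorff R) h1 h2).
Qed.

End state_space.

(** * Second moments of Gaussian variables *)

Section gaussian_moments.
Context {R : realType}.
Variable s : R.
Hypothesis s_gt0 : 0 < s.
(* N is characterized by its values, so that it can be the distribution of a
   random variable. *)
Variable N : probability (measurableTypeR R) R.
Hypothesis NE : forall A, measurable A -> N A = normal_prob 0 s A.
Local Notation mu := (@lebesgue_measure R).

Let s_neq0 : s != 0. Proof. by rewrite gt_eqF. Qed.

Lemma integral_normal_prob (f : R -> \bar R) :
  measurable_fun setT f -> (forall x, 0 <= f x)%E ->
  (\int[N]_x f x = \int[mu]_x (f x * (normal_pdf 0 s x)%:E))%E.
Proof.
move=> mf f0; have dom := @normal_prob_dominates R 0 s.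
have ipdf : mu.-integrable setT (EFin \o normal_pdf 0 s).
  exact: integrable_normal_pdf.
have mpdf : measurable_fun setT (EFin \o normal_pdf 0 s).
  by apply/measurable_EFinP; exact: measurable_normal_pdf.
rewrite (@eq_measure_integral _ _ _ _ (normal_prob 0 s)) => [|A mA _]; last exact: NE.
have iRN := Radon_Nikodym_SigmaFinite.f_integrable dom.
have mRN := measurable_int _ iRN.
rewrite -(Radon_Nikodym_SigmaFinite.change_of_variables dom f0 measurableT mf).
apply: ae_eq_integral => //; try exact: emeasurable_funM.
apply: ae_eqe_mul2l; apply: integral_ae_eq => // E _ mE.
by rewrite -Radon_Nikodym_SigmaFinite.f_integral.
Qed.

Lemma integral_lebesgueN (g : R -> \bar R) :
  measurable_fun setT g -> (forall x, 0 <= g x)%E ->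
  (\int[mu]_x g x = \int[mu]_x g (- x)%R)%E.
Proof.
move=> mg g0.
have mN : measurable_fun setT (-%R : measurableTypeR R -> measurableTypeR R).
  exact: oppr_measurable.
transitivity (\int[pushforward mu (-%R : measurableTypeR R -> measurableTypeR R)]_x g x)%E.
  by apply: eq_measure_integral => A mA _; exact/esym/lebesgue_measureN.
have := ge0_integral_pushforward mN mu measurableT mg (fun y _ => g0 y).
by rewrite preimage_setT.
Qed.

Lemma integral_normal_sym (f : R -> \bar R) :
  measurable_fun setT f -> (forall x, 0 <= f x)%E ->
  (\int[N]_x f x = \int[N]_x f (- x)%R)%E.
Proof.
move=> mf f0.
have mpdf : measurable_fun setT (EFin \o normal_pdf 0 s).
  by apply/measurable_EFinP; exact: measurable_normal_pdf.
rewrite !integral_normal_prob//; last first.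
  by apply: measurableT_comp => //; exact: oppr_measurable.
rewrite integral_lebesgueN; last 2 first.
- exact: emeasurable_funM.
- by move=> x; rewrite mule_ge0// lee_fin normal_pdf_ge0.
by apply: eq_integral => x _ /=; rewrite !normal_pdfE// /normal_fun !subr0 sqrrN.
Qed.

(** The exponent is chosen so that its product with the normal density is a
    times the normal density of standard deviation a s. *)
Lemma normal_exp_sqr (a : R) : 1 < a ->
  (\int[N]_x (expR ((1 - a ^- 2) / (s ^+ 2 *+ 2) * x ^+ 2))%:E = a%:E)%E.
Proof.
move=> a1; have a0 : 0 < a by exact: lt_trans a1.
have as0 : a * s != 0 by rewrite mulf_neq0// gt_eqF.
rewrite integral_normal_prob//; last first.
  apply/measurable_EFinP; apply: measurableT_comp => //.
  by apply: measurable_funM => //; exact: measurable_funX.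
transitivity (\int[mu]_x (a%:E * (normal_pdf 0 (a * s) x)%:E))%E.
  apply: eq_integral => x _; rewrite -!EFinM !normal_pdfE//; congr EFin.
  rewrite /normal_fun !subr0 mulrCA -expRD [RHS]mulrA; congr (_ * expR _).
    rewrite /normal_peak.
    have -> : (a * s) ^+ 2 * pi *+ 2 = a ^+ 2 * (s ^+ 2 * pi *+ 2) by ring.
    rewrite [in RHS]sqrtrM ?sqr_ge0// sqrtr_sqr gtr0_norm// invfM mulrA.
    by rewrite divff ?gt_eqF// mul1r.
  by field; rewrite ?s_neq0 ?(gt_eqF a0).
rewrite ge0_integralZl//.
- by rewrite integral_normal_pdf mule1.
- by apply/measurable_EFinP; exact: measurable_normal_pdf.
- by move=> x _; rewrite lee_fin normal_pdf_ge0.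
- by rewrite lee_fin ltW.
Qed.

(** From 1 + y <= exp y and normal_exp_sqr one gets
    1 + (1 - a^-2) / (2 s^2) E x^2 <= a for every a > 1; dividing by a - 1 and
    letting a tend to 1 gives the bound without integrating by parts. *)
Lemma normal_second_moment : (\int[N]_x (x ^+ 2)%:E <= (s ^+ 2)%:E)%E.
Proof.
have m2 : measurable_fun setT (fun x : R => (x ^+ 2)%:E).
  by apply/measurable_EFinP; exact: measurable_funX.
have M0 : (0 <= \int[N]_x (x ^+ 2)%:E)%E.
  by apply: integral_ge0 => x _; rewrite lee_fin sqr_ge0.
have key a : 1 < a -> (1 + ((1 - a ^- 2) / (s ^+ 2 *+ 2))%:E *
    \int[N]_x (x ^+ 2)%:E <= a%:E)%E.
  move=> a1; have a0 : 0 < a by exact: lt_trans a1.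
  rewrite -(normal_exp_sqr a1).
  have k0 : 0 <= (1 - a ^- 2) / (s ^+ 2 *+ 2).
    rewrite divr_ge0 ?mulrn_wge0 ?sqr_ge0// subr_ge0 invf_le1 ?exprn_gt0//.
    by rewrite exprn_ege1// ltW.
  rewrite -ge0_integralZl//; last by move=> x _; rewrite lee_fin sqr_ge0.
  have -> : 1%E = (\int[N]_x (cst 1%E x))%E :> \bar R.
    by rewrite integral_cst//= probability_setT mule1.
  rewrite -ge0_integralD//.
  - apply: ge0_le_integral => //.
    + by move=> x _; rewrite adde_ge0// mule_ge0// lee_fin ?sqr_ge0.
    + by apply: emeasurable_funD => //; exact: emeasurable_funM.
    + apply/measurable_EFinP; apply: measurableT_comp => //.
      by apply: measurable_funM => //; exact: measurable_funX.
    + by move=> x _; rewrite -EFinM -EFinD lee_fin expR_ge1Dx.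
  - by move=> x _; rewrite mule_ge0// lee_fin ?sqr_ge0.
  - exact: emeasurable_funM.
move: M0 key; case: (\int[N]_x _)%E => [M|_ /(_ 2)|//]; last first.
  rewrite gt0_muley ?addey//; first by move/(_ (ltr1n _ 2)).
  by rewrite lte_fin divr_gt0 ?pmulrn_lgt0 ?exprn_gt0// subr_gt0 invf_lt1 ?exprn_gt0// exprn_egt1// ltr1n.
rewrite lee_fin => M0 key; rewrite lee_fin; apply/ler_addgt0Pr => e e0.
have s20 : 0 < s ^+ 2 by exact: exprn_gt0.
pose a := 1 + e / (2 * s ^+ 2).
have a1 : 1 < a by rewrite ltrDl divr_gt0// mulr_gt0.
have := key a a1; rewrite -EFinM -EFinD lee_fin => h.
have eE : e = 2 * s ^+ 2 * (a - 1) by rewrite /a; field; exact: s_neq0.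
have a0 : 0 < a by lra.
have {}h : (a + 1) * M <= 2 * s ^+ 2 * a ^+ 2.
  pose D := 2 * s ^+ 2 * a ^+ 2 / (a - 1).
  have E1 : (a + 1) * M = (1 - a ^- 2) / (s ^+ 2 *+ 2) * M * D.
    by rewrite /D; field; rewrite s_neq0 !gt_eqF//; lra.
  have E2 : 2 * s ^+ 2 * a ^+ 2 = (a - 1) * D.
    by rewrite /D; field; rewrite gt_eqF//; lra.
  rewrite E1 E2 ler_wpM2r//; last by rewrite lerBrDl.
  apply: divr_ge0; last by lra.
  by apply: mulr_ge0; [apply: mulr_ge0 => //|]; exact: sqr_ge0.
rewrite eE -(ler_pM2l (_ : 0 < a + 1)); last by lra.
apply: le_trans h _.
have -> : (a + 1) * (s ^+ 2 + 2 * s ^+ 2 * (a - 1)) =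
   s ^+ 2 * (2 * a ^+ 2) + s ^+ 2 * (a - 1) by ring.
have : 0 <= s ^+ 2 * (a - 1) by rewrite mulr_ge0 ?sqr_ge0//; lra.
have -> : 2 * s ^+ 2 * a ^+ 2 = s ^+ 2 * (2 * a ^+ 2) by ring.
lra.
Qed.

(** The cross term is cancelled by averaging with the reflected integrand,
    whose integral is the same by symmetry. *)
Lemma normal_quadratic (u a : R) :
  (\int[N]_x ((u + a * x) ^+ 2)%:E <= (u ^+ 2 + a ^+ 2 * s ^+ 2)%:E)%E.
Proof.
have mq (a' : R) : measurable_fun setT (fun x : R => ((u + a' * x) ^+ 2)%:E).
  apply/measurable_EFinP; apply: measurable_funX; apply: measurable_funD => //.
have sym : (\int[N]_x ((u + a * x) ^+ 2)%:E = \int[N]_x ((u + (- a)%R * x) ^+ 2)%:E)%E.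
  rewrite integral_normal_sym//; last by move=> x; rewrite lee_fin sqr_ge0.
  by apply: eq_integral => x _; rewrite mulrN mulNr.
have : (\int[N]_x ((u + a * x) ^+ 2)%:E + \int[N]_x ((u + a * x) ^+ 2)%:E <=
    (2 * u ^+ 2)%:E + (2 * a ^+ 2)%:E * (s ^+ 2)%:E)%E.
  rewrite {2}sym -ge0_integralD//; try exact: mq;
    try by move=> x _; rewrite lee_fin sqr_ge0.
  under eq_integral => x _.
    rewrite -EFinD (_ : _ + _ = 2 * u ^+ 2 + 2 * a ^+ 2 * x ^+ 2); last by ring.
    rewrite EFinD (EFinM (2 * a ^+ 2)); over.
  have -> : (\int[N]_x ((2 * u ^+ 2)%:E + (2 * a ^+ 2)%:E * (x ^+ 2)%:E) =
      (2 * u ^+ 2)%:E + (2 * a ^+ 2)%:E * \int[N]_x (x ^+ 2)%:E)%E.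
    rewrite ge0_integralD//.
    - rewrite integral_cst//= probability_setT mule1 ge0_integralZl//.
      + by apply/measurable_EFinP; exact: measurable_funX.
      + by move=> x _; rewrite lee_fin sqr_ge0.
      + by rewrite lee_fin mulr_ge0// sqr_ge0.
    - by move=> x _; rewrite lee_fin mulr_ge0// sqr_ge0.
    - by move=> x _; apply: mule_ge0; rewrite lee_fin ?sqr_ge0// mulr_ge0// sqr_ge0.
    - apply: emeasurable_funM => //.
      by apply/measurable_EFinP; exact: measurable_funX.
  rewrite leeD2l// lee_wpmul2l ?normal_second_moment//.
  by rewrite lee_fin mulr_ge0// sqr_ge0.
have : (0 <= \int[N]_x ((u + a * x) ^+ 2)%:E)%E.
  by apply: integral_ge0 => x _; rewrite lee_fin sqr_ge0.
case: (\int[N]_x _)%E => [I| |]//=.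
by rewrite -?EFinM -?EFinD !lee_fin; lra.
Qed.

End gaussian_moments.

(** * Independence of families of coordinates *)

Section independence.
Context {R : realType} {d : measure_display} {Omega : measurableType d}.
Variable P : probability Omega R.

Definition indep_classes (F G : set (set Omega)) : Prop :=
  forall A B, F A -> G B -> P (A `&` B) = (P A * P B)%E.

Lemma indep_classesC F G : indep_classes F G -> indep_classes G F.
Proof. by move=> FG A B GA FB; rewrite setIC muleC; exact: FG. Qed.

(** For A fixed in F, P (A `&` B) and P A * P B are finite measures of B that
    agree on a pi-system. *)
Lemma indep_classes_pi F G : G `<=` measurable -> setI_closed G -> G setT ->
  F `<=` measurable ->
  indep_classes F G -> indep_classes F <<s G >>.
Proof.
move=> Gm GI GT Fm FG A B FA.
have mA := Fm _ FA.
pose c := NngNum (fine_ge0 (measure_ge0 P A)).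
have cE : (c%:num)%:E = P A by rewrite /= fineK// fin_num_measure.
suff h : <<s G >> B -> mrestr P mA B = mscale c P B.
  by move=> /h; rewrite /mrestr /mscale cE setIC.
apply: (g_sigma_algebra_measure_unique G Gm (fun=> setT)) => //.
- by apply/seteqP; split=> // x _; exists 0%N.
- by move=> C GC; rewrite /= /mrestr /mscale cE setIC FG.
- by move=> k; rewrite /= /mrestr setTI ltey_eq fin_num_measure.
Qed.

Lemma indep_classes_pi2 F G :
  F `<=` measurable -> setI_closed F -> F setT ->
  G `<=` measurable -> setI_closed G -> G setT ->
  indep_classes F G -> indep_classes <<s F >> <<s G >>.
Proof.
move=> Fm FI FT Gm GI GT FG.
apply: indep_classesC; apply: indep_classes_pi => //.
  exact: smallest_sub (@sigma_algebra_measurable _ Omega) Gm.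
by apply: indep_classesC; exact: indep_classes_pi.
Qed.

(** Independence says that the joint law is a product measure, so the second
    variable can be integrated out against its own law. *)
Lemma integral_indep d1 d2 (T1 : measurableType d1) (T2 : measurableType d2)
    (X : Omega -> T1) (Z : Omega -> T2) (gam : probability T2 R)
    (h : T1 * T2 -> \bar R) :
  measurable_fun setT X -> measurable_fun setT Z ->
  (forall B, measurable B -> P (Z @^-1` B) = gam B) ->
  (forall A B, measurable A -> measurable B ->
    P (X @^-1` A `&` Z @^-1` B) = (P (X @^-1` A) * P (Z @^-1` B))%E) ->
  measurable_fun setT h -> (forall t, 0 <= h t)%E ->
  (\int[P]_w h (X w, Z w) = \int[P]_w \int[gam]_z h (X w, z))%E.
Proof.
move=> mX mZ Zg XZ mh h0.
pose X' : {RV P >-> T1} := HB.pack X (isMeasurableFun.Build _ _ _ _ X mX).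
have mXZ : measurable_fun setT (fun w => (X w, Z w)) by exact: measurable_fun_pair.
pose XZ' : {RV P >-> (T1 * T2)%type} :=
  HB.pack (fun w => (X w, Z w)) (isMeasurableFun.Build _ _ _ _ _ mXZ).
rewrite -[LHS](ge0_integral_distribution XZ' mh h0).
transitivity (\int[distribution P X' \x gam]_t h t)%E.
  apply: eq_measure_integral => A mA _; apply/esym/product_measure_unique => //.
  by move=> B C mB mC; rewrite /= /pushforward/= -Zg// -XZ.
rewrite fubini_tonelli1//.
have mF := measurable_fun_fubini_tonelli_F h mh h0.
rewrite (ge0_integral_distribution X')//.
by move=> x; apply: integral_ge0.
Qed.

End independence.

Section coordinate_noise.
Context {R : realType} {d : measure_display} {Omega : measurableType d}.
Variables (P : probability Omega R) (m : nat) (X : nat * 'I_m -> Omega -> R).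
Hypothesis mX : forall p, measurable_fun setT (X p).
Hypothesis indX : forall k,
  mutually_independent P (fun p : 'I_k * 'I_m => X (val p.1, p.2)).

Definition noise_events (J : set (nat * 'I_m)) : set (set Omega) :=
  [set A | exists p B, [/\ J p, measurable B & A = X p @^-1` B]].

(** The pi-system used to pass from finitely many coordinates to all of them:
    only the coordinates in J with first index below some K are constrained. *)
Definition cylinders (J : set (nat * 'I_m)) : set (set Omega) :=
  [set A | exists K B, [/\ forall p, measurable (B p),
    forall p, (~ J p) \/ (K <= p.1)%N -> B p = setT &
    A = \bigcap_p (X p @^-1` B p)]].

Lemma cylinder_fin K (B : nat * 'I_m -> set R) :
  (forall p, (K <= p.1)%N -> B p = setT) ->
  \bigcap_p (X p @^-1` B p) =
  \bigcap_(p : 'I_K * 'I_m) (X (val p.1, p.2) @^-1` B (val p.1, p.2)).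
Proof.
move=> BT; apply/seteqP; split=> [w h p _|w h [k c] _] /=; first exact: (h (val p.1, p.2)).
by case: (ltnP k K) => kK; [exact: (h (Ordinal kK, c))|rewrite BT].
Qed.

Lemma cylinder_measurable J : cylinders J `<=` measurable.
Proof.
move=> _ [K [B [mB BT ->]]]; rewrite (@cylinder_fin K); last by move=> p pK; rewrite BT//; right.
apply: fin_bigcap_measurable => // p _.
by rewrite -[X in measurable X]setTI; exact: mX.
Qed.

Lemma cylinderI J : setI_closed (cylinders J).
Proof.
move=> _ _ [K [B [mB BT ->]]] [K' [B' [mB' BT' ->]]].
exists (maxn K K'), (fun p => B p `&` B' p); split.
- by move=> p; exact: measurableI.
- move=> p [nJ|]; first by rewrite BT ?BT' ?setIT//; left.
  by rewrite geq_max => /andP[pK pK']; rewrite BT ?BT' ?setIT//; right.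
- apply/seteqP; split=> [w [h h'] p _|w h]; first by split; [exact: h|exact: h'].
  by split=> p _; have [] := h p I.
Qed.

Lemma cylinderT J : cylinders J setT.
Proof.
exists 0%N, (fun=> setT); split=> //.
by apply/seteqP; split.
Qed.

Lemma indep_cylinders J J' : J `&` J' = set0 ->
  indep_classes P (cylinders J) (cylinders J').
Proof.
move=> JJ' _ _ [K [B [mB BT ->]]] [K' [B' [mB' BT' ->]]].
pose M := maxn K K'.
have BTM p : (M <= p.1)%N -> B p = setT.
  by rewrite geq_max => /andP[pK pK']; rewrite BT//; right.
have BTM' p : (M <= p.1)%N -> B' p = setT.
  by rewrite geq_max => /andP[pK pK']; rewrite BT'//; right.
have -> : \bigcap_p (X p @^-1` B p) `&` \bigcap_p (X p @^-1` B' p) =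
    \bigcap_p (X p @^-1` (B p `&` B' p)).
  apply/seteqP; split=> [w [h h'] p _|w h]; first by split; [exact: h|exact: h'].
  by split=> p _; have [] := h p I.
rewrite !(@cylinder_fin M)//; last by move=> p pM; rewrite BTM// BTM'// setIT.
rewrite !indX//; last by move=> p; exact: measurableI.
rewrite -big_split; apply: eq_bigr => p _ /=.
set q := (nat_of_ord p.1, p.2).
have [Jq|nJq] := pselect (J q).
  have -> : B' q = setT.
    by apply: BT'; left => J'q; have : set0 q by rewrite -JJ'.
  by rewrite setIT preimage_setT probability_setT mule1.
have -> : B q = setT by apply: BT; left.
by rewrite setTI preimage_setT probability_setT mul1e.
Qed.

Lemma noise_events_sub_cylinders J : noise_events J `<=` cylinders J.
Proof.
move=> _ [p [B [Jp mB ->]]].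
exists p.1.+1, (fun q => if q == p then B else setT); split.
- by move=> q; case: ifP.
- move=> q; case: eqVneq => [->|//] [//|]; by rewrite ltnn.
- apply/seteqP; split=> [w Bw q _|w h]; first by case: eqVneq => [->|].
  by have := h p I; rewrite eqxx.
Qed.

(** Sigma-algebras generated by disjoint sets of coordinates are independent;
    this is checked on the cylinders, where it is the product rule. *)
Lemma indep_noise J J' : J `&` J' = set0 ->
  indep_classes P <<s noise_events J >> <<s noise_events J' >>.
Proof.
move=> JJ' A B sA sB.
have sub J0 : <<s noise_events J0 >> `<=` <<s cylinders J0 >>.
  apply: smallest_sub; first exact: smallest_sigma_algebra.
  by move=> C hC; apply: sub_sigma_algebra; exact: noise_events_sub_cylinders.
have indC := indep_cylinders JJ'.
by apply: (indep_classes_pi2 _ _ _ _ _ _ indC); try exact: cylinder_measurable;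
  try exact: cylinderI; try exact: cylinderT; exact: sub.
Qed.

Lemma noise_sub_measurable J : <<s noise_events J >> `<=` measurable.
Proof.
apply: smallest_sub; first exact: sigma_algebra_measurable.
move=> _ [p [B [_ mB ->]]]; rewrite -[X in measurable X]setTI; exact: mX.
Qed.

End coordinate_noise.

(** * Brownian increments along the time grid *)

Section brownian_noise.
Context {R : realType} {d : measure_display} {Omega : measurableType d}.
Variables (P : probability Omega R) (m : nat) (W : R -> Omega -> 'cV[R]_m).
Variable delta : R.
Hypothesis hW : brownian_motion P W.
Hypothesis delta_gt0 : 0 < delta.

Definition increment (k : nat) (w : Omega) : 'cV[R]_m :=
  W (k.+1%:R * delta) w - W (k%:R * delta) w.

Definition increment_coord (p : nat * 'I_m) (w : Omega) : R :=
  increment p.1 w p.2 0.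

Let time_ge0 k : 0 <= k%:R * delta.
Proof. by rewrite mulr_ge0// ltW. Qed.

Lemma measurable_increment_coord p : measurable_fun setT (increment_coord p).
Proof.
case: hW => mW _ _ _ _.
have mc k c : measurable_fun setT (fun w => W (k%:R * delta) w c 0).
  exact: measurableT_comp (measurable_coord _ _) (mW _ (time_ge0 k)).
rewrite /increment_coord /increment; under eq_fun do rewrite !mxE.
exact: measurable_funB.
Qed.

Lemma measurable_increment k : measurable_fun setT (increment k).
Proof.
apply: measurable_fun_mx => c j; rewrite ord1.
exact: (measurable_increment_coord (k, c)).
Qed.

Lemma increment_coord_law p (B : set R) : measurable B ->
  P (increment_coord p @^-1` B) = normal_prob 0 (Num.sqrt delta) B.
Proof.
case: hW => _ _ _ _ law mB.
have kk : p.1%:R * delta < p.1.+1%:R * delta by rewrite ltr_pM2r// ltr_nat.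
have E : p.1.+1%:R * delta - p.1%:R * delta = delta.
  by rewrite -mulrBl -natrB// subSnn mul1r.
by have := law _ _ p.2 B (time_ge0 p.1) kk mB; rewrite E.
Qed.

Lemma increment_independent k0 k :
  mutually_independent P
    (fun p : 'I_k * 'I_m => increment_coord (k0 + val p.1, p.2)%N).
Proof.
case: hW => _ _ _ ind _.
have := ind k (fun a => (k0 + a)%N%:R * delta) (time_ge0 _).
have : {homo (fun a => (k0 + a)%N%:R * delta) : a b / (a < b)%N >-> a < b}.
  by move=> a b ab; rewrite ltr_pM2r// ltr_nat ltn_add2l.
by move=> /[swap] /[apply] h B mB; have := h B mB; under eq_bigcapr do rewrite addnS;
  under eq_bigr do rewrite addnS.
Qed.

(** By independence of the coordinates the laws agree on lower orthants. *)
Lemma increment_law k (B : set 'cV[R]_m) : measurable B ->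
  P (increment k @^-1` B) = P (increment 0 @^-1` B).
Proof.
have mI k' : measurable_fun setT (fun w => (increment k' w, ord0 : 'I_1)).
  by apply: measurable_fun_pair => //; exact: measurable_increment.
pose I' k' : {RV P >-> ('cV[R]_m * 'I_1)%type} :=
  HB.pack (fun w => (increment k' w, ord0 : 'I_1))
    (isMeasurableFun.Build _ _ _ _ _ (mI k')).
move=> mB; have E k' : P (increment k' @^-1` B) = distribution P (I' k') (B `*` setT).
  by congr (P _); apply/seteqP; split=> [w h|w []].
rewrite !E; apply: (@measure_ext_orthant R m 0 (distribution P (I' k))
  (distribution P (I' 0%N))); last exact: measurableX.
move=> a j.
have orth k' : distribution P (I' k') (orthant a j) =
    (\prod_(p : 'I_1 * 'I_m) normal_prob 0%R (Num.sqrt delta) `]-oo, a p.2 0%R]%classic)%E.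
  have -> : distribution P (I' k') (orthant a j) =
      P (\bigcap_(p : 'I_1 * 'I_m) (increment_coord (k' + val p.1, p.2)%N @^-1`
         `]-oo, a p.2 0]%classic)).
    congr (P _); apply/seteqP; split=> [w [h _] [i c] _|w h].
      by rewrite ord1 /= addn0 /increment_coord/= in_itv/=; exact: h.
    split; last by rewrite /= !ord1.
    move=> c; have := h (ord0, c) I.
    by rewrite /= addn0 /increment_coord/= in_itv.
  rewrite (increment_independent k' (B := fun p => `]-oo, a p.2 0]%classic))//.
  by apply: eq_bigr => p _; rewrite increment_coord_law.
exact: etrans (orth k) (esym (orth 0%N)).
Qed.

HB.instance Definition _ k :=
  isMeasurableFun.Build _ _ _ _ (increment k) (measurable_increment k).

Definition step_law : probability 'cV[R]_m R := distribution P (increment 0).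

Lemma increment_step_law k B : measurable B ->
  P (increment k @^-1` B) = step_law B.
Proof. exact: increment_law. Qed.

Lemma integral_step_law k (f : 'cV[R]_m -> \bar R) :
  measurable_fun setT f -> (forall z, 0 <= f z)%E ->
  (\int[step_law]_z f z = \int[P]_w f (increment k w))%E.
Proof.
move=> mf f0; rewrite -(ge0_integral_distribution (increment k) mf f0).
by apply: eq_measure_integral => B mB _; exact/esym/increment_law.
Qed.

Lemma noise_measurable_coord (J : set (nat * 'I_m)) p : J p ->
  @measurable_fun _ _ (g_sigma_algebraType (noise_events increment_coord J)) R
    setT (increment_coord p).
Proof.
by move=> Jp _ B mB; rewrite setTI; apply: sub_sigma_algebra; exists p, B.
Qed.

Lemma noise_measurable_increment (J : set (nat * 'I_m)) k :
  (forall c, J (k, c)) ->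
  @measurable_fun _ _ (g_sigma_algebraType (noise_events increment_coord J))
    'cV[R]_m setT (increment k).
Proof.
move=> Jk; apply: measurable_fun_mx => c j; rewrite ord1.
exact: (noise_measurable_coord (Jk c)).
Qed.

(** The coordinates of the increment are independent and are integrated out one
    at a time; each contributes the square of its column of A, and the cross
    terms vanish because the means are zero (normal_quadratic). *)
Lemma increment_quadratic n (u : 'cV[R]_n) (A : 'M[R]_(n, m)) :
  (\int[step_law]_z (hsnorm (u + A *m z) ^+ 2)%:E <=
    (hsnorm u ^+ 2 + delta * hsnorm A ^+ 2)%:E)%E.
Proof.
pose X c := increment_coord (0%N, c).
(* U l is u + A z with z restricted to the coordinates listed in l. *)
pose U (l : seq 'I_m) w : 'cV[R]_n := \col_r (u r 0 + \sum_(c <- l) A r c * X c w).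
have nU (J : set (nat * 'I_m)) l : (forall c, c \in l -> J (0%N, c)) ->
    @measurable_fun _ _ (g_sigma_algebraType (noise_events increment_coord J))
      'cV[R]_n setT (U l).
  move=> Jl; apply: measurable_fun_mx => r j; rewrite ord1.
  under eq_fun do rewrite mxE; apply: measurable_funD => //.
  elim: l Jl => [|c l IH] Jl; first by (under eq_fun do rewrite big_nil); exact: measurable_cst.
  under eq_fun do rewrite big_cons; apply: measurable_funD.
    apply: measurable_funM => //; apply: noise_measurable_coord.
    by apply: Jl; rewrite mem_head.
  by apply: IH => c' c'l; apply: Jl; rewrite inE c'l orbT.
have mU l : measurable_fun setT (U l).
  move=> _ B mB; have := nU setT l (fun _ _ => I) measurableT B mB.
  rewrite !setTI; apply: noise_sub_measurable; exact: measurable_increment_coord.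
have mX c : measurable_fun setT (X c) by exact: measurable_increment_coord.
have msq : measurable_fun setT (fun x : 'cV[R]_n => (hsnorm x ^+ 2)%:E).
  by apply/measurable_EFinP; exact: measurable_hsnorm_sqr.
have main l : uniq l -> (\int[P]_w (hsnorm (U l w) ^+ 2)%:E <=
    (hsnorm u ^+ 2 + delta * \sum_(c <- l) \sum_r A r c ^+ 2)%:E)%E.
  elim: l => [_|c l IH /= /andP[cl ul]].
    rewrite big_nil mulr0 addr0.
    have U0 w : U [::] w = u.
      by apply/matrixP => r j; rewrite ord1 /U mxE big_nil addr0.
    under eq_integral do rewrite U0.
    by rewrite integral_cst//= probability_setT mule1.
  pose h (t : 'cV[R]_n * R) : \bar R :=
    (\sum_r (t.1 r 0 + A r c * t.2) ^+ 2)%:E.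
  have mh : measurable_fun setT h.
    apply/measurable_EFinP; apply: measurable_sum => r; apply: measurable_funX.
    apply: measurable_funD; last exact: measurable_funM.
    exact: measurableT_comp (measurable_coord _ _) measurable_fst.
  have h0 t : (0 <= h t)%E by rewrite lee_fin sumr_ge0// => r _; exact: sqr_ge0.
  pose X' : {RV P >-> measurableTypeR R} :=
    HB.pack (X c) (isMeasurableFun.Build _ _ _ (measurableTypeR R) _ (mX c)).
  pose Nc : probability (measurableTypeR R) R := distribution P X'.
  have NcE B : measurable B -> Nc B = normal_prob 0 (Num.sqrt delta) B.
    exact: (increment_coord_law (0%N, c)).
  have inner x : (\int[Nc]_z h (x, z) <=
      (hsnorm x ^+ 2 + delta * \sum_r A r c ^+ 2)%:E)%E.
    rewrite /h; under eq_integral do rewrite -sumEFin.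
    rewrite ge0_integral_sum//; last 2 first.
    - move=> r; apply/measurable_EFinP; apply: measurable_funX.
      by apply: measurable_funD => //; apply: measurable_funM => //; exact: measurable_id.
    - by move=> r z _; rewrite lee_fin sqr_ge0.
    rewrite hsnorm_sqr mulr_sumr -big_split -sumEFin; apply: lee_sum => r _.
    have s0 : 0 < Num.sqrt delta by rewrite sqrtr_gt0.
    have := normal_quadratic s0 NcE (x r 0) (A r c).
    rewrite sqr_sqrtr ?(ltW delta_gt0)//= => /le_trans; apply.
    by rewrite big_ord1 mulrC.
  apply: (@le_trans _ _ (\int[P]_w (hsnorm (U l w) ^+ 2 +
      delta * \sum_r A r c ^+ 2)%:E)%E).
    have -> : (\int[P]_w (hsnorm (U (c :: l) w) ^+ 2)%:E =
               \int[P]_w h (U l w, X c w))%E.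
      apply: eq_integral => w _; rewrite hsnorm_sqr /h; congr EFin.
      by apply: eq_bigr => r _; rewrite big_ord1 /U !mxE big_cons addrCA addrC.
    rewrite (integral_indep (gam := Nc) (mU l) (mX c))//; last first.
      move=> B C mB mC.
      pose J := [set p : nat * 'I_m | p.2 \in l].
      have JJ : J `&` [set (0%N, c)] = set0.
        by apply/seteqP; split=> // p [+ pE]; rewrite /J/= pE/= (negbTE cl).
      apply: (indep_noise measurable_increment_coord _ JJ).
      - by move=> k; exact: (increment_independent 0 (k := k)).
      - have := @nU J l (fun _ h => h) measurableT B mB; by rewrite setTI.
      - by apply: sub_sigma_algebra; exists (0%N, c), C.
    apply: ge0_le_integral => //.
    - by move=> w _; exact: integral_ge0.
    - have mF := @measurable_fun_fubini_tonelli_F _ _ _ _ _ Nc h mh h0.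
      exact: measurableT_comp mF (mU l).
    - apply/measurable_EFinP; apply: measurable_funD => //.
      by move/measurable_EFinP : msq => msq'; exact: measurableT_comp msq' (mU l).
  under eq_integral do rewrite EFinD.
  rewrite ge0_integralD//; last 3 first.
  - by move=> w _; rewrite lee_fin sqr_ge0.
  - exact: measurableT_comp msq (mU l).
  - move=> w _; rewrite lee_fin mulr_ge0 ?(ltW delta_gt0)// sumr_ge0// => r _.
    exact: sqr_ge0.
  rewrite integral_cst//= probability_setT mule1 big_cons.
  apply: le_trans (leeD2r _ (IH ul)) _.
  by rewrite -EFinD lee_fin mulrDr -addrA (addrC (delta * \sum_(j <- l) _)).
have E w : u + A *m increment 0 w = U (index_enum 'I_m) w.
  apply/matrixP => r j; rewrite ord1 /U !mxE; congr (_ + _).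
rewrite (integral_step_law 0)//; last 2 first.
- apply: (measurableT_comp msq); apply: measurable_fun_mx => r j; rewrite ord1.
  under eq_fun do rewrite !mxE; apply: measurable_funD => //.
  apply: measurable_sum => c; apply: measurable_funM => //; exact: measurable_coord.
- by move=> z; rewrite lee_fin sqr_ge0.
under eq_integral do rewrite E.
apply: le_trans (main _ (index_enum_uniq _)) _.
by rewrite exchange_big (hsnorm_sqr A).
Qed.

End brownian_noise.

(** * The one-step operator and uniqueness of its invariant law *)

Section switched_operator.
Context {R : realType} {n m N : nat}.
Local Notation E := ('cV[R]_n * 'I_N.+1)%type.
Variables (gam : probability 'cV[R]_m R) (F : 'I_N.+1 -> 'cV[R]_n -> 'cV[R]_m -> 'cV[R]_n).
Variable A : 'M[R]_N.+1.
Hypothesis mF : forall i, measurable_fun setT (fun p : 'cV[R]_n * 'cV[R]_m => F i p.1 p.2).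
Hypothesis A_ge0 : forall i j, 0 <= A i j.
Hypothesis A_sum1 : forall i, \sum_j A i j = 1.
Implicit Types f g : E -> \bar R.

Definition step_op f (z : E) : \bar R :=
  (\sum_j (A z.2 j)%:E * \int[gam]_u f (F z.2 z.1 u, j))%E.

Lemma measurable_step_section f i j : measurable_fun setT f ->
  measurable_fun setT (fun p : 'cV[R]_n * 'cV[R]_m => f (F i p.1 p.2, j)).
Proof.
move=> mf; apply: (measurableT_comp mf).
exact: measurable_fun_pair.
Qed.

Lemma measurable_step_fiber f x i j : measurable_fun setT f ->
  measurable_fun setT (fun u => f (F i x u, j)).
Proof.
move=> mf; exact: measurableT_comp (measurable_step_section i j mf) (measurable_pair1 x).
Qed.

Lemma step_op_ge0 f : (forall z, 0 <= f z)%E -> forall z, (0 <= step_op f z)%E.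
Proof.
move=> f0 z; apply: sume_ge0 => j _; apply: mule_ge0; first by rewrite lee_fin.
exact: integral_ge0.
Qed.

Lemma measurable_step_op f : measurable_fun setT f -> (forall z, 0 <= f z)%E ->
  measurable_fun setT (step_op f).
Proof.
move=> mf f0; apply: measurable_fun_state => i; rewrite /step_op /=.
apply: emeasurable_sum => j; apply: emeasurable_funM => //.
have := @measurable_fun_fubini_tonelli_F _ _ _ _ _ gam _ (measurable_step_section i j mf).
exact.
Qed.

Lemma step_op_le f g : measurable_fun setT f -> measurable_fun setT g ->
  (forall z, 0 <= f z)%E -> (forall z, f z <= g z)%E ->
  forall z, (step_op f z <= step_op g z)%E.
Proof.
move=> mf mg f0 fg z; apply: lee_sum => j _.
apply: lee_wpmul2l; first by rewrite lee_fin.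
by apply: ge0_le_integral => //; exact: measurable_step_fiber.
Qed.

Lemma step_op_cst (c : R) z : 0 <= c -> step_op (fun=> c%:E) z = c%:E.
Proof.
move=> c0; rewrite /step_op.
under eq_bigr do rewrite integral_cst//= probability_setT mule1 -EFinM.
by rewrite sumEFin -mulr_suml A_sum1 mul1r.
Qed.

Lemma iter_step_op_measurable f k : measurable_fun setT f -> (forall z, 0 <= f z)%E ->
  measurable_fun setT (iter k step_op f) /\ (forall z, 0 <= iter k step_op f z)%E.
Proof.
move=> mf f0; elim: k => [//|k [mk k0]]/=; split; first exact: measurable_step_op.
exact: step_op_ge0.
Qed.

Lemma iter_step_op_le1 f k : measurable_fun setT f -> (forall z, 0 <= f z)%E ->
  (forall z, f z <= 1)%E -> forall z, (iter k step_op f z <= 1)%E.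
Proof.
move=> mf f0 f1; elim: k => [//|k IH] z /=.
have [mk k0] := iter_step_op_measurable k mf f0.
by apply: le_trans (step_op_le mk _ k0 IH z) _ => //; rewrite step_op_cst.
Qed.

(** Invariance tested on nonnegative measurable functions, a form that can be
    iterated without integrability conditions. *)
Definition op_invariant (pi : probability E R) : Prop :=
  forall f, measurable_fun setT f -> (forall z, 0 <= f z)%E ->
  (\int[pi]_z f z = \int[pi]_z step_op f z)%E.

Lemma op_invariant_iter pi f k : op_invariant pi ->
  measurable_fun setT f -> (forall z, 0 <= f z)%E ->
  (\int[pi]_z f z = \int[pi]_z iter k step_op f z)%E.
Proof.
move=> ip mf f0; elim: k => [//|k IH] /=.
have [mk k0] := iter_step_op_measurable k mf f0.
by rewrite IH ip.
Qed.

Section contraction.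
Variables (lam : 'I_N.+1 -> R) (xi : 'cV[R]_N.+1) (rho : R).
Hypothesis lam_ge0 : forall i, 0 <= lam i.
Hypothesis xi_gt0 : forall i, 0 < xi i 0.
Hypothesis rho_ge0 : 0 <= rho.
Hypothesis rho_lt1 : rho < 1.
Hypothesis lam_xi : forall i, lam i * (A *m xi) i 0 <= rho * xi i 0.
Hypothesis F_contract : forall i x y,
  (\int[gam]_u (hsnorm (F i x u - F i y u) ^+ 2)%:E <=
     (lam i * hsnorm (x - y) ^+ 2)%:E)%E.

(** A modulus of continuity in the first variable, quadratic up to an additive
    error.  Unlike a Lipschitz bound it is reproduced by step_op without taking
    square roots, the quadratic part shrinking by the factor rho. *)
Definition quadratic_modulus f (a b : R) : Prop :=
  forall x y j, (f (x, j) <= f (y, j) + (a + b * (xi j 0 * hsnorm (x - y) ^+ 2))%:E)%E.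

(** The error at (F_i(x, u), j) is averaged first over u, which produces the
    factor lam_i, then over j, which produces lam_i (A xi)_i <= rho xi_i. *)
Lemma quadratic_modulus_step f a b : 0 <= a -> 0 <= b ->
  measurable_fun setT f -> (forall z, 0 <= f z)%E ->
  quadratic_modulus f a b -> quadratic_modulus (step_op f) a (rho * b).
Proof.
move=> a0 b0 mf f0 fab x y i.
set s := hsnorm (x - y) ^+ 2.
have s0 : 0 <= s by exact: sqr_ge0.
have msq x' y' : measurable_fun setT (fun u => (hsnorm (F i x' u - F i y' u) ^+ 2)%:E).
  by apply: measurable_hsnorm_sqrB; exact: measurableT_comp (mF i) (measurable_pair1 _).
have fiber j : (\int[gam]_u f (F i x u, j) <= \int[gam]_u f (F i y u, j) +
    (a + b * (xi j 0 * (lam i * s)))%:E)%E.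
  have bx0 : 0 <= b * xi j 0 by rewrite mulr_ge0// ltW.
  have int_err : (\int[gam]_u (a + b * (xi j 0 * hsnorm (F i x u - F i y u) ^+ 2))%:E
      <= (a + b * (xi j 0 * (lam i * s)))%:E)%E.
    under eq_integral do rewrite mulrA EFinD (EFinM (b * xi j 0)).
    rewrite ge0_integralD//; last 2 first.
    - by move=> u _; rewrite -EFinM lee_fin mulr_ge0// sqr_ge0.
    - exact: emeasurable_funM.
    rewrite integral_cst//= probability_setT mule1 EFinD leeD2l//.
    rewrite ge0_integralZl//; last by move=> u _; rewrite lee_fin sqr_ge0.
    rewrite (_ : b * (xi j 0 * (lam i * s)) = (b * xi j 0) * (lam i * s)).
      by rewrite [leRHS]EFinM lee_wpmul2l// lee_fin.
    by ring.
  have err0 u : 0 <= a + b * (xi j 0 * hsnorm (F i x u - F i y u) ^+ 2).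
    by rewrite addr_ge0// mulrA mulr_ge0// sqr_ge0.
  have merr : measurable_fun setT
      (fun u => (a + b * (xi j 0 * hsnorm (F i x u - F i y u) ^+ 2))%:E).
    apply/measurable_EFinP; apply: measurable_funD => //.
    by do 2 apply: measurable_funM => //; apply/measurable_EFinP; exact: msq.
  apply: le_trans (leeD2l _ int_err).
  rewrite -ge0_integralD//; last 2 first.
  - exact: measurable_step_fiber.
  - by move=> u _; rewrite lee_fin.
  apply: ge0_le_integral => //.
  - exact: measurable_step_fiber.
  - by apply: emeasurable_funD => //; exact: measurable_step_fiber.
rewrite /step_op /=.
apply: (@le_trans _ _ (\sum_j (A i j)%:E * (\int[gam]_u f (F i y u, j) +
    (a + b * (xi j 0 * (lam i * s)))%:E))%E).
  by apply: lee_sum => j _; apply: lee_wpmul2l => //; rewrite lee_fin.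
have c0 j : (0 <= (a + b * (xi j 0 * (lam i * s)))%:E)%E.
  rewrite lee_fin addr_ge0// mulr_ge0//.
  by apply: mulr_ge0; [exact: ltW|exact: mulr_ge0].
have I0 j : (0 <= \int[gam]_u f (F i y u, j))%E by exact: integral_ge0.
rewrite (eq_bigr _ (fun j _ => ge0_muleDr (A i j)%:E (I0 j) (c0 j))).
rewrite big_split/= leeD2l//.
rewrite (_ : (\sum_j (A i j)%:E * (a + b * (xi j 0 * (lam i * s)))%:E)%E =
  (\sum_j A i j * (a + b * (xi j 0 * (lam i * s))))%:E); last by rewrite -sumEFin.
rewrite lee_fin.
have -> : \sum_j A i j * (a + b * (xi j 0 * (lam i * s))) =
    a + b * s * (lam i * (A *m xi) i 0).
  under eq_bigr do rewrite mulrDr.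
  rewrite big_split/= -mulr_suml A_sum1 mul1r; congr (_ + _).
  rewrite mxE !mulr_sumr; apply: eq_bigr => j _; ring.
rewrite lerD2l (_ : rho * b * _ = b * s * (rho * xi i 0)); last by ring.
by rewrite ler_wpM2l// mulr_ge0.
Qed.

Lemma quadratic_modulus_iter f a b k : 0 <= a -> 0 <= b ->
  measurable_fun setT f -> (forall z, 0 <= f z)%E ->
  quadratic_modulus f a b -> quadratic_modulus (iter k step_op f) a (rho ^+ k * b).
Proof.
move=> a0 b0 mf f0 fab; elim: k => [|k IH] /=; first by rewrite expr0 mul1r.
have [mk k0] := iter_step_op_measurable k mf f0.
rewrite exprS -mulrA; apply: quadratic_modulus_step => //.
by rewrite mulr_ge0// exprn_ge0.
Qed.

(** K t <= e + K^2 t^2 / (4 e); the sum of the inverses of the xi_j turns t^2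
    into a multiple of xi_j t^2. *)
Lemma lipschitz_quadratic_modulus (f : E -> R) (K e : R) : 0 < e ->
  (forall x y j, `|f (x, j) - f (y, j)| <= K * hsnorm (x - y)) ->
  exists2 b, 0 <= b & quadratic_modulus (EFin \o f) e b.
Proof.
move=> e0 fK; pose S := \sum_j (xi j 0)^-1.
have S0 j : 1 <= S * xi j 0.
  rewrite -ler_pdivrMr// div1r /S (bigD1 j)//= lerDl sumr_ge0// => i _.
  by rewrite invr_ge0 ltW.
have Sge0 : 0 <= S by apply: sumr_ge0 => i _; rewrite invr_ge0 ltW.
have q0 : 0 <= K ^+ 2 / (4 * e) by rewrite divr_ge0 ?sqr_ge0// mulr_ge0// ltW.
exists (K ^+ 2 / (4 * e) * S); first exact: mulr_ge0.
move=> x y j; rewrite /= -EFinD lee_fin -lerBlDl.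
apply: le_trans (ler_norm _) _; apply: le_trans (fK _ _ _) _.
set t := hsnorm _.
apply: (@le_trans _ _ (e + K ^+ 2 / (4 * e) * t ^+ 2)).
  have -> : e + K ^+ 2 / (4 * e) * t ^+ 2 = K * t + (2 * e - K * t) ^+ 2 / (4 * e).
    by field; rewrite gt_eqF.
  by rewrite lerDl divr_ge0 ?sqr_ge0// mulr_ge0// ltW.
rewrite lerD2l -(mulrA _ S) ler_wpM2l// mulrA ler_peMl//; exact: sqr_ge0.
Qed.

Lemma integral_state_coord (pi : probability E R) (g : 'I_N.+1 -> \bar R) :
  (forall j, 0 <= g j)%E ->
  (\int[pi]_z g z.2 = \sum_j g j * pi (setT `*` [set j]))%E.
Proof.
move=> g0.
have mS j : measurable ([set: 'cV[R]_n] `*` [set j : 'I_N.+1]) by exact: measurableX.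
transitivity (\int[pi]_z (\sum_j (g j * (\1_(setT `*` [set j]) z)%:E)))%E.
  apply: eq_integral => -[x i] _; rewrite (bigD1 i)//= indicE mem_set//= mule1.
  rewrite big1 ?adde0// => j ji; rewrite indicE memNset ?mule0//=.
  by move=> [_ /= ij]; rewrite ij eqxx in ji.
rewrite ge0_integral_sum//; last 2 first.
- move=> j; apply: emeasurable_funM => //.
  by apply/measurable_EFinP; exact: measurable_indic.
- by move=> j z _; rewrite mule_ge0// lee_fin.
apply: eq_bigr => j _; rewrite ge0_integralZl//.
- by rewrite integral_indic// setIT.
- by apply/measurable_EFinP; exact: measurable_indic.
Qed.

(** How far the k-th iterate of a function with values in [0, 1] can be from
    its value at the origin in the same regime; the truncation at 1 allows
    dominated convergence without moments of the invariant law. *)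
Definition truncated_error (e b : R) (k : nat) (z : E) : R :=
  Num.min 1 (e + rho ^+ k * b * (xi z.2 0 * hsnorm z.1 ^+ 2)).

Lemma measurable_truncated_error e b k : measurable_fun setT (truncated_error e b k).
Proof.
apply: measurable_minr => //; apply: measurable_funD => //; apply: measurable_funM => //.
apply: measurable_fun_state => j /=; apply: measurable_funM => //.
exact: measurable_hsnorm_sqr.
Qed.

Lemma truncated_error_ge0 e b k z : 0 <= e -> 0 <= b -> 0 <= truncated_error e b k z.
Proof.
move=> e0 b0; rewrite le_min ler01/= addr_ge0// mulr_ge0//.
  by rewrite mulr_ge0// exprn_ge0.
by rewrite mulr_ge0 ?sqr_ge0// ltW.
Qed.

Lemma cvg_integral_truncated_error (pi : probability E R) e b : 0 <= e -> 0 <= b ->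
  (\int[pi]_z (truncated_error e b k z)%:E)%E @[k --> \oo] --> (Num.min 1 e)%:E.
Proof.
move=> e0 b0.
have -> : (Num.min 1 e)%:E = (\int[pi]_z (cst (Num.min 1 e)%:E z))%E.
  by rewrite integral_cst//= probability_setT mule1.
have [] // := @dominated_convergence _ _ _ pi setT measurableT
  (fun k z => (truncated_error e b k z)%:E) (cst (Num.min 1 e)%:E) (cst 1%E).
- by move=> k; apply/measurable_EFinP; exact: measurable_truncated_error.
- apply: aeW => z _; apply: cvg_EFin; first by near=> k.
  have c0 : (rho ^+ k * b * (xi z.2 0 * hsnorm z.1 ^+ 2)) @[k --> \oo] --> (0 : R).
    pose v := b * (xi z.2 0 * hsnorm z.1 ^+ 2).
    have -> : (fun k => rho ^+ k * b * (xi z.2 0 * hsnorm z.1 ^+ 2)) =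
      (fun k => v * rho ^+ k) by apply/funext => k; rewrite /v; ring.
    rewrite -(mulr0 v); apply: cvgM; first exact: cvg_cst.
    by apply: cvg_expr; rewrite ger0_norm.
  have hc : {for (0 : R), continuous ((cst 1 : R -> R^o) \min (fun t : R => e + t : R^o))}.
    apply: continuous_min; first exact: cvg_cst.
    by apply: cvgD; [exact: cvg_cst|exact: cvg_id].
  have := cvg_comp _ _ c0 hc; rewrite /= addr0; exact.
- exact: finite_measure_integrable_cst.
- apply: aeW => z k _; rewrite lee_fin ger0_norm ?truncated_error_ge0//.
  by rewrite ge_min lexx.
Unshelve. all: by end_near. Qed.

(** Replace f by its k-th iterate under both laws, then by the value of that
    iterate at the origin, which only sees the common regime marginal.  Each
    replacement costs a truncated error, whose integral tends to at most e. *)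
Lemma op_invariant_cutoff_le pi1 pi2 a j k (e : R) : 0 < e ->
  op_invariant pi1 -> op_invariant pi2 ->
  (forall i, pi1 (setT `*` [set i]) = pi2 (setT `*` [set i])) ->
  (\int[pi1]_z (cutoff a j k z)%:E <= \int[pi2]_z (cutoff a j k z)%:E + (2 * e)%:E)%E.
Proof.
move=> e0 i1 i2 p12; set f := fun z => (cutoff a j k z)%:E.
have mf : measurable_fun setT f by apply/measurable_EFinP; exact: measurable_cutoff.
have f0 z : (0 <= f z)%E by rewrite lee_fin cutoff_ge0.
have f1 z : (f z <= 1)%E by rewrite lee_fin cutoff_le1.
have [b b0 fb] := lipschitz_quadratic_modulus (f := cutoff a j k) e0
  (fun x y i => cutoff_lipschitz a j k x y i).
have step l : (\int[pi1]_z f z <= \int[pi2]_z f z +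
    (\int[pi1]_z (truncated_error e b l z)%:E +
     \int[pi2]_z (truncated_error e b l z)%:E))%E.
  have [mk k0] := iter_step_op_measurable l mf f0.
  have k1 := iter_step_op_le1 l mf f0 f1.
  have kmod := quadratic_modulus_iter l (ltW e0) b0 mf f0 fb.
  set fl := iter l step_op f in mk k0 k1 kmod *.
  have mr : measurable_fun setT (fun z => (truncated_error e b l z)%:E).
    by apply/measurable_EFinP; exact: measurable_truncated_error.
  have r0 z : (0 <= (truncated_error e b l z)%:E)%E.
    by rewrite lee_fin truncated_error_ge0// ltW.
  have mg : measurable_fun setT (fun z : E => fl (0%R, z.2)).
    by apply: measurable_fun_state => i; exact: (@measurable_cst _ _ _ _ setT (fl (0%R, i))).
  have up z : (fl z <= fl (0%R, z.2) + (truncated_error e b l z)%:E)%E.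
    case: z => x i /=; rewrite /truncated_error/=.
    have [_|_] := leP 1 (e + _ * _).
      by rewrite (le_trans (k1 _))// leeDr.
    by have := kmod x 0 i; rewrite subr0.
  have dn z : (fl (0%R, z.2) <= fl z + (truncated_error e b l z)%:E)%E.
    case: z => x i /=; rewrite /truncated_error/=.
    have [_|_] := leP 1 (e + _ * _).
      by rewrite (le_trans (k1 _))// leeDr.
    by have := kmod 0 x i; rewrite sub0r hsnormN.
  rewrite (op_invariant_iter l i1 mf f0) (op_invariant_iter l i2 mf f0) -/fl.
  apply: (@le_trans _ _ (\int[pi1]_z (fl (0%R, z.2) + (truncated_error e b l z)%:E))%E).
    by apply: ge0_le_integral => //; exact: emeasurable_funD.
  rewrite ge0_integralD// [leRHS]addeCA [leRHS]addeC leeD2r//.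
  rewrite (integral_state_coord pi1 (g := fun i => fl (0%R, i)))//.
  under eq_bigr do rewrite p12.
  rewrite -(integral_state_coord pi2 (g := fun i => fl (0%R, i)))//.
  rewrite -ge0_integralD//.
  by apply: ge0_le_integral => //; exact: emeasurable_funD.
have lim1 := cvg_integral_truncated_error pi1 (ltW e0) b0.
have lim2 := cvg_integral_truncated_error pi2 (ltW e0) b0.
have fin2 : (\int[pi2]_z f z)%E \is a fin_num.
  rewrite ge0_fin_numE; last exact: integral_ge0.
  apply: (@le_lt_trans _ _ (\int[pi2]_z cst 1 z)%E); first exact: ge0_le_integral.
  by rewrite integral_cst//= probability_setT mule1 ltry.
have lim12 : (\int[pi2]_z f z + (\int[pi1]_z (truncated_error e b l z)%:E +
    \int[pi2]_z (truncated_error e b l z)%:E))%E @[l --> \oo] -->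
    (\int[pi2]_z f z + ((Num.min 1 e)%:E + (Num.min 1 e)%:E))%E.
  apply: cvgeD; [exact: fin_num_adde_defr|exact: cvg_cst|].
  by apply: cvgeD.
apply: (@le_trans _ _ (\int[pi2]_z f z + ((Num.min 1 e)%:E + (Num.min 1 e)%:E))%E).
  rewrite -(cvg_lim (@ereal_hausdorff R) lim12); apply: lime_ge.
    by apply/cvg_ex; eexists; exact: lim12.
  by near=> l; exact: step.
rewrite leeD2l// -EFinD lee_fin mulr_natl mulr2n lerD// ge_min lexx orbT//.
Unshelve. all: by end_near. Qed.

Theorem op_invariant_unique pi1 pi2 :
  op_invariant pi1 -> op_invariant pi2 ->
  (forall i, pi1 (setT `*` [set i]) = pi2 (setT `*` [set i])) ->
  forall B, measurable B -> pi1 B = pi2 B.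
Proof.
move=> i1 i2 p12; apply: measure_ext_cutoff => a j k.
apply/eqP; rewrite eq_le; apply/andP; split; apply/lee_addgt0Pr => e e0.
- have := op_invariant_cutoff_le a j k (divr_gt0 e0 (ltr0n R 2)) i1 i2 p12.
  by rewrite mulrC divfK.
- have p21 i := esym (p12 i).
  have := op_invariant_cutoff_le a j k (divr_gt0 e0 (ltr0n R 2)) i2 i1 p21.
  by rewrite mulrC divfK.
Qed.

End contraction.

End switched_operator.

(** * Values driven along a path of regimes *)

Section paths.
Context {R : realType} {N : nat}.
Variables (A : 'M[R]_N.+1) (init : 'I_N.+1 -> R).
Notation path_of := ('I_N.+1 * seq 'I_N.+1)%type.

(** Paths of k steps, as the current state and the list of past states, most
    recent first. *)
Fixpoint paths (k : nat) : seq path_of :=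
  if k is k'.+1 then [seq (j, p.1 :: p.2) | p <- paths k', j <- index_enum 'I_N.+1]
  else [seq (j, [::]) | j <- index_enum 'I_N.+1].

Fixpoint path_weight (j : 'I_N.+1) (q : seq 'I_N.+1) : R :=
  if q is i :: q' then path_weight i q' * A i j else init j.

Lemma path_weight_ge0 j q : (forall i j, 0 <= A i j) -> (forall i, 0 <= init i) ->
  0 <= path_weight j q.
Proof. by move=> A0 i0; elim: q j => [|i q IH] j //=; rewrite mulr_ge0. Qed.

Lemma paths_uniq k : uniq (paths k).
Proof.
elim: k => [|k IH] /=.
  by rewrite map_inj_uniq ?index_enum_uniq// => i j [].
apply: allpairs_uniq => //; first exact: index_enum_uniq.
by move=> [[a l] j] [[a' l'] j'] _ _ /= [-> -> ->].
Qed.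

Lemma mem_paths k j q : ((j, q) \in paths k) = (size q == k).
Proof.
elim: k j q => [|k IH] j [|i q] /=.
- by rewrite map_f// mem_index_enum.
- by apply/negbTE/mapP => -[? _].
- by apply/negbTE/allpairsPdep => -[? [? [_ _]]].
- rewrite eqSS -(IH i); apply/allpairsPdep/idP.
    by move=> [[i' q'] [j' [+ _ /= [_ -> ->]]]].
  by move=> qk; exists (i, q), j; rewrite mem_index_enum.
Qed.

End paths.

Section driven_paths.
Context {R : realType} {d : measure_display} {Omega : measurableType d}.
Variables (P : probability Omega R) (n m N : nat) (W : R -> Omega -> 'cV[R]_m).
Variable delta : R.
Hypothesis hW : brownian_motion P W.
Hypothesis delta_gt0 : 0 < delta.
Variable F : 'I_N.+1 -> 'cV[R]_n -> 'cV[R]_m -> 'cV[R]_n.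
Hypothesis mF : forall i, measurable_fun setT (fun p : 'cV[R]_n * 'cV[R]_m => F i p.1 p.2).
Local Notation Z := (increment W delta).
Local Notation noise_measurable J T Y :=
  (@measurable_fun _ _ (g_sigma_algebraType (noise_events (increment_coord W delta) J)) T setT Y).
Local Notation gam := (step_law hW delta_gt0).

Lemma noise_measurableW d' (T : measurableType d') J (Y : Omega -> T) :
  noise_measurable J T Y -> measurable_fun setT Y.
Proof.
move=> mY _ B mB; have := mY measurableT B mB; rewrite !setTI.
by apply: noise_sub_measurable; exact: (measurable_increment_coord hW delta_gt0).
Qed.

(** The increments over distinct steps are independent, so a fresh increment
    can be integrated out first. *)
Lemma integral_fresh_increment d' (T : measurableType d') (Y : Omega -> T)
    (J : set (nat * 'I_m)) o (h : T * 'cV[R]_m -> \bar R) :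
  noise_measurable J T Y -> (forall c, ~ J (o, c)) ->
  measurable_fun setT h -> (forall t, 0 <= h t)%E ->
  (\int[P]_w h (Y w, Z o w) = \int[P]_w \int[gam]_u h (Y w, u))%E.
Proof.
move=> mY oJ mh h0; apply: integral_indep => //.
- exact: noise_measurableW mY.
- exact: (measurable_increment hW delta_gt0).
- by move=> B mB; exact: increment_step_law.
- move=> B C mB mC; pose J' := [set p : nat * 'I_m | p.1 = o].
  have JJ' : J `&` J' = set0.
    apply/seteqP; split=> // -[k c] [+ ko]; rewrite /J'/= in ko.
    by rewrite ko => /oJ.
  apply: (indep_noise (measurable_increment_coord hW delta_gt0) _ JJ').
  + by move=> k; exact: (increment_independent hW delta_gt0 0 (k := k)).
  + by have := mY measurableT B mB; rewrite setTI.
  + have := noise_measurable_increment (W := W) (delta := delta) (J := J') (k := o)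
      (fun c => erefl _) measurableT mC.
    by rewrite setTI.
Qed.

(** The entries of l are pairs of a regime and a time index, latest first: the
    last entry is applied to x first. *)
Definition drive (x : 'cV[R]_n) (l : seq ('I_N.+1 * nat)) (w : Omega) : 'cV[R]_n :=
  foldr (fun so y => F so.1 y (Z so.2 w)) x l.

Lemma noise_measurable_step J i k (Y : Omega -> 'cV[R]_n) :
  noise_measurable J _ Y -> (forall c, J (k, c)) ->
  noise_measurable J _ (fun w => F i (Y w) (Z k w)).
Proof.
move=> mY Jk; have mZ := noise_measurable_increment (W := W) (delta := delta) Jk.
exact: measurableT_comp (mF i) (measurable_fun_pair mY mZ).
Qed.

Lemma noise_measurable_drive J x l : (forall so c, so \in l -> J (so.2, c)) ->
  noise_measurable J _ (drive x l).
Proof.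
elim: l => [|so l IH] Jl /=; first exact: measurable_cst.
apply: noise_measurable_step; last by move=> c; apply: Jl; rewrite mem_head.
by apply: IH => so' c sl; apply: Jl; rewrite inE sl orbT.
Qed.

Lemma measurable_drive x l : measurable_fun setT (drive x l).
Proof. by apply: (@noise_measurableW _ _ setT); exact: noise_measurable_drive. Qed.

Variables (A : 'M[R]_N.+1) (init : 'I_N.+1 -> R).
Hypothesis A_ge0 : forall i j, 0 <= A i j.

Local Notation T := (step_op gam F A).

(** Any distinct time indices give the same value, since the increments are
    independent and identically distributed.  Numbered downwards they give the
    chain itself, numbered upwards the backward iteration: both have the law of
    T^k. *)
Lemma path_expectation k (idx : seq nat) x (f : 'cV[R]_n * 'I_N.+1 -> \bar R) :
  uniq idx -> size idx = k ->
  measurable_fun setT f -> (forall z, 0 <= f z)%E ->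
  (\sum_(p <- paths k) (path_weight A init p.1 p.2)%:E *
     \int[P]_w f (drive x (zip p.2 idx) w, p.1) =
   \sum_i (init i)%:E * iter k T f (x, i))%E.
Proof.
move=> + + mf f0; elim: k idx f mf f0 => [|k IH] idx f mf f0.
  case: idx => // _ _ /=; rewrite big_map; apply: eq_bigr => i _ /=.
  by rewrite integral_cst//= probability_setT mule1.
case: idx => [//|o idx] /= /andP[oidx uidx] [sidx].
have mTf : measurable_fun setT (T f) by exact: measurable_step_op.
have Tf0 z : (0 <= T f z)%E by exact: step_op_ge0.
rewrite big_allpairs_dep/= -iterS iterSr -(IH _ _ mTf Tf0 uidx sidx).
rewrite !big_seq; apply: eq_bigr => -[i q] /=; rewrite mem_paths => /eqP sq.
have md := measurable_drive x (zip q idx).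
pose J := [set p : nat * 'I_m | p.1 \in idx].
have nd : noise_measurable J 'cV[R]_n (drive x (zip q idx)).
  apply: noise_measurable_drive => so c sl; rewrite /J/=.
  have := map_f snd sl; rewrite -/(unzip2 _) unzip2_zip ?sq ?sidx//.
have step j : (\int[P]_w f (F i (drive x (zip q idx) w) (Z o w), j) =
    \int[P]_w \int[gam]_u f (F i (drive x (zip q idx) w) u, j))%E.
  have oJ c : ~ J (o, c) by rewrite /J/=; exact/negP.
  have mh := measurable_step_section mF i j mf.
  exact: (integral_fresh_increment nd oJ mh (fun _ => f0 _)).
have mI j : measurable_fun setT
    (fun w => \int[gam]_u f (F i (drive x (zip q idx) w) u, j))%E.
  have h := @measurable_fun_fubini_tonelli_F _ _ _ _ _ gam _ (measurable_step_section mF i j mf).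
  exact: measurableT_comp (h (fun _ => f0 _)) md.
have I0 j w : (0 <= \int[gam]_u f (F i (drive x (zip q idx) w) u, j))%E.
  exact: integral_ge0.
rewrite /step_op/= ge0_integral_sum//; last 2 first.
- by move=> j; exact: emeasurable_funM.
- by move=> j w _; rewrite mule_ge0// lee_fin.
rewrite ge0_sume_distrr; last by move=> j _; apply: integral_ge0 => w _; rewrite mule_ge0// lee_fin.
apply: eq_bigr => j _; rewrite ge0_integralZl//; last by rewrite lee_fin.
by rewrite muleA -EFinM step.
Qed.

End driven_paths.

(** * Transition law of the Euler-Maruyama chain *)

Section em_transition.
Context {R : realType} {d : measure_display} {Omega : measurableType d}.
Variables (P : probability Omega R) (n m N : nat) (W : R -> Omega -> 'cV[R]_m).
Variables (b : 'cV[R]_n -> 'I_N.+1 -> 'cV[R]_n)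
  (sigma : 'cV[R]_n -> 'I_N.+1 -> 'M[R]_(n, m)).
Variables (Pt : R -> 'M[R]_N.+1) (Lam : 'I_N.+1 -> R -> Omega -> 'I_N.+1).
Variable delta : R.
Hypothesis hW : brownian_motion P W.
Hypothesis hLam : forall i, markov_chain P Pt i (Lam i).
Hypothesis hind : forall i, independent_processes P W (Lam i).
Hypothesis delta_gt0 : 0 < delta.
Hypothesis Pt_ge0 : forall i j, 0 <= Pt delta i j.

Definition em_step (i : 'I_N.+1) (y : 'cV[R]_n) (z : 'cV[R]_m) : 'cV[R]_n :=
  y + delta *: b y i + sigma y i *m z.

Hypothesis m_em_step : forall i,
  measurable_fun setT (fun p : 'cV[R]_n * 'cV[R]_m => em_step i p.1 p.2).

Local Notation gam := (step_law hW delta_gt0).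
Local Notation T := (step_op gam em_step (Pt delta)).

(** The regimes at times k delta, ..., 0 in the format of paths: the current one
    and the list of past ones, latest first. *)
Fixpoint regime_path (i : 'I_N.+1) (k : nat) (w : Omega) : 'I_N.+1 * seq 'I_N.+1 :=
  if k is k'.+1 then
    (Lam i (k%:R * delta) w, (regime_path i k' w).1 :: (regime_path i k' w).2)
  else (Lam i 0 w, [::]).

Fixpoint countdown (k : nat) : seq nat := if k is k'.+1 then k' :: countdown k' else [::].

Lemma size_countdown k : size (countdown k) = k.
Proof. by elim: k => //= k ->. Qed.

Lemma countdown_uniq k : uniq (countdown k).
Proof.
elim: k => //= k ->; rewrite andbT; apply/negP.
have le j : forall l, l \in countdown j -> (l < j)%N.
  by elim: j => //= j IH l; rewrite inE => /predU1P[->//|/IH/ltnW].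
by move/le; rewrite ltnn.
Qed.

Lemma regime_path1 i k w : (regime_path i k w).1 = Lam i (k%:R * delta) w.
Proof. by case: k => [|k] //=; rewrite mul0r. Qed.

Lemma size_regime_path i k w : size (regime_path i k w).2 = k.
Proof. by elim: k => //= k ->. Qed.

Lemma EM_drive x i k w : EM b sigma W Lam delta x i k w =
  drive W delta em_step x (zip (regime_path i k w).2 (countdown k)) w.
Proof. by elim: k => //= k ->; rewrite regime_path1. Qed.

(** Paths list the latest regime first, so steps are counted from the end of the
    list. *)
Definition regime_state (p : 'I_N.+1 * seq 'I_N.+1) (a : nat) : 'I_N.+1 :=
  nth ord0 (rev (p.1 :: p.2)) a.

Lemma regime_stateS j i q a : (a <= size q)%N ->
  regime_state (j, i :: q) a = regime_state (i, q) a.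
Proof.
move=> aq; rewrite /regime_state/= [in LHS]rev_cons nth_rcons size_rev/=.
by rewrite ltnS aq.
Qed.

Lemma regime_state_last j q k : size q = k -> regime_state (j, q) k = j.
Proof. by move=> <-; rewrite /regime_state/= rev_cons nth_rcons size_rev ltnn eqxx. Qed.

Lemma regime_path_eq i k j q w : size q = k ->
  regime_path i k w = (j, q) <->
  forall a, (a <= k)%N -> Lam i (a%:R * delta) w = regime_state (j, q) a.
Proof.
elim: k j q => [|k IH] j [|i' q]//= => [_|[sq]].
  split=> [[<-] a|/(_ 0%N)]; last by rewrite mul0r => ->.
  by rewrite leqn0 => /eqP ->; rewrite mul0r.
split=> [[<- i'E qE] a|h].
  have /(IH _ _ sq) h : regime_path i k w = (i', q).
    by rewrite -i'E -qE; case: regime_path.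
  rewrite leq_eqVlt => /predU1P[->|]; last first.
    by rewrite ltnS => ak; rewrite h// regime_stateS// sq.
  by rewrite regime_state_last//= sq.
have h' : regime_path i k w = (i', q).
  by apply/(IH _ _ sq) => a ak; rewrite h ?(leqW ak)// regime_stateS// sq.
by rewrite h'/= h// regime_state_last//= sq.
Qed.

(** The finite-dimensional distributions of the regime chain along the grid,
    rewritten as the weight of a path issued from i. *)
Lemma regime_path_prob i k j q : size q = k ->
  P [set w | regime_path i k w = (j, q)] =
  (path_weight (Pt delta) (fun l => (l == i)%:R) j q)%:E.
Proof.
move=> sq; case: (hLam i) => _ law.
have hm : {homo (fun a : nat => a%:R * delta) : a b / (a <= b)%N >-> a <= b}.
  by move=> a c ac; rewrite ler_wpM2r ?(ltW delta_gt0)// ler_nat.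
have := law k (fun a => a%:R * delta) (regime_state (j, q)) (mul0r _) hm.
have -> : [set w | forall a, (a <= k)%N -> Lam i (a%:R * delta) w = regime_state (j, q) a] =
    [set w | regime_path i k w = (j, q)].
  by apply/seteqP; split=> w /=; [move/(regime_path_eq i j w sq)|move/(regime_path_eq i j w sq)].
move=> ->; congr EFin.
elim: k j q sq {law} => [|k IH] j [|i' q]//= => [_|[sq]].
  by rewrite big_nil mulr1.
rewrite big_nat_recr//= mulrA -(IH i' q sq); congr (_ * _ * _).
- by rewrite regime_stateS.
- rewrite !big_nat; apply: eq_bigr => a /andP[_ ak].
  by rewrite !regime_stateS ?sq// ltnW.
- rewrite (@regime_stateS j i' q k) ?sq// !regime_state_last//= ?sq//.
  by rewrite -mulrBl -natrB// subSnn mul1r.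
Qed.

(** The generators of process_sigma, whose generated sigma-algebra is needed as
    the structure of a measurable space. *)
Definition time_events d' (S : measurableType d') (X : R -> Omega -> S) : set (set Omega) :=
  [set A | exists t B, [/\ 0 <= t, measurable B & A = X t @^-1` B]].

Lemma time_measurable d' (S : measurableType d') (X : R -> Omega -> S) t : 0 <= t ->
  @measurable_fun _ _ (g_sigma_algebraType (time_events X)) S setT (X t).
Proof.
by move=> t0 _ B mB; rewrite setTI; apply: sub_sigma_algebra; exists t, B.
Qed.

Let grid_ge0 k : 0 <= k%:R * delta. Proof. by rewrite mulr_ge0// ltW. Qed.

Lemma regime_path_process_sigma i k p :
  process_sigma (Lam i) [set w | regime_path i k w = p].
Proof.
pose S := g_sigma_algebraType (time_events (Lam i)).
change (measurable ([set w | regime_path i k w = p] : set S)).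
have mL t j : 0 <= t -> measurable ([set w | Lam i t w = j] : set S).
  move=> t0; have := time_measurable (X := Lam i) t0 measurableT (measurable_discrete [set j]).
  by rewrite setTI.
elim: k p => [|k IH] [j q].
  case: q => [|? ?].
    rewrite (_ : [set w | _] = [set w | Lam i 0 w = j]); first exact: mL.
    by apply/seteqP; split=> w /= [->].
  rewrite (_ : [set w | _] = set0); first exact: measurable0.
  by apply/seteqP; split=> w.
case: q => [|i' q].
  rewrite (_ : [set w | _] = set0); first exact: measurable0.
  by apply/seteqP; split=> w.
rewrite (_ : [set w | _] = [set w | Lam i (k.+1%:R * delta) w = j] `&`
    [set w | regime_path i k w = (i', q)]).
  by apply: measurableI; [exact: mL|exact: IH].
apply/seteqP; split=> w /=; last by move=> [-> ->].
by move=> [-> <- <-]; split=> //; case: regime_path.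
Qed.

Lemma drive_process_sigma x l (B : set 'cV[R]_n) : measurable B ->
  process_sigma W (drive W delta em_step x l @^-1` B).
Proof.
move=> mB; pose S := g_sigma_algebraType (time_events W).
have mc k c : measurable_fun setT (fun w : S => W (k%:R * delta) w c 0).
  exact: measurableT_comp (measurable_coord _ _) (time_measurable (X := W) (grid_ge0 k)).
have sub : <<s noise_events (increment_coord W delta) setT >> `<=` process_sigma W.
  apply: smallest_sub; first exact: smallest_sigma_algebra.
  move=> _ [p [C [_ mC ->]]].
  have mp : measurable_fun setT (increment_coord W delta p : S -> R).
    rewrite /increment_coord /increment; under eq_fun do rewrite !mxE.
    exact: measurable_funB.
  by have := mp measurableT C mC; rewrite setTI.
apply: sub.
have := noise_measurable_drive (W := W) (delta := delta) (J := setT) m_em_step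
  x (l := l) (fun _ _ _ => I) measurableT mB.
by rewrite setTI.
Qed.

(** The event concerns the regime process only and the driven value the
    Brownian motion only. *)
Lemma integral_regime_noise i k p x l (g : 'cV[R]_n -> \bar R) :
  measurable_fun setT g -> (forall y, 0 <= g y)%E ->
  (\int[P]_w ((\1_[set w | regime_path i k w = p] w)%:E * g (drive W delta em_step x l w)) =
   P [set w | regime_path i k w = p] * \int[P]_w g (drive W delta em_step x l w))%E.
Proof.
move=> mg g0; set D := [set w | _]; set Y := drive W delta em_step x l.
have mD : measurable D.
  have : process_sigma (Lam i) D by exact: regime_path_process_sigma.
  apply: smallest_sub; first exact: sigma_algebra_measurable.
  move=> _ [t [B [t0 mB ->]]]; rewrite -[X in measurable X]setTI.
  by case: (hLam i) => mL _; exact: mL.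
have mY : measurable_fun setT Y by exact: (measurable_drive hW delta_gt0 m_em_step).
pose Y' : {RV P >-> 'cV[R]_n} := HB.pack Y (isMeasurableFun.Build _ _ _ _ Y mY).
have mI : measurable_fun setT (\1_D : Omega -> R) by exact: measurable_indic.
(* The absolute value, harmless on an indicator, makes h nonnegative on all of
   its domain. *)
pose h (t : R * 'cV[R]_n) : \bar R := (`|t.1|%:E * g t.2)%E.
have mh : measurable_fun setT h.
  apply: emeasurable_funM.
    by apply/measurable_EFinP; exact: measurableT_comp.
  exact: measurableT_comp.
have h0 t : (0 <= h t)%E by rewrite mule_ge0// lee_fin.
transitivity (\int[P]_w h (\1_D w, Y w))%E.
  by apply: eq_integral => w _; rewrite /h/= ger0_norm.
rewrite (integral_indep (gam := distribution P Y') mI mY)//; last first.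
  move=> B C mB mC; rewrite setIC muleC; apply: hind; first exact: drive_process_sigma.
  have mD' : measurable (D : set (g_sigma_algebraType (time_events (Lam i)))).
    exact: regime_path_process_sigma.
  have := @measurable_indic _ (g_sigma_algebraType (time_events (Lam i))) R setT D mD'
    measurableT B mB.
  by rewrite setTI => mDB; exact: mDB.
have Eg : (\int[distribution P Y']_y g y = \int[P]_w g (Y w))%E.
  exact: ge0_integral_distribution.
have Ih w : (\int[distribution P Y']_y h (\1_D w, y) =
    (\1_D w)%:E * \int[P]_w' g (Y w'))%E.
  by rewrite /h/= ge0_integralZl// Eg ger0_norm.
under eq_integral do rewrite Ih muleC.
rewrite ge0_integralZl//.
- by rewrite integral_indic// setIT muleC.
- by apply/measurable_EFinP.
- exact: integral_ge0.
Qed.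

(** Conditioning on the regimes visited before time k decouples the switching
    from the noise, so the chain has the product-form one-step operator. *)
Lemma em_expectation x i k (f : 'cV[R]_n * 'I_N.+1 -> \bar R) :
  measurable_fun setT f -> (forall z, 0 <= f z)%E ->
  (\int[P]_w f (EM b sigma W Lam delta x i k w, Lam i (k%:R * delta) w) =
   iter k T f (x, i))%E.
Proof.
move=> mf f0; pose Y q := drive W delta em_step x (zip q (countdown k)).
pose D p := [set w | regime_path i k w = p].
have mD p : measurable (D p).
  have : process_sigma (Lam i) (D p) by exact: regime_path_process_sigma.
  apply: smallest_sub; first exact: sigma_algebra_measurable.
  move=> _ [t [B [t0 mB ->]]]; rewrite -[X in measurable X]setTI.
  by case: (hLam i) => mL _; exact: mL.
have mfj j : measurable_fun setT (fun y => f (y, j)).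
  exact: measurableT_comp mf (measurable_pair2 j).
transitivity (\int[P]_w \sum_(p <- paths k) ((\1_(D p) w)%:E * f (Y p.2 w, p.1)))%E.
  apply: eq_integral => w _.
  rewrite (bigD1_seq (regime_path i k w)) ?paths_uniq//=; last first.
    by case E : (regime_path i k w) => [j q]; rewrite mem_paths -(size_regime_path i k w) E.
  rewrite indicE mem_set//= mul1e big1 ?adde0; last first.
    move=> p pw; rewrite indicE memNset ?mul0e// => pE.
    by rewrite /D/= in pE; rewrite pE eqxx in pw.
  by rewrite EM_drive regime_path1.
rewrite ge0_integral_sum//; last 2 first.
- move=> p; apply: emeasurable_funM.
    by apply/measurable_EFinP; exact: measurable_indic.
  exact: measurableT_comp (mfj p.1) (measurable_drive hW delta_gt0 m_em_step x _).
- by move=> p w _; rewrite mule_ge0// lee_fin.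
transitivity (\sum_(p <- paths k)
    (path_weight (Pt delta) (fun l => (l == i)%:R) p.1 p.2)%:E *
    \int[P]_w f (Y p.2 w, p.1))%E.
  rewrite !big_seq; apply: eq_bigr => -[j q]; rewrite mem_paths => /eqP sq /=.
  rewrite (integral_regime_noise i k (j, q) x (zip q (countdown k)) (mfj j))//.
  by rewrite regime_path_prob.
rewrite (path_expectation hW delta_gt0 m_em_step (fun l => (l == i)%:R) Pt_ge0 x
  (countdown_uniq k) (size_countdown k))//.
rewrite (bigD1 i)//= eqxx mul1e big1 ?adde0// => j ji.
by rewrite (negbTE ji) mul0e.
Qed.

End em_transition.

(** * Random words read off a uniform variable *)

Section interval_words.
Context {R : realType} {N : nat}.
(* V r is the prescribed probability of the word r; a word is extended at its
   head, and V_cons is the consistency of the probabilities. *)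
Variable V : seq 'I_N.+1 -> R.
Hypothesis V_ge0 : forall r, 0 <= V r.
Hypothesis V_nil : V [::] = 1.
Hypothesis V_cons : forall r, V r = \sum_j V (j :: r).

Fixpoint left_end (r : seq 'I_N.+1) : R :=
  if r is j :: r' then left_end r' + \sum_(i < N.+1 | (i < j)%N) V (i :: r') else 0.

(** Intervals of length V r; those of the one-letter extensions of r partition
    the interval of r in the order of the letters. *)
Definition word_itv (r : seq 'I_N.+1) : set R :=
  [set u | left_end r <= u < left_end r + V r].

(** The word of length k whose interval contains u; outside [0, 1) the letter
    ord0 is a default. *)
Fixpoint word (k : nat) (u : R) : seq 'I_N.+1 :=
  if k is k'.+1 then
    odflt ord0 [pick j | left_end (j :: word k' u) <= u <
                         left_end (j :: word k' u) + V (j :: word k' u)] :: word k' u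
  else [::].

Lemma size_word k u : size (word k u) = k.
Proof. by elim: k => //= k ->. Qed.

(* The left end of the t-th subinterval of r, with t allowed to be N.+1. *)
Let cut r (t : nat) : R := left_end r + \sum_(i < N.+1 | (i < t)%N) V (i :: r).

Let cutS r (j : 'I_N.+1) : cut r j.+1 = cut r j + V (j :: r).
Proof.
rewrite /cut -addrA; congr (_ + _); rewrite (bigD1 j)//= addrC; congr (_ + _).
by apply: eq_bigl => i; rewrite ltnS [RHS]ltn_neqAle -val_eqE andbC.
Qed.

Let cut_le r s t : (s <= t)%N -> cut r s <= cut r t.
Proof.
move=> st; rewrite lerD2l [leRHS](bigID (fun i : 'I_N.+1 => (i < s)%N))/=.
have -> : \sum_(i < N.+1 | (i < t)%N && (i < s)%N) V (i :: r) =
    \sum_(i < N.+1 | (i < s)%N) V (i :: r).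
  apply: eq_bigl => i.
  by case: (ltnP i s) => is_; rewrite ?andbF// (leq_trans is_ st).
by rewrite lerDl sumr_ge0.
Qed.

Let cutT r : cut r N.+1 = left_end r + V r.
Proof. by rewrite /cut (V_cons r); congr (_ + _); apply: eq_bigl => i; rewrite ltn_ord. Qed.

Let cut0 r : cut r 0 = left_end r.
Proof. by rewrite /cut big1 ?addr0. Qed.

Lemma word_itv_cons r u : word_itv r u <-> exists j, word_itv (j :: r) u.
Proof.
split=> [/andP[ru ur]|[j /= /andP[ju uj]]].
  have ex : exists t, u < cut r t.+1 by exists N; rewrite cutT.
  case: (ex_minnP ex) => t ut tmin.
  have tN : (t < N.+1)%N by rewrite ltnS; apply: tmin; rewrite cutT.
  exists (Ordinal tN); rewrite /word_itv /= -/(cut r t).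
  rewrite -[X in _ < X](cutS r (Ordinal tN)) ut andbT.
  case: t ut tmin {tN} => [|t] ut tmin; first by rewrite cut0.
  by rewrite leNgt; apply/negP => /tmin; rewrite ltnn.
rewrite /word_itv /=; apply/andP; split.
  by apply: le_trans ju; rewrite -cut0 /= -/(cut r j) cut_le.
apply: (lt_le_trans uj); rewrite /= -/(cut r j) -cutS -cutT; apply: cut_le.
exact: ltn_ord.
Qed.

Lemma word_itv_cons_inj r u j j' : word_itv (j :: r) u -> word_itv (j' :: r) u -> j = j'.
Proof.
wlog jj : j j' / (j < j')%N => [th uj uj'|/andP[_ uj] /andP[ju _]].
  case: (ltngtP j j') => [jj|jj|/val_inj//]; first exact: th.
  exact/esym/th.
move: uj ju; rewrite /= -!/(cut r _) -cutS => uj ju.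
have := lt_le_trans uj (le_trans (cut_le r jj) ju).
by rewrite ltxx.
Qed.

Lemma word_itv_nil u : word_itv [::] u <-> 0 <= u < 1.
Proof. by rewrite /word_itv /= V_nil add0r. Qed.

Lemma word_itv_word k u : 0 <= u < 1 -> word_itv (word k u) u.
Proof.
move=> u01; elim: k => [|k IH] /=; first exact/word_itv_nil.
case: pickP => [j //|no]; have [j uj] := (word_itv_cons _ _).1 IH.
by have := no j; rewrite /word_itv/= in uj; rewrite uj.
Qed.

Lemma word_eq k r u : size r = k -> 0 <= u < 1 -> word k u = r <-> word_itv r u.
Proof.
move=> sr u01; split=> [<-|]; first exact: word_itv_word.
elim: k r sr => [|k IH] [|j r]//= [sr] ru.
have ru' : word_itv r u by apply/word_itv_cons; exists j.
have wr := IH r sr ru'; have := word_itv_word k.+1 u01 => /= h.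
rewrite wr in h *; congr (_ :: _); exact: word_itv_cons_inj h ru.
Qed.

Lemma word_out k u : ~ (0 <= u < 1) -> word k u = nseq k ord0.
Proof.
move=> u01; elim: k => //= k ->; congr (_ :: _); case: pickP => // j uj.
exfalso; apply: u01; apply/word_itv_nil.
have /(word_itv_cons _ _).2 : exists j, word_itv (j :: nseq k ord0) u by exists j.
by elim: k {j uj} => [//|k IH] h; apply: IH; apply/word_itv_cons; exists ord0.
Qed.

Lemma word_itvE r : word_itv r = `[left_end r, left_end r + V r[%classic.
Proof. by apply/seteqP; split=> u /=; rewrite in_itv. Qed.

Lemma word_itv_sub r u : word_itv r u -> 0 <= u < 1.
Proof.
elim: r => [/word_itv_nil//|j r IH] h; apply: IH; apply/word_itv_cons.
by exists j.
Qed.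

(** For u outside [0, 1) the word is constantly ord0, whence the second term. *)
Lemma word_set k r : size r = k -> [set u | word k u = r] =
  word_itv r `|` (if r == nseq k ord0 then ~` word_itv [::] else set0).
Proof.
move=> sr; apply/seteqP; split=> u /=.
  move=> wr; have [u01|u01] := pselect (0 <= u < 1).
    by left; exact/(word_eq sr u01).
  right; move: (word_out k u01); rewrite wr => ->; rewrite eqxx => /word_itv_nil.
  exact: u01.
case=> [ru|]; first exact/(word_eq sr (word_itv_sub ru)).
case: eqP => // -> h; apply: word_out => u01; apply: h; exact/word_itv_nil.
Qed.

Lemma measurable_word k r : measurable [set u : measurableTypeR R | word k u = r].
Proof.
have [sr|sr] := eqVneq (size r) k.
  rewrite word_set// !word_itvE; apply: measurableU; first exact: measurable_itv.
  by case: ifP => _ //; apply: measurableC; exact: measurable_itv.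
rewrite (_ : [set u | _] = set0)//; apply/seteqP; split=> // u /= wr.
by move: sr; rewrite -wr size_word eqxx.
Qed.

Definition unit_uniform : probability (measurableTypeR R) R := uniform_prob (@ltr01 R).

Lemma word_prob k r : size r = k ->
  unit_uniform [set u | word k u = r] = (V r)%:E.
Proof.
move=> sr.
have uE (A : set (measurableTypeR R)) : measurable A ->
    unit_uniform A = lebesgue_measure (A `&` `[0, 1]%classic).
  move=> mA; rewrite /unit_uniform/= /uniform_prob integral_uniform_pdf.
  rewrite (eq_integral (cst 1%E)).
    by rewrite integral_cst//= ?mul1e//; exact: measurableI.
  move=> x; rewrite inE => -[_ /=]; rewrite in_itv/= /uniform_pdf => ->.
  by rewrite subr0 invr1.
rewrite uE; last exact: measurable_word.
transitivity (lebesgue_measure (word_itv r)); last first.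
  rewrite word_itvE lebesgue_measure_itv/= lte_fin -EFinB addrAC subrr add0r.
  case: ltP => // h; congr EFin; apply/eqP; rewrite eq_le V_ge0/=.
  by move: h; rewrite gerDl.
have mI : measurable (word_itv r : set (measurableTypeR R)).
  by rewrite word_itvE; exact: measurable_itv.
have mX : measurable ([set u : measurableTypeR R | word k u = r] `&` `[0, 1]%classic).
  by apply: measurableI; [exact: measurable_word|exact: measurable_itv].
apply/eqP; rewrite eq_le; apply/andP; split.
  apply: (@le_trans _ _ (lebesgue_measure (word_itv r `|` [set (1 : R)]))).
    apply: le_measure; rewrite ?inE//; first exact: measurableU.
    move=> u [/= wr]; rewrite in_itv/= => /andP[u0]; rewrite le_eqVlt.
    case/predU1P => [->|u1]; [by right|left].
    by apply/(word_eq sr) => //; rewrite u0.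
  apply: (le_trans (measureU2 _ _ _)) => //.
  by rewrite [X in (_ + X)%E](_ : _ = 0%E) ?adde0//; exact: lebesgue_measure_set1.
apply: le_measure; rewrite ?inE// => u ru; have u01 := word_itv_sub ru.
split; first exact/(word_eq sr u01).
by rewrite /= in_itv/=; move/andP: u01 => [-> /ltW ->].
Qed.

End interval_words.

Arguments word {R N} V k u : simpl never.

(** * Mean-square gaps of the backward iteration *)

Lemma iota0S k : iota 0 k.+1 = rcons (iota 0 k) k.
Proof. by rewrite -[k.+1]addn1 iotaD cats1. Qed.

Section path_gap.
Context {R : realType} {d : measure_display} {Omega : measurableType d}.
Variables (P : probability Omega R) (n m N : nat) (W : R -> Omega -> 'cV[R]_m).
Variable delta : R.
Hypothesis hW : brownian_motion P W.
Hypothesis delta_gt0 : 0 < delta.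
Variable F : 'I_N.+1 -> 'cV[R]_n -> 'cV[R]_m -> 'cV[R]_n.
Hypothesis mF : forall i, measurable_fun setT (fun p : 'cV[R]_n * 'cV[R]_m => F i p.1 p.2).
Local Notation Z := (increment W delta).
Local Notation gam := (step_law hW delta_gt0).
Local Notation noise_measurable J T Y :=
  (@measurable_fun _ _ (g_sigma_algebraType (noise_events (increment_coord W delta) J)) T setT Y).
Variable lam : 'I_N.+1 -> R.
Hypothesis lam_ge0 : forall i, 0 <= lam i.
Hypothesis F_contract : forall i x y,
  (\int[gam]_u (hsnorm (F i x u - F i y u) ^+ 2)%:E <=
     (lam i * hsnorm (x - y) ^+ 2)%:E)%E.
Variable C : R.
Hypothesis F_moment : forall i, (\int[gam]_u (hsnorm (F i 0 u) ^+ 2)%:E <= C%:E)%E.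
Local Notation drv := (drive W delta F 0).

Let mgap J (l l' : seq ('I_N.+1 * nat)) :
  (forall so c, so \in l -> J (so.2, c)) -> (forall so c, so \in l' -> J (so.2, c)) ->
  noise_measurable J ('cV[R]_n * 'cV[R]_n)%type (fun w => (drv l w, drv l' w)).
Proof.
by move=> lJ l'J; apply: measurable_fun_pair; exact: noise_measurable_drive.
Qed.

Lemma measurable_fun_gap i : measurable_fun setT
  (fun t : ('cV[R]_n * 'cV[R]_n) * 'cV[R]_m => (hsnorm (F i t.1.1 t.2 - F i t.1.2 t.2) ^+ 2)%:E).
Proof.
have m1 : measurable_fun setT (fun t : ('cV[R]_n * 'cV[R]_n) * 'cV[R]_m => F i t.1.1 t.2).
  have m11 := measurableT_comp (@measurable_fst _ _ 'cV[R]_n 'cV[R]_n)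
    (@measurable_fst _ _ ('cV[R]_n * 'cV[R]_n)%type 'cV[R]_m).
  exact: measurableT_comp (mF i) (measurable_fun_pair m11 measurable_snd).
have m2 : measurable_fun setT (fun t : ('cV[R]_n * 'cV[R]_n) * 'cV[R]_m => F i t.1.2 t.2).
  have m12 := measurableT_comp (@measurable_snd _ _ 'cV[R]_n 'cV[R]_n)
    (@measurable_fst _ _ ('cV[R]_n * 'cV[R]_n)%type 'cV[R]_m).
  exact: measurableT_comp (mF i) (measurable_fun_pair m12 measurable_snd).
exact: measurable_hsnorm_sqrB m1 m2.
Qed.

(** Prolonging the backward composition by one more past step moves its value
    by an amount contracted along the whole path. *)
Lemma drive_gap l so : uniq (unzip2 (rcons l so)) ->
  (\int[P]_w (hsnorm (drv (rcons l so) w - drv l w) ^+ 2)%:E <=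
   (C * \prod_(x <- l) lam x.1)%:E)%E.
Proof.
elim: l => [|x l IH] /=.
  rewrite big_nil mulr1 => _.
  have mh : measurable_fun setT (fun u => (hsnorm (F so.1 0 u) ^+ 2)%:E).
    apply/measurable_EFinP; apply: (measurableT_comp (@measurable_hsnorm_sqr R n 1)).
    exact: measurableT_comp (mF so.1) (measurable_pair1 (0 : 'cV[R]_n)).
  apply: le_trans (F_moment so.1).
  rewrite (integral_step_law hW delta_gt0 so.2 mh); last by move=> z; rewrite lee_fin sqr_ge0.
  by under eq_integral do rewrite subr0.
rewrite big_cons => /andP[xl ul].
pose h (t : ('cV[R]_n * 'cV[R]_n) * 'cV[R]_m) : \bar R :=
  (hsnorm (F x.1 t.1.1 t.2 - F x.1 t.1.2 t.2) ^+ 2)%:E.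
have mh : measurable_fun setT h by exact: measurable_fun_gap.
have h0 t : (0 <= h t)%E by rewrite lee_fin sqr_ge0.
pose J := [set p : nat * 'I_m | p.1 \in unzip2 (rcons l so)].
pose Y w := (drv (rcons l so) w, drv l w).
have mY : noise_measurable J _ Y.
  apply: mgap => y c yl; rewrite /J/=; first exact: map_f.
  by rewrite /unzip2 map_rcons mem_rcons inE map_f ?orbT.
have oJ c : ~ J (x.2, c) by rewrite /J/=; exact/negP.
have := integral_fresh_increment hW delta_gt0 mY oJ mh h0.
rewrite /h/= => ->.
have mYT : measurable_fun setT Y by exact: (noise_measurableW hW delta_gt0 mY).
have mgap2 : measurable_fun setT (fun w => (hsnorm (drv (rcons l so) w - drv l w) ^+ 2)%:E).
  by apply: measurable_hsnorm_sqrB; exact: (measurable_drive hW delta_gt0 mF).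
apply: (@le_trans _ _ (\int[P]_w ((lam x.1)%:E *
    (hsnorm (drv (rcons l so) w - drv l w) ^+ 2)%:E))%E).
  apply: ge0_le_integral => //.
  - by move=> w _; apply: integral_ge0 => u _; rewrite lee_fin sqr_ge0.
  - have mFF := @measurable_fun_fubini_tonelli_F _ _ _ _ _ gam h mh h0.
    exact: measurableT_comp mFF mYT.
  - exact: emeasurable_funM.
have g0 w : setT w -> (0 <= (hsnorm (drv (rcons l so) w - drv l w) ^+ 2)%:E)%E.
  by rewrite lee_fin sqr_ge0.
have l0 : (0 <= (lam x.1)%:E)%E by rewrite lee_fin.
rewrite (ge0_integralZl P measurableT mgap2 g0 l0).
rewrite mulrCA EFinM; apply: lee_wpmul2l; first by rewrite lee_fin.
exact: IH.
Qed.

Variables (A : 'M[R]_N.+1) (init : 'I_N.+1 -> R) (xi : 'cV[R]_N.+1) (rho : R).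
Hypothesis A_ge0 : forall i j, 0 <= A i j.
Hypothesis init_ge0 : forall i, 0 <= init i.
Hypothesis xi_gt0 : forall i, 0 < xi i 0.
Hypothesis rho_ge0 : 0 <= rho.
Hypothesis lam_xi : forall i, lam i * (A *m xi) i 0 <= rho * xi i 0.
Hypothesis C_ge0 : 0 <= C.

(** Summing out the latest regime with xi as terminal weight yields (A xi)_i,
    which together with the factor lam_i is at most rho xi_i. *)
Lemma path_contraction_sum k :
  \sum_(p <- paths k.+1) path_weight A init p.1 p.2 *
    (\prod_(i <- take k p.2) lam i) * xi p.1 0 <=
  rho ^+ k * \sum_(p <- paths 1) path_weight A init p.1 p.2 * xi p.1 0.
Proof.
elim: k => [|k IH].
  rewrite mul1r le_eqVlt; apply/orP; left; apply/eqP; apply: eq_bigr => p _.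
  by rewrite take0 big_nil mulr1.
apply: (@le_trans _ _ (rho * \sum_(p <- paths k.+1) path_weight A init p.1 p.2 *
    (\prod_(i <- take k p.2) lam i) * xi p.1 0)); last first.
  by rewrite exprS -mulrA ler_wpM2l.
rewrite [in leLHS]/paths -/paths big_allpairs_dep/= mulr_sumr; apply: ler_sum => -[i q] _ /=.
have w0 : 0 <= path_weight A init i q * \prod_(a <- take k q) lam a.
  by rewrite mulr_ge0 ?path_weight_ge0// prodr_ge0.
rewrite mulrCA; apply: le_trans (ler_wpM2l w0 (lam_xi i)).
rewrite le_eqVlt; apply/orP; left; apply/eqP.
rewrite mxE !mulr_sumr; apply: eq_bigr => j _; rewrite big_cons; ring.
Qed.

(** The gap along a given path is contracted by the product of its lam_i
    (drive_gap); averaging the product over paths gives the rate rho once xi is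
    inserted as terminal weight, at the price of a constant. *)
Lemma gap_sum_bound : exists2 M, 0 <= M & forall k,
  (\sum_(p <- paths k.+1) (path_weight A init p.1 p.2)%:E *
     \int[P]_w (hsnorm (drv (zip p.2 (iota 0 k.+1)) w -
                        drv (zip (take k p.2) (iota 0 k)) w) ^+ 2)%:E <=
   (M * rho ^+ k)%:E)%E.
Proof.
pose S := \sum_j (xi j 0)^-1.
have S1 j : 1 <= S * xi j 0.
  rewrite -ler_pdivrMr// div1r /S (bigD1 j)//= lerDl sumr_ge0// => i _.
  by rewrite invr_ge0 ltW.
have S0 : 0 <= S by apply: sumr_ge0 => i _; rewrite invr_ge0 ltW.
pose B := \sum_(p <- paths 1) path_weight A init p.1 p.2 * xi p.1 0.
have B0 : 0 <= B by apply: sumr_ge0 => p _; rewrite mulr_ge0 ?path_weight_ge0// ltW.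
exists (C * S * B) => [|k]; first by rewrite !mulr_ge0.
apply: (@le_trans _ _ (\sum_(p <- paths k.+1) (path_weight A init p.1 p.2 *
    (C * \prod_(i <- take k p.2) lam i))%:E)%E).
  rewrite !big_seq; apply: lee_sum => p; rewrite {1}[p]surjective_pairing mem_paths => /eqP.
  rewrite EFinM => sq; apply: lee_wpmul2l; first by rewrite lee_fin path_weight_ge0.
  case/lastP: p.2 sq => [//|q s]; rewrite size_rcons => -[sq].
  have tq : take k (rcons q s) = q by rewrite -cats1 take_cat sq ltnn subnn take0 cats0.
  have zq : zip (rcons q s) (iota 0 k.+1) = rcons (zip q (iota 0 k)) (s, k).
    by rewrite iota0S zip_rcons ?size_iota.
  rewrite tq zq; apply: le_trans (drive_gap _) _.
    by rewrite -zq unzip2_zip ?iota_uniq// size_iota size_rcons sq.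
  rewrite lee_fin ler_wpM2l// le_eqVlt; apply/orP; left; apply/eqP.
  by rewrite -(big_map fst xpredT lam) -/(unzip1 _) unzip1_zip// size_iota sq.
rewrite sumEFin lee_fin.
apply: (@le_trans _ _ (C * S * \sum_(p <- paths k.+1) path_weight A init p.1 p.2 *
    (\prod_(i <- take k p.2) lam i) * xi p.1 0)).
  rewrite mulr_sumr; apply: ler_sum => p _.
  have w0 : 0 <= C * (path_weight A init p.1 p.2 * \prod_(a <- take k p.2) lam a).
    by rewrite !mulr_ge0 ?path_weight_ge0// prodr_ge0.
  have := ler_wpM2l w0 (S1 p.1); rewrite mulr1.
  by rewrite mulrCA => /le_trans; apply; rewrite le_eqVlt; apply/orP; left; apply/eqP; ring.
rewrite (_ : C * S * B * rho ^+ k = C * S * (rho ^+ k * B)); last by ring.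
by rewrite ler_wpM2l ?mulr_ge0// path_contraction_sum.
Qed.

End path_gap.

(** * Almost sure convergence from geometric gaps *)

Section geometric_gaps.
Context {R : realType}.

Lemma geometric_gap_cvg (x : R ^nat) (M r : R) : 0 <= r -> r < 1 -> 
  (forall k, (x k.+1 - x k) ^+ 2 <= M * r ^+ k) -> cvgn x.
Proof.
move=> r0 r1 gap.
have M0 : 0 <= M by have := le_trans (sqr_ge0 _) (gap 0%N); rewrite expr0 mulr1.
have rs0 : 0 <= Num.sqrt r by exact: sqrtr_ge0.
have rs1 : Num.sqrt r < 1 by rewrite -sqrtr1 ltr_sqrt.
have : cvgn (series (telescope x)).
  apply: (@normed_cvg _ (R^o : completeNormedModType R)).
  apply: (@series_le_cvg R (fun k => `|telescope x k|)
    (geometric (Num.sqrt M) (Num.sqrt r))) => [k|k|k|].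
  - by rewrite normr_ge0.
  - by rewrite /= mulr_ge0 ?sqrtr_ge0// exprn_ge0.
  - rewrite /= -(ler_pXn2r (_ : 0 < 2)%N) ?nnegrE// ?mulr_ge0 ?sqrtr_ge0 ?exprn_ge0//.
    rewrite real_normK ?num_real// exprMn sqr_sqrtr// -exprM mulnC exprM sqr_sqrtr//.
    exact: gap.
  - by apply: is_cvg_geometric_series; rewrite ger0_norm.
move=> /cvg_ex[l xl]; apply/cvg_ex; exists (x 0%N + l).
have h : (fun n => x 0%N + series (telescope x) n) @ \oo --> x 0%N + l.
  by apply: cvgD => //; exact: cvg_cst.
have E : (fun n => x 0%N + series (telescope x) n) = x.
  by apply/funext => n; exact/esym/eq_sum_telescope.
by rewrite E in h.
Qed.

Lemma nneseries_geometric_le (a z : R) : 0 <= a -> 0 <= z -> z < 1 ->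
  (\sum_(0 <= k <oo) (a * z ^+ k)%:E <= (a / (1 - z))%:E)%E.
Proof.
move=> a0 z0 z1; apply: lime_le.
  by apply: is_cvg_nneseries => k _ _; rewrite lee_fin mulr_ge0// exprn_ge0.
near=> n; rewrite sumEFin lee_fin.
have z_neq1 : z != 1 by rewrite lt_eqF.
have -> : \sum_(0 <= k < n) a * z ^+ k = series (geometric a z) n by [].
rewrite geometric_seriesE//= ler_wpM2r//; first by rewrite invr_ge0 subr_ge0 ltW.
by rewrite ler_piMr// gerBl exprn_ge0.
Unshelve. all: by end_near. Qed.

Context d (T : measurableType d) (P : probability T R) (n : nat).

(** Squared increments that are summable against a geometric weight in mean
    are almost surely summable, so the sequence converges almost surely. *)
Lemma ae_cvg_geometric_gaps (Y : nat -> T -> 'cV[R]_n) (M rho : R) :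
  0 <= M -> 0 <= rho -> rho < 1 -> (forall k, measurable_fun setT (Y k)) ->
  (forall k, \int[P]_t (hsnorm (Y k.+1 t - Y k t) ^+ 2)%:E <= (M * rho ^+ k)%:E)%E ->
  exists2 Yoo : T -> 'cV[R]_n, measurable_fun setT Yoo &
    {ae P, forall t, forall c, Y k t c 0 @[k --> \oo] --> Yoo t c 0}.
Proof.
move=> M0 rho0 rho1 mY gap.
(* Any r strictly between rho and 1 leaves a summable series (rho / r)^k. *)
pose r := (1 + rho) / 2.
have r0 : 0 < r by rewrite /r; lra.
have r1 : r < 1 by rewrite /r; lra.
have rhor : rho < r by rewrite /r; lra.
pose g k t : \bar R := ((r ^+ k)^-1%:E * (hsnorm (Y k.+1 t - Y k t) ^+ 2)%:E)%E.
have mgap k : measurable_fun setT (fun t => (hsnorm (Y k.+1 t - Y k t) ^+ 2)%:E).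
  exact: measurable_hsnorm_sqrB.
have rk0 k : 0 <= (r ^+ k)^-1 by rewrite invr_ge0 exprn_ge0// ltW.
have g0 k t : (0 <= g k t)%E by rewrite mule_ge0// lee_fin ?sqr_ge0.
have mg k : measurable_fun setT (g k) by exact: emeasurable_funM.
pose S t := (\sum_(0 <= k <oo) g k t)%E.
have mS : measurable_fun setT S by exact: ge0_emeasurable_sum.
have S0 t : (0 <= S t)%E by exact: nneseries_ge0.
have intS : (\int[P]_t S t < +oo)%E.
  rewrite integral_nneseries//.
  apply: (@le_lt_trans _ _ (\sum_(0 <= k <oo) (M * (rho / r) ^+ k)%:E)%E).
    apply: lee_nneseries => [k *|k *]; first by apply: integral_ge0 => t _; exact: g0.
    rewrite ge0_integralZl//; try by [move=> t _; rewrite lee_fin sqr_ge0|rewrite lee_fin].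
    apply: le_trans (lee_wpmul2l _ (gap k)) _; first by rewrite lee_fin.
    by rewrite -EFinM lee_fin [in leRHS]exprMn exprVn le_eqVlt; apply/orP; left; apply/eqP; ring.
  apply: le_lt_trans (nneseries_geometric_le _ _ _) (ltry _) => //.
    by rewrite divr_ge0// ltW.
  by rewrite ltr_pdivrMr// mul1r.
pose D := [set t | (S t < +oo)%E].
have mD : measurable D.
  by rewrite -[X in measurable X]setTI; exact: emeasurable_fun_lt.
have aeD : {ae P, forall t, D t}.
  have /integrable_ae : P.-integrable setT S.
    apply/integrableP; split=> //; under eq_integral do rewrite gee0_abs//; exact: intS.
  move=> /(_ measurableT); apply: filterS => t /(_ I).
  by rewrite ge0_fin_numE.
have cvD t c : D t -> cvgn (fun k => Y k t c 0).
  move=> Dt; apply: (@geometric_gap_cvg _ (fine (S t)) r (ltW r0) r1) => k.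
  have : (g k t <= S t)%E.
    apply: le_trans (nneseries_lim_ge k.+1 (fun k _ _ => g0 k t)).
    by rewrite big_nat_recr//= leeDr// sume_ge0.
  rewrite -(fineK (_ : S t \is a fin_num)); last by rewrite ge0_fin_numE.
  rewrite /g -EFinM lee_fin mulrC ler_pdivrMr ?exprn_gt0//; apply: le_trans.
  have := coord_le_hsnorm (Y k.+1 t - Y k t) c 0; rewrite !mxE => h.
  by rewrite -real_normK ?num_real// ler_pXn2r// ?nnegrE// hsnorm_ge0.
(* Multiplying by the indicator of the convergence set makes the limit exist
   everywhere, hence measurable. *)
pose Yoo t : 'cV[R]_n := \col_c limn (fun k => \1_D t * Y k t c 0).
have cvT t c : cvgn (fun k => \1_D t * Y k t c 0).
  have [Dt|Dt] := pselect (D t).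
    by rewrite indicE mem_set//; under eq_fun do rewrite mul1r; exact: cvD.
  rewrite indicE memNset//; under eq_fun do rewrite mul0r; exact: is_cvg_cst.
exists Yoo.
  apply: measurable_fun_mx => c j; rewrite ord1.
  apply: (@measurable_fun_cvg _ _ _ setT (fun k t => \1_D t * Y k t c 0)) => [k|t _].
    apply: measurable_funM; first exact: measurable_indic.
    exact: measurableT_comp (measurable_coord _ _) (mY k).
  by rewrite mxE; exact: cvT.
apply: filterS aeD => t Dt c; rewrite mxE indicE mem_set//.
under [X in limn X]eq_fun do rewrite mul1r.
exact: cvD.
Qed.

End geometric_gaps.

(** * The backward limit under a stationary path of regimes *)

Section stationary_words.
Context {R : realType} {N : nat}.
Variables (A : 'M[R]_N.+1) (mu : 'I_N.+1 -> R).
Hypothesis A_ge0 : forall i j, 0 <= A i j.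
Hypothesis mu_ge0 : forall i, 0 <= mu i.
Hypothesis mu_sum1 : \sum_i mu i = 1.
Hypothesis mu_stat : forall j, \sum_i mu i * A i j = mu j.

(** A backward word [:: s_k; ...; s_0] has its oldest regime at the head, where
    words are extended, and the present regime s_0 last.  Its weight follows the
    original direction of time for a path weighted with initial law mu:
    path_weight reads s_0 as the end of the path s_k, ..., s_0. *)
Definition word_weight (r : seq 'I_N.+1) : R :=
  if rev r is j :: q then path_weight A mu j q else 1.

Lemma word_weight_ge0 r : 0 <= word_weight r.
Proof. by rewrite /word_weight; case: rev => // j q; exact: path_weight_ge0. Qed.

Lemma word_weight_nil : word_weight [::] = 1.
Proof. by []. Qed.

(** Stationarity makes the weights consistent: summing over the oldest regime
    replaces it by the next one. *)
Lemma word_weight_cons r : word_weight r = \sum_j word_weight (j :: r).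
Proof.
rewrite /word_weight; under eq_bigr do rewrite rev_cons.
case: (rev r) => [|i q] /=; first by rewrite mu_sum1.
elim: q i => [|a q IH] i /=; first by rewrite mu_stat.
by rewrite (IH a) mulr_suml.
Qed.

Lemma word_weight_rev j q : word_weight (rev (j :: q)) = path_weight A mu j q.
Proof. by rewrite /word_weight revK. Qed.

Context {d : measure_display} {Omega : measurableType d} (P : probability Omega R).
Local Notation U := (measurableTypeR R).
Local Notation wd := (word word_weight).
(** The Brownian motion together with an independent uniform variable, from
    which the regimes are read. *)
Definition backward_space : probability (Omega * U)%type R :=
  (P \x @unit_uniform R)%E.

(** There are countably many words. *)
Lemma measurable_word_fun d' (S : measurableType d') (G : seq 'I_N.+1 -> Omega -> S) k :
  (forall r, measurable_fun setT (G r)) ->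
  measurable_fun setT (fun t : Omega * U => G (wd k t.2) t.1).
Proof.
move=> mG _ B mB; rewrite setTI.
have -> : (fun t : Omega * U => G (wd k t.2) t.1) @^-1` B =
    \bigcup_(r in [set: seq 'I_N.+1]) ((G r @^-1` B) `*` [set u : U | wd k u = r]).
  apply/seteqP; split=> [[w u] /= h|[w u] [r _ [/= h ->]]//].
  by exists (wd k u).
apply: countable_bigcupT_measurable => // r; apply: measurableX.
  by rewrite -[X in measurable X]setTI; exact: mG.
exact: (measurable_word word_weight_ge0 word_weight_nil word_weight_cons).
Qed.

Lemma integral_word_fun (g : seq 'I_N.+1 -> Omega -> \bar R) k :
  (forall r, measurable_fun setT (g r)) -> (forall r w, 0 <= g r w)%E ->
  (\int[backward_space]_t g (wd k.+1 t.2) t.1 =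
   \sum_(p <- paths k) (path_weight A mu p.1 p.2)%:E *
     \int[P]_w g (rev (p.1 :: p.2)) w)%E.
Proof.
move=> mg g0; rewrite /backward_space fubini_tonelli2//; last exact: measurable_word_fun.
rewrite /fubini_G/=.
pose c (p : 'I_N.+1 * seq 'I_N.+1) := (\int[P]_w g (rev (p.1 :: p.2)) w)%E.
pose D (p : 'I_N.+1 * seq 'I_N.+1) := [set u : U | wd k.+1 u = rev (p.1 :: p.2)].
have mD p : measurable (D p).
  exact: (measurable_word word_weight_ge0 word_weight_nil word_weight_cons).
have c0 p : (0 <= c p)%E by apply: integral_ge0 => w _; exact: g0.
transitivity (\int[@unit_uniform R]_u \sum_(p <- paths k) (c p * (\1_(D p) u)%:E))%E.
  apply: eq_integral => u _.
  have : size (rev (wd k.+1 u)) = k.+1 by rewrite size_rev size_word.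
  case E : (rev (wd k.+1 u)) => [//|j q] [sq].
  have wE : wd k.+1 u = rev (j :: q) by rewrite -E revK.
  rewrite (bigD1_seq (j, q)) ?paths_uniq ?mem_paths ?sq//=.
  rewrite indicE mem_set//= mule1 big1 ?adde0 ?wE// => -[j' q'] pw.
  rewrite indicE memNset ?mule0// => pE.
  have /(can_inj revK)[jj qq] : rev (j' :: q') = rev (j :: q) by rewrite -wE -pE.
  by rewrite jj qq eqxx in pw.
rewrite ge0_integral_sum//; last 2 first.
- by move=> p; apply: emeasurable_funM => //; apply/measurable_EFinP; exact: measurable_indic.
- by move=> p u _; rewrite mule_ge0// lee_fin.
rewrite !big_seq; apply: eq_bigr => -[j q]; rewrite mem_paths => /eqP sq.
rewrite ge0_integralZl//; last first.
  by apply/measurable_EFinP; exact: measurable_indic.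
rewrite integral_indic// setIT muleC; congr (_ * _)%E.
have sr : size (rev (j :: q)) = k.+1 by rewrite size_rev/= sq.
by rewrite /= -word_weight_rev; exact: (word_prob word_weight_ge0 word_weight_nil word_weight_cons sr).
Qed.

End stationary_words.

Section stationary_limit.
Context {R : realType} {d : measure_display} {Omega : measurableType d}.
Variables (P : probability Omega R) (n m N : nat) (W : R -> Omega -> 'cV[R]_m).
Variable delta : R.
Hypothesis hW : brownian_motion P W.
Hypothesis delta_gt0 : 0 < delta.
Variable F : 'I_N.+1 -> 'cV[R]_n -> 'cV[R]_m -> 'cV[R]_n.
Hypothesis mF : forall i, measurable_fun setT (fun p : 'cV[R]_n * 'cV[R]_m => F i p.1 p.2).
Local Notation gam := (step_law hW delta_gt0).
Variable lam : 'I_N.+1 -> R.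
Hypothesis lam_ge0 : forall i, 0 <= lam i.
Hypothesis F_contract : forall i x y,
  (\int[gam]_u (hsnorm (F i x u - F i y u) ^+ 2)%:E <=
     (lam i * hsnorm (x - y) ^+ 2)%:E)%E.
Variable C : R.
Hypothesis C_ge0 : 0 <= C.
Hypothesis F_moment : forall i, (\int[gam]_u (hsnorm (F i 0 u) ^+ 2)%:E <= C%:E)%E.
Variables (A : 'M[R]_N.+1) (mu : 'I_N.+1 -> R) (xi : 'cV[R]_N.+1) (rho : R).
Hypothesis A_ge0 : forall i j, 0 <= A i j.
Hypothesis A_sum1 : forall i, \sum_j A i j = 1.
Hypothesis mu_ge0 : forall i, 0 <= mu i.
Hypothesis mu_sum1 : \sum_i mu i = 1.
Hypothesis mu_stat : forall j, \sum_i mu i * A i j = mu j.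
Hypothesis xi_gt0 : forall i, 0 < xi i 0.
Hypothesis rho_ge0 : 0 <= rho.
Hypothesis rho_lt1 : rho < 1.
Hypothesis lam_xi : forall i, lam i * (A *m xi) i 0 <= rho * xi i 0.
Local Notation T := (step_op gam F A).
Local Notation U := (measurableTypeR R).
Local Notation wd := (word (word_weight A mu)).
Local Notation Pr := (backward_space P).
Local Notation E := ('cV[R]_n * 'I_N.+1)%type.

(** The recursion is started at the origin in regime s_k and applies the maps of
    s_k, ..., s_1; the index 0 is given to the latest increment, so that a longer
    past leaves the increments already used in place. *)
Definition backward_value (r : seq 'I_N.+1) (w : Omega) : 'cV[R]_n :=
  drive W delta F 0 (zip (behead (rev r)) (iota 0 (size r).-1)) w.

Definition backward_state k (t : Omega * U) : E :=
  (backward_value (wd k.+1 t.2) t.1, head ord0 (rev (wd k.+1 t.2))).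

Lemma measurable_backward_value r : measurable_fun setT (backward_value r).
Proof. exact: (measurable_drive hW delta_gt0 mF). Qed.

Lemma backward_state_regime k t : (backward_state k t).2 = (backward_state 0 t).2.
Proof.
elim: k => // k <-; rewrite /backward_state [LHS]/= [RHS]/=.
rewrite -[wd k.+2 _]/(_ :: wd k.+1 _) rev_cons.
have : size (rev (wd k.+1 t.2)) = k.+1 by rewrite size_rev size_word.
by case: (rev _).
Qed.

Lemma measurable_backward_state k : measurable_fun setT (backward_state k).
Proof.
apply: (measurable_word_fun A_ge0 mu_ge0 mu_sum1 mu_stat
  (G := fun r w => (backward_value r w, head ord0 (rev r)))) => r.
by apply: measurable_fun_pair => //; exact: measurable_backward_value.
Qed.

(** Renumbering the increments backwards does not change laws, so the state is
    distributed as the chain after k steps from the origin and a stationary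
    regime. *)
Lemma backward_state_law k (f : E -> \bar R) :
  measurable_fun setT f -> (forall z, 0 <= f z)%E ->
  (\int[Pr]_t f (backward_state k t) = \sum_i (mu i)%:E * iter k T f (0%R, i))%E.
Proof.
move=> mf f0.
rewrite (integral_word_fun A_ge0 mu_ge0 mu_sum1 mu_stat P
  (g := fun r w => f (backward_value r w, head ord0 (rev r))))//; last first.
  move=> r; apply: (measurableT_comp mf).
  by apply: measurable_fun_pair => //; exact: measurable_backward_value.
rewrite -(path_expectation hW delta_gt0 mF mu A_ge0 0 (iota_uniq 0 k) (size_iota 0 k) mf f0).
rewrite !big_seq; apply: eq_bigr => -[j q]; rewrite mem_paths => /eqP sq.
by rewrite /backward_value revK size_rev/= sq.
Qed.

Lemma backward_gap : exists2 M, 0 <= M & forall k,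
  (\int[Pr]_t (hsnorm ((backward_state k.+1 t).1 - (backward_state k t).1) ^+ 2)%:E
   <= (M * rho ^+ k)%:E)%E.
Proof.
have [M M0 gap] := gap_sum_bound mF lam_ge0 F_contract F_moment
  A_ge0 mu_ge0 xi_gt0 rho_ge0 lam_xi C_ge0.
exists M => // k; apply: le_trans (gap k).
pose g r w := (hsnorm (backward_value r w - backward_value (behead r) w) ^+ 2)%:E.
have mg r : measurable_fun setT (g r).
  by apply: measurable_hsnorm_sqrB; exact: measurable_backward_value.
have g0 r w : (0 <= g r w)%E by rewrite lee_fin sqr_ge0.
have gE t : (hsnorm ((backward_state k.+1 t).1 - (backward_state k t).1) ^+ 2)%:E =
    g (wd k.+2 t.2) t.1 by [].
rewrite (eq_integral _ _ (fun t _ => gE t)).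
rewrite (integral_word_fun A_ge0 mu_ge0 mu_sum1 mu_stat P k.+1 mg g0).
rewrite big_seq [leRHS]big_seq; apply: lee_sum => p.
rewrite {1}[p]surjective_pairing mem_paths => /eqP sq.
suff -> : (\int[P]_w g (rev (p.1 :: p.2)) w =
    \int[P]_w (hsnorm (drive W delta F 0 (zip p.2 (iota 0 k.+1)) w -
      drive W delta F 0 (zip (take k p.2) (iota 0 k)) w) ^+ 2)%:E)%E by [].
apply: eq_integral => w _; rewrite /g /backward_value revK size_rev.
case/lastP: p.2 sq => [//|q s]; rewrite size_rcons => -[sq].
have -> : behead (rev (p.1 :: rcons q s)) = rev (p.1 :: q).
  by rewrite -rcons_cons rev_rcons.
rewrite revK size_rev /= size_rcons sq.
by rewrite -cats1 take_cat sq ltnn subnn take0 cats0.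
Qed.

(** A substitute for uniform continuity in the first variable that contains the
    Lipschitz functions and is stable under T. *)
Definition arbitrarily_fine_modulus (f : E -> \bar R) : Prop :=
  forall e, 0 < e -> exists2 b, 0 <= b & quadratic_modulus xi f e b.

Lemma arbitrarily_fine_modulus_step f : measurable_fun setT f -> (forall z, 0 <= f z)%E ->
  arbitrarily_fine_modulus f -> arbitrarily_fine_modulus (T f).
Proof.
move=> mf f0 ff e e0; have [b b0 fb] := ff e e0.
exists (rho * b); first exact: mulr_ge0.
exact: (quadratic_modulus_step mF A_ge0 A_sum1 lam_ge0 xi_gt0 lam_xi F_contract (ltW e0) b0 mf f0 fb).
Qed.

Lemma backward_state_cvg : exists2 Xoo : Omega * U -> E, measurable_fun setT Xoo &
  {ae Pr, forall t, (Xoo t).2 = (backward_state 0 t).2 /\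
    hsnorm ((backward_state k t).1 - (Xoo t).1) ^+ 2 @[k --> \oo] --> (0 : R)}.
Proof.
have [M M0 gap] := backward_gap.
have mY k : measurable_fun setT (fun t => (backward_state k t).1).
  exact: measurableT_comp measurable_fst (measurable_backward_state k).
have [Y mYoo cvY] := ae_cvg_geometric_gaps M0 rho_ge0 rho_lt1 mY gap.
exists (fun t => (Y t, (backward_state 0 t).2)).
  apply: measurable_fun_pair => //.
  exact: measurableT_comp measurable_snd (measurable_backward_state 0).
apply: filterS cvY => t ct /=; split=> //.
have -> : (0 : R) = \sum_(i < n) (Y t i 0 - Y t i 0) ^+ 2.
  by rewrite big1// => i _; rewrite subrr expr0n.
have -> : (fun k => hsnorm ((backward_state k t).1 - Y t) ^+ 2) =
    (fun k => \sum_(i < n) ((backward_state k t).1 i 0 - Y t i 0) ^+ 2).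
  apply/funext => k; rewrite hsnorm_sqr; apply: eq_bigr => i _.
  by rewrite big_ord1 !mxE.
apply: (@cvg_big R^o) => [|i _]; first by move=> z; apply: cvgD; [exact: cvg_fst|exact: cvg_snd].
by apply: cvgM; (apply: cvgB; [exact: ct|exact: cvg_cst]).
Qed.

Section limit_law.
Variable Xoo : Omega * U -> E.
Hypothesis mXoo : measurable_fun setT Xoo.
Hypothesis cvXoo : {ae Pr, forall t, (Xoo t).2 = (backward_state 0 t).2 /\
    hsnorm ((backward_state k t).1 - (Xoo t).1) ^+ 2 @[k --> \oo] --> (0 : R)}.

Lemma cvg_backward_expectation f : measurable_fun setT f ->
  (forall z, 0 <= f z)%E -> (forall z, f z <= 1)%E -> arbitrarily_fine_modulus f ->
  (\int[Pr]_t f (backward_state k t))%E @[k --> \oo] --> (\int[Pr]_t f (Xoo t))%E.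
Proof.
move=> mf f0 f1 ff.
have fE z : f z = (fine (f z))%:E.
  by rewrite fineK// ge0_fin_numE// (le_lt_trans (f1 z))// ltry.
have [] // := @dominated_convergence _ _ _ Pr setT measurableT
  (fun k t => f (backward_state k t)) (fun t => f (Xoo t)) (cst 1%E).
- by move=> k; exact: measurableT_comp mf (measurable_backward_state k).
- exact: measurableT_comp mf mXoo.
- apply: filterS cvXoo => t [reg ct] _.
  rewrite fE; apply: cvg_EFin; first by near=> k; rewrite fE.
  apply/cvgrPdist_le => e e0.
  have e2 : 0 < e / 2 by rewrite divr_gt0.
  have [b b0 fb] := ff _ e2.
  pose x := xi (Xoo t).2 0.
  have : b * (x * hsnorm ((backward_state k t).1 - (Xoo t).1) ^+ 2) @[k --> \oo] --> (0 : R).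
    rewrite -[X in _ --> X](mulr0 b); apply: cvgM; first exact: cvg_cst.
    by rewrite -[X in _ --> X](mulr0 x); apply: cvgM => //; exact: cvg_cst.
  move/cvgrPdist_le => /(_ _ e2) near0; near=> k.
  have small : `|0 - b * (x * hsnorm ((backward_state k t).1 - (Xoo t).1) ^+ 2)| <= e / 2.
    by near: k.
  rewrite sub0r normrN in small; have {}small := le_trans (ler_norm _) small.
  have E1 : backward_state k t = ((backward_state k t).1, (Xoo t).2).
    by rewrite reg -(backward_state_regime k) -surjective_pairing.
  have up := fb (backward_state k t).1 (Xoo t).1 (Xoo t).2.
  have dn := fb (Xoo t).1 (backward_state k t).1 (Xoo t).2.
  rewrite -E1 -surjective_pairing (fE (Xoo t)) (fE (backward_state k t)) -!EFinD !lee_fin in up dn.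
  rewrite -hsnormN opprB in dn.
  rewrite -/x in up dn; by rewrite ler_norml /=; apply/andP; split; lra.
- exact: finite_measure_integrable_cst.
- by apply: aeW => t k _; rewrite gee0_abs.
Unshelve. all: by end_near. Qed.

(** Both sides are limits of one sequence: the state with a past of length
    k + 1 integrates f as the state with a past of length k integrates T f. *)
Lemma limit_law_step f : measurable_fun setT f ->
  (forall z, 0 <= f z)%E -> (forall z, f z <= 1)%E -> arbitrarily_fine_modulus f ->
  (\int[Pr]_t f (Xoo t) = \int[Pr]_t T f (Xoo t))%E.
Proof.
move=> mf f0 f1 ff.
have mTf : measurable_fun setT (T f) by exact: measurable_step_op.
have Tf0 z : (0 <= T f z)%E by exact: step_op_ge0.
have Tf1 z : (T f z <= 1)%E by exact: (iter_step_op_le1 gam mF A_ge0 A_sum1 1 mf f0 f1).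
have c1 := cvg_backward_expectation mf f0 f1 ff.
have c2 := cvg_backward_expectation mTf Tf0 Tf1 (arbitrarily_fine_modulus_step mf f0 ff).
have E k : (\int[Pr]_t T f (backward_state k t) = \int[Pr]_t f (backward_state k.+1 t))%E.
  by rewrite !backward_state_law//; under eq_bigr do rewrite -iterSr.
move: c1; rewrite -cvg_shiftS /=.
under eq_fun do rewrite -E.
by move=> c1; exact: (cvg_unique (@ereal_hausdorff R) c1 c2).
Qed.

End limit_law.

End stationary_limit.

(** * Invariance for the chain and for the one-step operator *)

Lemma measurable_fun_switch d d' (T : measurableType d) (T' : measurableType d') N
    (G : 'I_N.+1 -> T -> T') (h : T -> 'I_N.+1) :
  (forall i, measurable_fun setT (G i)) -> measurable_fun setT h ->
  measurable_fun setT (fun t => G (h t) t).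
Proof.
move=> mG mh _ B mB; rewrite setTI.
have -> : (fun t => G (h t) t) @^-1` B =
    \bigcup_(i in [set: 'I_N.+1]) (h @^-1` [set i] `&` G i @^-1` B).
  by apply/seteqP; split=> [t /= Bt|t [i _ [/= <-]]//]; exists (h t).
apply: fin_bigcup_measurable => // i _.
by apply: measurableI; rewrite -[X in measurable X]setTI; [exact: mh|exact: mG].
Qed.

Section one_step_law.
Context {R : realType} {d : measure_display} {Omega : measurableType d}.
Variables (P : probability Omega R) (n m N : nat) (W : R -> Omega -> 'cV[R]_m).
Variables (b : 'cV[R]_n -> 'I_N.+1 -> 'cV[R]_n)
  (sigma : 'cV[R]_n -> 'I_N.+1 -> 'M[R]_(n, m)).
Variables (Pt : R -> 'M[R]_N.+1) (Lam : 'I_N.+1 -> R -> Omega -> 'I_N.+1).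
Variable delta : R.
Hypothesis hW : brownian_motion P W.
Hypothesis hLam : forall i, markov_chain P Pt i (Lam i).
Hypothesis hind : forall i, independent_processes P W (Lam i).
Hypothesis delta_gt0 : 0 < delta.
Hypothesis Pt_ge0 : forall i j, 0 <= Pt delta i j.
Local Notation F := (em_step b sigma delta).
Hypothesis m_em_step : forall i,
  measurable_fun setT (fun p : 'cV[R]_n * 'cV[R]_m => F i p.1 p.2).

Local Notation gam := (step_law hW delta_gt0).
Local Notation T := (step_op gam F (Pt delta)).
Local Notation E := ('cV[R]_n * 'I_N.+1)%type.

(** Realises the kernel T as a random map, so that the image of pi under one
    step is the law of a random variable. *)
Definition one_step (t : E * Omega) : E :=
  (EM b sigma W Lam delta t.1.1 t.1.2 1 t.2, Lam t.1.2 (1%:R * delta) t.2).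

Let mLam i k : measurable_fun setT (Lam i (k%:R * delta)).
Proof. by case: (hLam i) => + _; apply; rewrite mulr_ge0// ltW. Qed.

Lemma measurable_one_step : measurable_fun setT one_step.
Proof.
have mx : measurable_fun setT (fun t : E * Omega => t.1.1).
  exact: measurableT_comp measurable_fst measurable_fst.
have mi : measurable_fun setT (fun t : E * Omega => t.1.2).
  exact: measurableT_comp measurable_snd measurable_fst.
have mL k : measurable_fun setT (fun t : E * Omega => Lam t.1.2 (k%:R * delta) t.2).
  apply: (measurable_fun_switch (G := fun i t => Lam i (k%:R * delta) t.2)) => // i.
  exact: measurableT_comp (mLam i k) measurable_snd.
apply: measurable_fun_pair; last exact: mL.
apply: (measurable_fun_switch
  (G := fun j (t : E * Omega) => F j t.1.1 (increment W delta 0 t.2))) => // j.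
have mz := measurableT_comp (measurable_increment hW delta_gt0 0)
  (@measurable_snd _ _ E Omega).
exact: measurableT_comp (m_em_step j) (measurable_fun_pair mx mz).
Qed.

Lemma measurable_EM x i k : measurable_fun setT (EM b sigma W Lam delta x i k).
Proof.
elim: k => [|k IH]; first exact: measurable_cst.
apply: (measurable_fun_switch (G := fun j w => F j (EM b sigma W Lam delta x i k w)
  (increment W delta k w))) => // j.
have mz := measurable_increment hW delta_gt0 k.
exact: measurableT_comp (m_em_step j) (measurable_fun_pair IH mz).
Qed.

Section next_law.
Variable pi : probability E R.

Let one_step_RV : {RV (pi \x P)%E >-> E} :=
  HB.pack one_step (isMeasurableFun.Build _ _ _ _ _ measurable_one_step).

Definition next_law : probability E R := distribution (pi \x P)%E one_step_RV.

Lemma integral_next_law (f : E -> \bar R) :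
  measurable_fun setT f -> (forall z, 0 <= f z)%E ->
  (\int[next_law]_z f z = \int[pi]_z T f z)%E.
Proof.
move=> mf f0; rewrite ge0_integral_distribution//.
have mf1 : measurable_fun setT (f \o one_step).
  exact: measurableT_comp mf measurable_one_step.
rewrite (fubini_tonelli1 _ mf1); last by move=> t; exact: f0.
apply: eq_integral => -[x i] _; rewrite /fubini_F/=.
exact: (em_expectation hW hLam hind delta_gt0 Pt_ge0 m_em_step x i 1 mf f0).
Qed.

Lemma op_invariant_next_law :
  (forall B, measurable B -> next_law B = pi B) -> op_invariant gam F (Pt delta) pi.
Proof.
move=> nE f mf f0; rewrite -integral_next_law//.
by apply: eq_measure_integral => B mB _; exact/esym/nE.
Qed.

End next_law.

Section invariance.
Variable pi : probability E R.

Let mrect (G : set 'cV[R]_n) (i : 'I_N.+1) :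
  measurable G -> measurable (G `*` [set i] : set E).
Proof. by move=> mG; exact: measurableX. Qed.

Let ind (B : set E) (z : E) : \bar R := (\1_B z)%:E.

Let mind B : measurable B -> measurable_fun setT (ind B).
Proof. by move=> mB; apply/measurable_EFinP; exact: measurable_indic. Qed.

Let ind_ge0 B z : (0 <= ind B z)%E. Proof. by rewrite lee_fin. Qed.

Lemma EM_kernelE k (B : set E) z : measurable B ->
  EM_kernel P b sigma W Lam delta k z B = iter k T (ind B) z.
Proof.
move=> mB; case: z => x i.
rewrite -(em_expectation hW hLam hind delta_gt0 Pt_ge0 m_em_step x i k (mind mB) (ind_ge0 B)).
pose S w := (EM b sigma W Lam delta x i k w, Lam i (k%:R * delta) w).
have mS : measurable_fun setT S by apply: measurable_fun_pair => //; exact: measurable_EM.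
rewrite /EM_kernel -[X in P X]setIT -integral_indic//.
by rewrite -[X in measurable X]setTI; exact: mS.
Qed.

Lemma integral_slices (g : E -> \bar R) :
  measurable_fun setT g -> (forall z, 0 <= g z)%E ->
  (\sum_(j < N.+1) \int[pi]_(z in setT `*` [set j]) g z = \int[pi]_z g z)%E.
Proof.
move=> mg g0; pose S (j : 'I_N.+1) := ([set: 'cV[R]_n] `*` [set j] : set E).
have mS j : measurable (S j) by exact: mrect.
transitivity (\int[pi]_z \sum_j (g z * ind (S j) z))%E; last first.
  apply: eq_integral => -[x i] _; rewrite (bigD1 i)//= /ind indicE mem_set//= mule1.
  rewrite big1 ?adde0// => j ji; rewrite indicE memNset ?mule0//=.
  by move=> [_ /= ij]; rewrite ij eqxx in ji.
rewrite ge0_integral_sum//; last 2 first.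
- by move=> j; apply: emeasurable_funM => //; exact: mind.
- by move=> j z _; rewrite mule_ge0// ind_ge0.
apply: eq_bigr => j _; rewrite [LHS]integral_mkcond epatch_indic.
by apply: eq_integral.
Qed.

Lemma op_invariant_EM : op_invariant gam F (Pt delta) pi ->
  EM_invariant P b sigma W Lam delta pi.
Proof.
move=> ip k G i mG; have mB := mrect i mG.
under eq_bigr do under eq_integral do rewrite EM_kernelE//.
have [mk k0] := iter_step_op_measurable gam m_em_step Pt_ge0 k (mind mB) (ind_ge0 _).
rewrite integral_slices// -(op_invariant_iter m_em_step Pt_ge0 k ip (mind mB) (ind_ge0 _)).
by rewrite integral_indic// setIT.
Qed.

Lemma EM_op_invariant : EM_invariant P b sigma W Lam delta pi ->
  op_invariant gam F (Pt delta) pi.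
Proof.
move=> ei; apply: op_invariant_next_law; apply: measure_ext_orthant => a j.
pose G := [set x : 'cV[R]_n | forall c, x c 0 <= a c 0].
have oE : orthant a j = G `*` [set j] by [].
have mG : measurable G.
  have -> : G = (fun x => (x, j)) @^-1` orthant a j.
    by apply/seteqP; split=> [x /= Gx|x [/= Gx _]//]; split.
  rewrite -[X in measurable X]setTI; apply: measurable_pair2 => //.
  exact: measurable_orthant.
have mB := mrect j mG.
rewrite oE (ei 1%N G j mG).
under [RHS]eq_bigr do under eq_integral do rewrite EM_kernelE//.
rewrite integral_slices//; last 2 first.
- exact: (measurable_step_op gam _ m_em_step (mind mB) (ind_ge0 _)).
- exact: (step_op_ge0 gam F Pt_ge0 (ind_ge0 _)).
rewrite -integral_next_law//; last exact: mind.
by rewrite integral_indic// setIT.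
Qed.

(** Apply invariance to the indicator of a regime. *)
Lemma op_invariant_marginal : op_invariant gam F (Pt delta) pi -> forall j,
  (pi (setT `*` [set j]) = \sum_i (Pt delta i j)%:E * pi (setT `*` [set i]))%E.
Proof.
move=> ip j; rewrite -(integral_state_coord pi (g := fun i => (Pt delta i j)%:E)); last first.
  by move=> i; rewrite lee_fin.
have mB : measurable (setT `*` [set j] : set E) by exact: mrect.
transitivity (\int[pi]_z ind (setT `*` [set j]) z)%E.
  by rewrite integral_indic// setIT.
rewrite (ip _ (mind mB) (ind_ge0 _)); apply: eq_integral => -[x i] _.
rewrite /step_op (bigD1 j)//= /ind.
have one u : (\1_([set: 'cV[R]_n] `*` [set j]) (F i x u, j) : R) = 1.
  by rewrite indicE mem_set.
under eq_integral do rewrite one.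
rewrite integral_cst//= probability_setT mule1 mule1 big1 ?adde0// => l lj.
rewrite integral0_eq ?mule0// => u _; rewrite indicE memNset//.
by move=> [_ /= lE]; rewrite lE eqxx in lj.
Qed.

End invariance.
End one_step_law.

(** * Existence and uniqueness for a contracting step *)

Section unique_invariant_law.
Context {R : realType} {d : measure_display} {Omega : measurableType d}.
Variables (P : probability Omega R) (n m N : nat) (W : R -> Omega -> 'cV[R]_m).
Variables (b : 'cV[R]_n -> 'I_N.+1 -> 'cV[R]_n)
  (sigma : 'cV[R]_n -> 'I_N.+1 -> 'M[R]_(n, m)).
Variables (Q : 'M[R]_N.+1) (Pt : R -> 'M[R]_N.+1) (Lam : 'I_N.+1 -> R -> Omega -> 'I_N.+1).
Variables (mu : 'rV[R]_N.+1) (delta : R).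
Hypothesis hW : brownian_motion P W.
Hypothesis hLam : forall i, markov_chain P Pt i (Lam i).
Hypothesis hind : forall i, independent_processes P W (Lam i).
Hypothesis hPt : transition_function Q Pt.
Hypothesis hQirr : irreducible Q.
Hypothesis hmu : stationary Pt mu.
Hypothesis delta_gt0 : 0 < delta.
Local Notation F := (em_step b sigma delta).
Hypothesis m_em_step : forall i,
  measurable_fun setT (fun p : 'cV[R]_n * 'cV[R]_m => F i p.1 p.2).
Local Notation gam := (step_law hW delta_gt0).
Local Notation A := (Pt delta).
Local Notation T := (step_op gam F A).
Local Notation E := ('cV[R]_n * 'I_N.+1)%type.
Variables (lam : 'I_N.+1 -> R) (C : R) (xi : 'cV[R]_N.+1).
Hypothesis lam_ge0 : forall i, 0 <= lam i.
Hypothesis F_contract : forall i x y,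
  (\int[gam]_u (hsnorm (F i x u - F i y u) ^+ 2)%:E <=
     (lam i * hsnorm (x - y) ^+ 2)%:E)%E.
Hypothesis C_ge0 : 0 <= C.
Hypothesis F_moment : forall i, (\int[gam]_u (hsnorm (F i 0 u) ^+ 2)%:E <= C%:E)%E.
Hypothesis xi_gt0 : forall i, 0 < xi i 0.
Hypothesis lam_xi : forall i, lam i * (A *m xi) i 0 < xi i 0.

Let A_ge0 i j : 0 <= A i j.
Proof. by case: hPt => + _ _ _ _; apply; exact: ltW. Qed.

Let A_sum1 i : \sum_j A i j = 1.
Proof. by case: hPt => _ + _ _ _; apply; exact: ltW. Qed.

Let A_gt0 i j : 0 < A i j.
Proof. exact: (transition_positive hPt hQirr delta_gt0). Qed.

Definition contraction_rate : R := \big[Num.max/0]_i (lam i * (A *m xi) i 0 / xi i 0).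
Local Notation rho := contraction_rate.

Lemma contraction_rate_ge0 : 0 <= rho.
Proof. exact: bigmax_ge_id. Qed.

Lemma contraction_rate_lt1 : rho < 1.
Proof. by apply: bigmax_lt => // i _; rewrite ltr_pdivrMr// mul1r. Qed.

Lemma contraction_rate_le i : lam i * (A *m xi) i 0 <= rho * xi i 0.
Proof. by rewrite -ler_pdivrMr//; exact: (le_bigmax _ (fun i => lam i * (A *m xi) i 0 / xi i 0)). Qed.

(** The law of the backward limit; its invariance is known on the cutoffs by
    limit_law_step, and cutoffs determine a law. *)
Lemma exists_op_invariant : exists pi : probability E R, op_invariant gam F A pi.
Proof.
case: hmu => mu_ge0 mu_sum1 /(_ _ (ltW delta_gt0)) muA.
have mu_stat j : \sum_i mu 0 i * A i j = mu 0 j by rewrite -[in RHS]muA mxE.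
have [Xoo mXoo cvX] := backward_state_cvg m_em_step lam_ge0 F_contract C_ge0 F_moment
  A_ge0 mu_ge0 mu_sum1 mu_stat xi_gt0 contraction_rate_ge0 contraction_rate_lt1
  contraction_rate_le.
have inv := limit_law_step m_em_step lam_ge0 F_contract A_ge0 A_sum1 mu_ge0 mu_sum1
  mu_stat xi_gt0 contraction_rate_ge0 contraction_rate_le mXoo cvX.
pose X : {RV (backward_space P) >-> E} := HB.pack Xoo (isMeasurableFun.Build _ _ _ _ _ mXoo).
exists (distribution (backward_space P) X).
apply: (@op_invariant_next_law _ _ _ _ _ _ _ _ _ _ _ _ _ hW hLam hind delta_gt0 A_ge0 m_em_step).
apply: measure_ext_cutoff => a j k.
set f := fun z => (cutoff a j k z)%:E.
have mf : measurable_fun setT f by apply/measurable_EFinP; exact: measurable_cutoff.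
have f0 z : (0 <= f z)%E by rewrite lee_fin cutoff_ge0.
have f1 z : (f z <= 1)%E by rewrite lee_fin cutoff_le1.
rewrite integral_next_law//.
rewrite ge0_integral_distribution//; last 2 first.
- exact: measurable_step_op.
- exact: step_op_ge0.
rewrite ge0_integral_distribution//.
apply/esym/inv => // e e0.
exact: (lipschitz_quadratic_modulus xi_gt0 e0 (fun x y i => cutoff_lipschitz a j k x y i)).
Qed.

Lemma op_invariant_regime_unique (pi pi' : probability E R) :
  op_invariant gam F A pi -> op_invariant gam F A pi' ->
  forall i, pi (setT `*` [set i]) = pi' (setT `*` [set i]).
Proof.
have finm (p : probability E R) i : p (setT `*` [set i]) \is a fin_num.
  by apply: fin_num_measure; exact: measurableX.
have stat p j : op_invariant gam F A p -> fine (p (setT `*` [set j])) =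
    \sum_i fine (p (setT `*` [set i])) * A i j.
  move=> ip; apply: EFin_inj; rewrite fineK// (op_invariant_marginal A_ge0 ip).
  by rewrite -sumEFin; apply: eq_bigr => i _; rewrite EFinM fineK// muleC.
have mass (p : probability E R) : \sum_i fine (p (setT `*` [set i])) = 1.
  apply: EFin_inj; rewrite -sumEFin.
  have := integral_state_coord p (g := fun=> 1%E) (fun=> lee01).
  rewrite integral_cst//= probability_setT mule1 => ->.
  by apply: eq_bigr => i _; rewrite mul1e fineK.
move=> ip ip' i; rewrite -(fineK (finm pi i)) -(fineK (finm pi' i)); congr EFin.
apply: (positive_stationary_unique A_gt0 A_sum1 (fun j => stat pi j ip)
  (fun j => stat pi' j ip') _ i).
by rewrite !mass.
Qed.

Theorem unique_EM_invariant : exists pi : probability E R,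
  EM_invariant P b sigma W Lam delta pi /\
  forall pi' : probability E R, EM_invariant P b sigma W Lam delta pi' ->
    forall B, measurable B -> pi' B = pi B.
Proof.
have [pi ip] := exists_op_invariant.
exists pi; split; first exact: (op_invariant_EM hLam hind A_ge0 m_em_step ip).
move=> pi' /(EM_op_invariant hW hLam hind delta_gt0 A_ge0 m_em_step) ip'.
apply: (op_invariant_unique m_em_step A_ge0 A_sum1 lam_ge0 xi_gt0 contraction_rate_ge0
  contraction_rate_lt1 contraction_rate_le F_contract ip' ip).
exact: op_invariant_regime_unique.
Qed.

End unique_invariant_law.

Section coefficient_bounds.
Context {R : realType} {n m N : nat}.
Variables (b : 'cV[R]_n -> 'I_N.+1 -> 'cV[R]_n)
  (sigma : 'cV[R]_n -> 'I_N.+1 -> 'M[R]_(n, m)).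
Variables (L : R) (bet : 'I_N.+1 -> R).
Hypothesis L_gt0 : 0 < L.
Hypothesis lip : forall i (x y : 'cV[R]_n),
  hsnorm (b x i - b y i) + hsnorm (sigma x i - sigma y i) <= L * hsnorm (x - y).
Hypothesis one_sided : forall i (x y : 'cV[R]_n),
  2 * inner (x - y) (b x i - b y i) + hsnorm (sigma x i - sigma y i) ^+ 2
    <= bet i * hsnorm (x - y) ^+ 2.

Lemma drift_lipschitz i x y : hsnorm (b x i - b y i) <= L * hsnorm (x - y).
Proof. by apply: le_trans (lip i x y); rewrite lerDl hsnorm_ge0. Qed.

Lemma diffusion_lipschitz i x y : hsnorm (sigma x i - sigma y i) <= L * hsnorm (x - y).
Proof. by apply: le_trans (lip i x y); rewrite lerDr hsnorm_ge0. Qed.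

Lemma measurable_em_step delta i :
  measurable_fun setT (fun p : 'cV[R]_n * 'cV[R]_m => em_step b sigma delta i p.1 p.2).
Proof.
have mb c : measurable_fun setT (fun y => b y i c 0).
  apply: continuous_mx_measurable; apply: (@lipschitz_continuous_mx R _ _ _ L) => x y.
  apply: le_trans (drift_lipschitz i x y).
  by have := coord_le_hsnorm (b x i - b y i) c 0; rewrite !mxE.
have ms c k : measurable_fun setT (fun y => sigma y i c k).
  apply: continuous_mx_measurable; apply: (@lipschitz_continuous_mx R _ _ _ L) => x y.
  apply: le_trans (diffusion_lipschitz i x y).
  by have := coord_le_hsnorm (sigma x i - sigma y i) c k; rewrite !mxE.
have m1 (g : 'cV[R]_n -> R) : measurable_fun setT g ->
    measurable_fun setT (fun p : 'cV[R]_n * 'cV[R]_m => g p.1).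
  by move=> mg; exact: measurableT_comp mg measurable_fst.
apply: measurable_fun_mx => c j; rewrite ord1 /em_step; under eq_fun do rewrite !mxE.
apply: measurable_funD.
  apply: measurable_funD; first exact: (m1 (fun y => y c 0) (measurable_coord _ _)).
  by apply: measurable_funM => //; exact: (m1 (fun y => b y i c 0)).
apply: measurable_sum => k; apply: measurable_funM.
  exact: (m1 (fun y => sigma y i c k)).
exact: measurableT_comp (measurable_coord k 0) measurable_snd.
Qed.

(** The left side is the bound of increment_quadratic for the difference of two
    steps; expanding the square, the one-sided condition controls the terms of
    order delta and the Lipschitz condition the term of order delta^2.  The
    maximum with 0 keeps the rate nonnegative. *)
Lemma em_step_contraction delta i x y : 0 < delta ->
  hsnorm (x - y + delta *: (b x i - b y i)) ^+ 2 +
    delta * hsnorm (sigma x i - sigma y i) ^+ 2 <=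
  Num.max 0 (1 + delta * bet i + delta ^+ 2 * L ^+ 2) * hsnorm (x - y) ^+ 2.
Proof.
move=> d0; rewrite hsnorm_sqrD.
apply: (@le_trans _ _ ((1 + delta * bet i + delta ^+ 2 * L ^+ 2) * hsnorm (x - y) ^+ 2)).
  have h1 := one_sided i x y.
  have h2 : hsnorm (b x i - b y i) ^+ 2 <= L ^+ 2 * hsnorm (x - y) ^+ 2.
    rewrite -exprMn; apply: lerXn2r; rewrite ?nnegrE ?hsnorm_ge0 ?drift_lipschitz//.
    by rewrite mulr_ge0 ?hsnorm_ge0// ltW.
  have {}h1 := ler_wpM2l (ltW d0) h1.
  have {}h2 := ler_wpM2l (sqr_ge0 delta) h2.
  by lra.
by rewrite ler_wpM2r ?sqr_ge0// le_max lexx orbT.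
Qed.

(** Test the one-sided condition on a pair of points at distance 1; in dimension
    0 there is none and the rates are unconstrained. *)
Lemma one_sided_rate_ge i : (0 < n)%N -> - (2 * L) <= bet i.
Proof.
case: n b sigma lip one_sided => // n' b' sigma' lip' os' _.
pose e : 'cV[R]_n'.+1 := delta_mx 0 0.
have he : hsnorm (e - 0) = 1.
  apply/eqP; rewrite -(eqrXn2 (n := 2))// ?hsnorm_ge0// hsnorm_sqr expr1n.
  rewrite (bigD1 0)//= big_ord1 !mxE !eqxx subr0 expr1n big1 ?addr0// => k k0.
  by rewrite big_ord1 !mxE (negbTE k0) subr0 expr0n.
have hin v : inner (e - 0) v = v 0 0.
  rewrite /inner (bigD1 0)//= !mxE !eqxx subr0 mul1r big1 ?addr0// => k k0.
  by rewrite !mxE (negbTE k0) subr0 mul0r.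
have := os' i e 0; rewrite hin he expr1n mulr1 => h.
have := coord_le_hsnorm (b' e i - b' 0 i) 0 0; rewrite ler_norml => /andP[h1 _].
have := lip' i e 0; rewrite he => h2.
have h3 := hsnorm_ge0 (sigma' e i - sigma' 0 i).
have h4 := sqr_ge0 (hsnorm (sigma' e i - sigma' 0 i)).
by lra.
Qed.

End coefficient_bounds.

(** * Euler-Maruyama chains with small step size *)

Theorem theorem3p3 (R : realType) (n m N : nat)
  (* state space S = 'I_N.+1, i.e. N.+1 >= 1 states *)
  (b : 'cV[R]_n -> 'I_N.+1 -> 'cV[R]_n)
  (sigma : 'cV[R]_n -> 'I_N.+1 -> 'M[R]_(n, m))
  (Q : 'M[R]_N.+1) (Pt : R -> 'M[R]_N.+1) (mu : 'rV[R]_N.+1)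
  (hQcons : conservative Q) (hQirr : irreducible Q)
  (hPt : transition_function Q Pt) (hmu : stationary Pt mu)
  (d : measure_display) (Omega : measurableType d) (P : probability Omega R)
  (W : R -> Omega -> 'cV[R]_m) (Lam : 'I_N.+1 -> R -> Omega -> 'I_N.+1)
  (hW : brownian_motion P W)
  (hLam : forall i, markov_chain P Pt i (Lam i))
  (hind : forall i, independent_processes P W (Lam i))
  (L c0 : R) (bet : 'I_N.+1 -> R) (hL : 0 < L) (hc0 : 0 < c0)
  (h1 : forall i (x y : 'cV[R]_n),
     hsnorm (b x i - b y i) + hsnorm (sigma x i - sigma y i)
       <= L * hsnorm (x - y))
  (h2a : forall i (x : 'cV[R]_n),
     2 * inner x (b x i) + hsnorm (sigma x i) ^+ 2
       <= c0 + bet i * hsnorm x ^+ 2)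
  (h2b : forall i (x y : 'cV[R]_n),
     2 * inner (x - y) (b x i - b y i) + hsnorm (sigma x i - sigma y i) ^+ 2
       <= bet i * hsnorm (x - y) ^+ 2)
  (h3 : \sum_i mu 0 i * bet i < 0)
  (h4 : (1 < \big[Order.min/+oo]_(i < N.+1 | (0 < bet i)%R)
               (- Q i i / bet i)%:E)%E)
  (heta : 0 < eta2 Q bet)
  (xi : 'cV[R]_N.+1) (hxi_pos : forall i, 0 < xi i 0)
  (hxi : Q2 Q bet *m xi = - eta2 Q bet *: xi)
  (delta : R) (hd0 : 0 < delta) (hd1 : delta < 1)
  (hd : delta < Num.min (1 / (32 * L ^+ 2))
                        ((eta2 Q bet / beta_const L Q bet xi) ^+ 2)) :
  exists pi : probability ('cV[R]_n * 'I_N.+1)%type R,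
    EM_invariant P b sigma W Lam delta pi /\
    forall pi' : probability ('cV[R]_n * 'I_N.+1)%type R,
      EM_invariant P b sigma W Lam delta pi' ->
      forall A, measurable A -> pi' A = pi A.
Proof.
move: hd; rewrite lt_min => /andP[hdL hdb].
have mem := measurable_em_step h1 delta.
pose C := \sum_i (hsnorm (0 + delta *: b 0 i) ^+ 2 + delta * hsnorm (sigma 0 i) ^+ 2).
have Cterm i : 0 <= hsnorm (0 + delta *: b 0 i) ^+ 2 + delta * hsnorm (sigma 0 i) ^+ 2.
  by rewrite addr_ge0 ?sqr_ge0// mulr_ge0 ?sqr_ge0// ltW.
have C0 : 0 <= C by apply: sumr_ge0.
have moment i : (\int[step_law hW hd0]_u
    (hsnorm (em_step b sigma delta i 0%R u) ^+ 2)%:E <= C%:E)%E.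
  apply: le_trans (increment_quadratic hW hd0 _ _) _.
  by rewrite lee_fin /C (bigD1 i)//= lerDl sumr_ge0.
(* In dimension 0 all distances vanish, so the rate 0 is a valid contraction
   rate; the lower bound on the one-sided rates is available only for n > 0. *)
have [n0|n_gt0] := posnP n.
  have hs0 (v : 'cV[R]_n) : hsnorm v ^+ 2 = 0.
    by rewrite hsnorm_sqr big1// => -[k kn]; exfalso; move: kn; rewrite n0.
  apply: (@unique_EM_invariant _ _ _ _ _ _ _ _ _ _ _ _ _ _ _ hW hLam hind hPt hQirr hmu
    hd0 mem (fun=> 0) C xi _ _ C0 moment hxi_pos) => // [i x y|i].
    by rewrite mul0r; under eq_integral do rewrite hs0; rewrite integral0.
  by rewrite mul0r.
apply: (@unique_EM_invariant _ _ _ _ _ _ _ _ _ _ _ _ _ _ _ hW hLam hind hPt hQirr hmu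
  hd0 mem (fun i => Num.max 0 (1 + delta * bet i + delta ^+ 2 * L ^+ 2)) C xi _ _ C0
  moment hxi_pos) => [i|i x y|i].
- by rewrite le_max lexx.
- have E u : em_step b sigma delta i x u - em_step b sigma delta i y u =
      x - y + delta *: (b x i - b y i) + (sigma x i - sigma y i) *m u.
    by rewrite /em_step mulmxBl scalerBr; apply/matrixP => c j; rewrite !mxE; ring.
  under eq_integral do rewrite E.
  apply: le_trans (increment_quadratic hW hd0 _ _) _.
  by rewrite lee_fin; exact: em_step_contraction.
- apply: (drift_contraction hPt hQcons hxi_pos hxi heta _ _ hL hd0 hd1 hdL hdb) => j.
    move=> bj; apply: lt_le_trans (q0_ge Q j).
    have := lt_le_trans h4 (bigmin_le_cond +oo%E (fun i => (- Q i i / bet i)%:E) bj).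
    by rewrite lte_fin ltr_pdivlMr// mul1r.
  exact: one_sided_rate_ge.
Qed.
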